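(* Let $\Lambda$ be a non-zero measure on the space $\mathcal{H}$ of hyperplanes of $\mathbb{R}^\ell$ that is translation invariant, locally finite, and whose support has the property that there is no line in $\mathbb{R}^\ell$ to which all hyperplanes of the support are parallel. Let $W\subset\mathbb{R}^\ell$ be a window and let $Y\wedge W=((Y\wedge W)_t:t\ge0)$ be the STIT tessellation process on $W$ associated to $\Lambda_{[W]}$. Then for all integers $k\ge1$, all $t\ge0$ and all $A\in\mathcal{B}(\mathbb{T}\wedge W)$, $$\begin{aligned} &\mathbb{P}\big(\#(Y\wedge W)_t=k+1,\ (Y\wedge W)_t\in A\big)\\ &=\sum_{R\in\Theta_k}\int d\widehat\Lambda_{[C(r_0^* )]}(H_1)\int d\widehat\Lambda_{[C(r_1^* )]}(H_2)\cdots\int d\widehat\Lambda_{[C(r_{k-1}^* )]}(H_k)\int_0^t dw_1\int_0^{t-w_1}dw_2\cdots\int_0^{t-\sum_{j=1}^{k-1}w_j}dw_k\\ &\quad\times\left(\prod_{s=0}^{k-1}\Lambda([C(r_s^* )])\right)\exp\left[-\sum_{s=0}^{k-1}\zeta(T^{(s)}(R))\,w_{s+1}\right]\exp\left[-\zeta(T^{(k)}(R))\Big(t-\sum_{j=1}^k w_j\Big)\right]\mathbf{1}_A(T^{(k)}(R)), \end{aligned}$$ where $\#T$ denotes the number of cells of a tessellation $T$, and where, for $R\in\Theta_k$, the words $r^*_s$, the cells $C(r)$ and the tessellations $T^{(s)}(R)$ (which depend on $R$ and on the hyperplanes $H_1,\dots,H_k$) are as defined in the context.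
   Context: Polytopes and tessellations. A polytope is the convex hull of a finite set in $\mathbb{R}^\ell$; a polytope with nonempty interior is called a window, or a cell. A tessellation of a window $W$ is a finite set of cells with pairwise disjoint interiors and union $W$. The set $\mathbb{T}\wedge W$ of tessellations of $W$ carries the $\sigma$-algebra $\mathcal{B}(\mathbb{T}\wedge W)$ generated by the sets $\{T:\partial T\cap A=\emptyset\}$, $A\subseteq W$ compact, where $\partial T=\bigcup_{C\in T}\partial C$. Hyperplanes. Let $\mathbb{S}_+^{\ell-1}$ be the upper half unit sphere of $\mathbb{R}^\ell$. Hyperplanes are written $H(\alpha,u)=\{x:\langle x,u\rangle=\alpha\}$ with $\alpha\in\mathbb{R}$, $u\in\mathbb{S}_+^{\ell-1}$, with closed half-spaces $H^-=\{x:\langle x,u\rangle\le\alpha\}$ and $H^+=\{x:\langle x,u\rangle\ge\alpha\}$. $\mathcal{H}$ is the set of all hyperplanes, with the $\sigma$-algebra induced from the Borel $\sigma$-algebra of the parameter space. For Borel $B\subseteq\mathbb{R}^\ell$, $[B]=\{H\in\mathcal{H}:H\cap B\ne\emptyset\}$. Locally finite means $\Lambda([B])<\infty$ for every bounded Borel $B$. For a cell or window $C$, $\Lambda_{[C]}$ is the restriction of $\Lambda$ to $[C]$, one has $0<\Lambda([C])<\infty$, and $\widehat\Lambda_{[C]}=\Lambda([C])^{-1}\Lambda_{[C]}$. For a tessellation $T$ of $W$, $\zeta(T)=\sum_{C\in T}\Lambda([C])$. Tree indices. $\mathcal{E}=\{-,+\}$; $\mathcal{E}^*=\bigcup_{k\ge0}\mathcal{E}^k$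 is the set of finite words over $\mathcal{E}$, with $\mathcal{E}^0=\{o\}$, $o$ the empty word. The successors of $\vec e$ are $\vec e-$ and $\vec e+$, $\mathrm{Succ}(\vec e)=\{\vec e-,\vec e+\}$; $\mathrm{Pred}(\vec e)$ is the word of which $\vec e\ne o$ is a successor. $\mathcal{E}^*$ is totally ordered by $\le$: shorter words precede longer ones, and words of equal length are ordered lexicographically with $-<+$. The sets $\Theta_k$. For $k\ge0$, $\Theta_k$ is the set of tuples $R=(r_0,\dots,r_{2k})\in(\mathcal{E}^* )^{2k+1}$ with pairwise distinct entries such that $r_0=o$ and for each $l\in\{1,\dots,k\}$ there is $j_l\in\{0,\dots,2l-2\}$ with $(r_{2l-1},r_{2l})=(r_{j_l}-,r_{j_l}+)$. For $R\in\Theta_k$ and $0\le s\le k$ put $R^{(s)}=(r_0,\dots,r_{2s})\in\Theta_s$, and for $0\le s\le k-1$ put $r^*_s=r_{j_{s+1}}$, the word whose successors are $r_{2s+1},r_{2s+2}$ (so $r_0^*=o$). The set of leaves of $R$ is $\mathcal{L}(R)=\{r\in\{r_0,\dots,r_{2k}\}:\mathrm{Succ}(r)\cap\{r_0,\dots,r_{2k}\}=\emptyset\}$. Cells and tessellations in the formula. For $R\in\Theta_k$ and hyperplanes $H_1,\dots,H_k$: $C(o)=W$ and, for $s=0,\dots,k-1$, the cell $C(r^*_s)$ is divided by $H_{s+1}$: $C(r_{2s+1})=C(r_s^* )\cap H_{s+1}^-$, $C(r_{2s+2})=C(r_s^* )\cap H_{s+1}^+$. For $0\le s\le k$, $T^{(s)}(R)=\{C(r):r\in\mathcal{L}(R^{(s)})\}$,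 a tessellation of $W$ with $s+1$ cells (depending on $H_1,\dots,H_s$), for almost all choices of the hyperplanes in the integration. The integrals are iterated, with $H_1$ outermost, $\widehat\Lambda_{[C(r^*_s)]}$ depending on $H_1,\dots,H_s$. STIT process. The STIT tessellation process $Y\wedge W$ on $W$ associated to $\Lambda_{[W]}$ is the following process. Let $(Z(\vec e):\vec e\in\mathcal{E}^* )$ and $(G_n:n\ge1)$ be two independent families of independent random variables with $Z(\vec e)\sim\mathrm{Exponential}(1)$ and $G_n\sim\widehat\Lambda_{[W]}$. Put $C'(o)=W$, $\kappa(o)=1$ and, going through $\mathcal{E}^*$ in increasing order, for $\vec e\neq o$ let $\kappa(\vec e)=\inf\{n: G_n\in[C'(\vec e)],\ n>\max\{\kappa(\vec e\,'):\vec e\,'<\vec e\}\}$; for all $\vec e$ let $H'(\vec e)=G_{\kappa(\vec e)}$, $C'(\vec e-)=C'(\vec e)\cap H'(\vec e)^-$, $C'(\vec e+)=C'(\vec e)\cap H'(\vec e)^+$. The lifetime of $C'(\vec e)$ is $t_l(\vec e)=\Lambda([C'(\vec e)])^{-1}Z(\vec e)$; its birth time is $t_b(o)=0$ and $t_b(\vec e)=t_b(\mathrm{Pred}(\vec e))+t_l(\mathrm{Pred}(\vec e))$ for $\vec e\ne o$. Then $(Y\wedge W)_t=\{C'(\vec e): t_b(\vec e)\le t<t_b(\vec e)+t_l(\vec e)\}$, $t\ge0$. All objects are well-defined almost surely; null events may be ignored. *)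

(* Defs.v *)
From HB Require Import structures.
From mathcomp Require Import all_boot all_order all_algebra.
From mathcomp Require Import all_classical all_reals all_analysis.

Set Implicit Arguments.
Unset Strict Implicit.
Unset Printing Implicit Defensive.

Import Order.TTheory GRing.Theory Num.Theory.
Import numFieldNormedType.Exports.

Local Open Scope classical_set_scope.
Local Open Scope ring_scope.

(* The dimension of the ambient space is l.+1, so that it is at least 1; in
   dimension 0 there is no hyperplane and no non-zero measure on them. *)

Section Geometry.
Context (R : realType) (l : nat).
Local Notation V := 'rV[R]_l.+1.

Definition dotp (x y : V) : R := \sum_i x ord0 i * y ord0 i.

Definition polytope (C : set V) :=
  exists2 S : set V, finite_set S & C = smallest (@convex_set R V) S.

Definition window (C : set V) := polytope C /\ interior C !=set0.

Definition bdry (C : set V) : set V := closure C `\` interior C.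

Definition tessellation (W : set V) (T : set (set V)) :=
  [/\ finite_set T, T `<=` window, trivIset T (fun C => interior C)
    & \bigcup_(C in T) C = W].

Definition tbdry (T : set (set V)) : set V := \bigcup_(C in T) bdry C.

Definition tess_sigma (W : set V) : set (set (set (set V))) :=
  <<s tessellation W,
      [set [set T | tessellation W T /\ tbdry T `&` K = set0]
      | K in [set K | compact K /\ K `<=` W]] >>.

(* Half of the unit sphere containing exactly one of u and -u for each unit
   vector u, so that (alpha, u) |-> H(alpha, u) is a bijection. *)
Definition upper_sphere : set V :=
  [set u | dotp u u = 1 /\
     exists i, 0 < u ord0 i /\ forall j : 'I_l.+1, (i < j)%N -> u ord0 j = 0].

Lemma upper_sphere_nonempty : upper_sphere (delta_mx ord0 ord0).
Proof.
split.
  rewrite /dotp (bigD1 ord0)//= big1 ?addr0; first by rewrite !mxE eqxx mulr1.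
  by move=> i i0; rewrite !mxE (negPf i0) mul0r.
exists ord0; rewrite !mxE eqxx; split=> // j.
by rewrite !mxE/=; have [->|] := eqVneq j ord0; rewrite ?ltnn ?mulr0n.
Qed.

Definition hyp_params : set (R * V) := [set p | upper_sphere p.2].

Definition hyp_space : Type := set_type hyp_params.

HB.instance Definition _ := Topological.on hyp_space.

Lemma hyp_params_nonempty : (0, delta_mx ord0 ord0) \in hyp_params.
Proof. by apply/mem_set; exact: upper_sphere_nonempty. Qed.

HB.instance Definition _ :=
  isPointed.Build hyp_space
    (@exist _ (fun p => p \in hyp_params) _ hyp_params_nonempty).

Definition hyperplane : Type := g_sigma_algebraType (@open hyp_space).

HB.instance Definition _ := Measurable.on hyperplane.

Definition offset (H : hyperplane) : R :=
  (sval (H : {p | p \in hyp_params})).1.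
Definition normal (H : hyperplane) : V :=
  (sval (H : {p | p \in hyp_params})).2.

Definition plane (H : hyperplane) : set V :=
  [set x | dotp x (normal H) = offset H].

Definition hit (B : set V) : set hyperplane :=
  [set H | plane H `&` B !=set0].

End Geometry.

(* The letter - is false and + is true. A word is stored with its LAST letter
   first: the successors of e are false :: e and true :: e, its predecessor is
   behead e, and the empty word o is [::]. *)
Definition word := seq bool.

Definition word_lt (e e' : word) : bool :=
  (size e < size e')%N ||
  (size e == size e') && @Order.lt _ (seqlexi bool) (rev e) (rev e').

Definition half (R : realType) (l : nat) (b : bool) (H : hyperplane R l) :
    set 'rV[R]_l.+1 :=
  if b then [set x | offset H <= dotp x (normal H)]
       else [set x | dotp x (normal H) <= offset H].

(* The cell of the word e when W is successively divided, the cell of each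
   word p being divided by the hyperplane h p. *)
Fixpoint cell (R : realType) (l : nat) (W : set 'rV[R]_l.+1)
    (h : word -> hyperplane R l) (e : word) : set 'rV[R]_l.+1 :=
  if e is b :: p then cell W h p `&` half b (h p) else W.

Section HyperplaneMeasures.
Context (R : realType) (l : nat).
Local Notation V := 'rV[R]_l.+1.
Variable Lam : {measure set (hyperplane R l) -> \bar R}.

Definition translation_invariant :=
  forall (x : V) (S : set (hyperplane R l)), measurable S ->
    Lam [set H' | exists2 H, S H & plane H' = [set y + x | y in plane H]]
    = Lam S.

(* For a Borel set B the set [hit B] is in general only analytic, and Lam is
   meaningful on measurable sets only; [hit B] is measurable for instance for
   every compact B, hence for balls, which cover all bounded sets. *)
Definition locally_finite :=
  forall B : set V, bounded_set B -> <<s (@open V) >> B -> measurable (hit B) ->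
    (Lam (hit B) < +oo)%E.

Definition msupport : set (hyperplane R l) :=
  [set H | forall U : set (hyp_space R l), open U -> U H -> (0 < Lam U)%E].

(* v is the direction of a line: the line is parallel to a hyperplane iff v is
   orthogonal to the normal vector of the hyperplane. *)
Definition no_common_parallel_line :=
  ~ exists2 v : V, v != 0 &
      forall H, msupport H -> dotp v (normal H) = 0.

(* Lam([C]) as a real number; it is finite for the bounded sets C to which it
   is applied, and the convention 0^-1 = 0 used with it in [Lamhat] and
   [lifetime] below only matters on null events. *)
Definition lam (C : set V) : R := fine (Lam (hit C)).

Definition Lamhat (C : set V) (B : set (hyperplane R l)) : \bar R :=
  ((lam C)^-1%:E * Lam (B `&` hit C))%E.

Definition zeta (T : set (set V)) : R := \sum_(C \in T) lam C.

End HyperplaneMeasures.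

Section Independence.
Context d (Omega : measurableType d) (R : realType) (P : probability Omega R).

Definition mutually_independent (I : choiceType) (D : set I)
    (F : I -> set (set Omega)) :=
  forall s : seq I, uniq s -> [set` s] `<=` D ->
  forall E : I -> set Omega, (forall i, i \in s -> F i (E i)) ->
    P (\bigcap_(i in [set` s]) E i) = (\prod_(i <- s) P (E i))%E.

Definition independent (F1 F2 : set (set Omega)) :=
  forall E1 E2, F1 E1 -> F2 E2 -> P (E1 `&` E2) = (P E1 * P E2)%E.

End Independence.

(* The event S has probability p in the completion of P: objects that are only
   defined almost surely give events that are only determined up to a null
   event. *)
Definition prob_mod_null d (Omega : measurableType d) (R : realType)
    (P : probability Omega R) (S : set Omega) (p : \bar R) :=
  exists2 E : set Omega,
    measurable E /\ {ae P, forall omega, S omega <-> E omega} & P E = p.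

Section STIT.
Context (R : realType) (l : nat).
Local Notation V := 'rV[R]_l.+1.
Variables (Lam : {measure set (hyperplane R l) -> \bar R}) (W : set V).

(* Only the variables G n with n >= 1 are used; G 0 is a dummy. *)
Record stit_variables d (Omega : measurableType d) (P : probability Omega R)
    (Z : word -> {RV P >-> R}) (G : nat -> {RV P >-> hyperplane R l}) : Prop := {
  Z_exponential : forall e B, measurable B ->
    distribution P (Z e) B = exponential_prob 1 B;
  G_law : forall n B, (1 <= n)%N -> measurable B ->
    distribution P (G n) B = Lamhat Lam W B;
  Z_independent : mutually_independent P setT
    (fun e => g_sigma_algebra_preimage (Z e));
  G_independent : mutually_independent P [set n | (1 <= n)%N]
    (fun n => g_sigma_algebra_preimage (G n));
  ZG_independent : independent P
    <<s \bigcup_e g_sigma_algebra_preimage (Z e) >>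
    <<s \bigcup_(n in [set n | (1 <= n)%N]) g_sigma_algebra_preimage (G n) >>
}.

Definition kappa_candidates (g : nat -> hyperplane R l) (kap : word -> nat)
    (e : word) : set nat :=
  [set n | hit (cell W (g \o kap) e) (g n) /\
           forall e', word_lt e' e -> (kap e' < n)%N].

Definition kappa_spec (g : nat -> hyperplane R l) (kap : word -> nat) :=
  kap [::] = 1%N /\
  forall e, e != [::] ->
    kappa_candidates g kap e (kap e) /\
    forall n, kappa_candidates g kap e n -> (kap e <= n)%N.

(* [kappa_spec g] determines kappa by recursion along the order of words, and
   is solvable as soon as all the infima are finite (almost surely); on the
   complementary null event the value is irrelevant. *)
Definition kappa (g : nat -> hyperplane R l) : word -> nat :=
  xget (fun=> 0%N) [set kap | kappa_spec g kap].

Definition stit_cell (g : nat -> hyperplane R l) : word -> set V :=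
  cell W (g \o kappa g).

Definition lifetime (z : word -> R) (g : nat -> hyperplane R l) (e : word) : R :=
  (lam Lam (stit_cell g e))^-1 * z e.

Fixpoint birth (z : word -> R) (g : nat -> hyperplane R l) (e : word) : R :=
  if e is _ :: p then birth z g p + lifetime z g p else 0.

Definition stit (z : word -> R) (g : nat -> hyperplane R l) (t : R) :
    set (set V) :=
  [set stit_cell g e
  | e in [set e | birth z g e <= t < birth z g e + lifetime z g e]].

End STIT.

Definition Theta (k : nat) : set ((2 * k).+1.-tuple word) :=
  [set r | let r_ := nth [::] r in
     [/\ uniq r, r_ 0%N = [::]
       & forall s, (s < k)%N -> exists2 j, (j <= 2 * s)%N &
           r_ (2 * s).+1 = false :: r_ j /\ r_ (2 * s).+2 = true :: r_ j]].

Arguments Theta k : clear implicits.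

Definition leaves (r : seq word) : set word :=
  [set e | [&& e \in r, (false :: e) \notin r & (true :: e) \notin r]].

(* r^*_s, the common predecessor of r_(2s+1) and r_(2s+2). *)
Definition rstar (r : seq word) (s : nat) : word :=
  behead (nth [::] r (2 * s).+1).

Section Formula.
Context (R : realType) (l : nat).
Local Notation V := 'rV[R]_l.+1.
Variables (Lam : {measure set (hyperplane R l) -> \bar R}) (W : set V).
Variable r : seq word.

(* hs is the sequence H_1, ..., H_s, so that its entry of index s is H_(s+1):
   it divides the cell of r^*_s. *)
Definition divider (hs : seq (hyperplane R l)) (e : word) : hyperplane R l :=
  nth point hs (index e [seq rstar r s | s <- iota 0 (size hs)]).

Definition rcell (hs : seq (hyperplane R l)) : word -> set V :=
  cell W (divider hs).

Definition rtess (hs : seq (hyperplane R l)) (s : nat) : set (set V) :=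
  [set rcell hs e | e in leaves (take (2 * s).+1 r)].

Local Open Scope ereal_scope.

(* Iterated integral of F over the n hyperplanes following those in hs, the
   first of them being integrated last. *)
Fixpoint int_hyperplanes (n : nat) (hs : seq (hyperplane R l))
    (F : seq (hyperplane R l) -> \bar R) : \bar R :=
  if n is m.+1 then
    \int[Lamhat Lam (rcell hs (rstar r (size hs)))]_H
      int_hyperplanes m (rcons hs H) F
  else F hs.

(* Likewise for the n times following w_1, ..., w_j in ws. *)
Fixpoint int_times (t : R) (n : nat) (ws : seq R) (F : seq R -> \bar R) : \bar R :=
  if n is m.+1 then
    \int[lebesgue_measure]_(w in `[0%R, (t - \sum_(v <- ws) v)%R])
      int_times t m (rcons ws w) F
  else F ws.

Definition stit_density (k : nat) (t : R) (A : set (set (set V)))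
    (hs : seq (hyperplane R l)) (ws : seq R) : R :=
  (\prod_(0 <= s < k) lam Lam (rcell hs (rstar r s))) *
  expR (- \sum_(0 <= s < k) zeta Lam (rtess hs s) * ws`_s) *
  expR (- (zeta Lam (rtess hs k) * (t - \sum_(v <- ws) v))) *
  \1_A (rtess hs k).

End Formula.

(* Main.v *)
(* If the cells alive at time t form a tessellation, then only finitely many
   divisions have occurred, since a word born before t without a descendant alive
   at t would leave the interior of its cell uncovered.  The words divided, in
   order of division, are the r^*_s of a unique R in Theta_k, and the cells alive
   are those of the leaves of R.  The event of the theorem is thus, up to a null
   event, the disjoint union over Theta_k of the events that the divisions up to
   time t are those prescribed by R.

   To compute the probability of one of them, the lifetimes are integrated first,
   conditionally on all hyperplanes, the leaves before the inner nodes and these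
   in reverse order of division: a leaf born at b contributes the factor
   exp (- Lam [C] (t - b)), and the substitution x = Lam [C] (w + c) turns an
   inner lifetime into the time w elapsed since the previous division.  What
   remains is a function of the hyperplanes of the inner nodes.  The search in the
   sequence G gives to the cell of e a hyperplane of law Lamhat_[C(e)] given those
   of the smaller words: if it misses the cell with probability 1 - p, then the
   number of misses is geometric and sum_j (1 - p)^j = 1 / p normalizes the law.
   As the divisions of incomparable words commute by Fubini's theorem, the words
   can be treated in the order of R instead of that of E^*.

   Translation invariance makes hyperplanes that only touch a cell negligible: the
   translates of the set of these hyperplanes along a suitable axis are disjoint
   and hit a common compact set. *)
Require Import Defs.
From HB Require Import structures.
From mathcomp Require Import all_boot all_order all_algebra.
From mathcomp Require Import all_classical all_reals all_analysis.
From mathcomp Require Import measurable_realfun.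
From mathcomp Require Import ring lra zify.

Set Implicit Arguments.
Unset Strict Implicit.
Unset Printing Implicit Defensive.

Import Order.TTheory GRing.Theory Num.Theory.
Import numFieldNormedType.Exports.

Local Open Scope classical_set_scope.
Local Open Scope ring_scope.

(** * Convex hulls and half-spaces *)

(** Two obstacles shape the proof. The map [kappa] is picked by [xget] from a specification that
    concerns all words at once, which gives no measurability. It is replaced by finite sequences of
    values certified one word at a time ([valid]), of which there are only countably many. They also
    require each hyperplane found to split its cell, which keeps all later hitting probabilities
    positive. Conditioning on the variables already seen would involve infinitely many of them.
    Instead of conditional expectations, [Omega] itself is given the smaller sigma-algebra generated
    by these variables, and the identity into it is paired with the next variable. The integrands
    are functions of families indexed by all words. Each integration becomes an operator on such
    functions, [divide] for a hyperplane and [zint] for a lifetime. Iterated integrals are then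
    instances of [foldr], and a change in the order of the words is an exchange of operators. *)

Section Convexity.
Context (R : realType) (l : nat).
Local Notation V := 'rV[R]_l.+1.

Definition cvx (A : set V) := forall x y (a : R), A x -> A y ->
  0 <= a -> a <= 1 -> A (a *: x + (1 - a) *: y).

Lemma convex_setP (A : set V) : @convex_set R V A <-> cvx A.
Proof.
split=> [cA x y a Ax Ay a0 a1|cA x y a]; last first.
  by rewrite !inE => Ax Ay; apply: cA.
have := cA x y (Itv01 a0 a1); rewrite !inE; exact.
Qed.

Definition hull (S : set V) := smallest (@convex_set R V) S.

Lemma hull_cvx S : cvx (hull S).
Proof.
move=> x y a Sx Sy a0 a1 B [Bc SB].
by apply: (convex_setP B).1 => //; [exact: Sx|exact: Sy].
Qed.

Lemma sub_hull S : S `<=` hull S. Proof. exact: sub_gen_smallest. Qed.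

Lemma hull_min S B : cvx B -> S `<=` B -> hull S `<=` B.
Proof. by move=> /convex_setP; exact: smallest_sub. Qed.

Lemma cvx_setI A B : cvx A -> cvx B -> cvx (A `&` B).
Proof. by move=> cA cB x y a [? ?] [? ?] ? ?; split; [exact: cA|exact: cB]. Qed.

Definition affine (f : V -> R) := forall x y a,
  f (a *: x + (1 - a) *: y) = a * f x + (1 - a) * f y.

(** For affine [f] with different values at [a] and [b], the zero of [f] on the line through these
    points. *)
Definition crossing (f : V -> R) (a b : V) : V :=
  (f b - f a)^-1 *: (f b *: a - f a *: b).

Lemma crossing_affine f a b : affine f ->
  f b - f a != 0 -> f (crossing f a b) = 0.
Proof.
move=> fa ba; rewrite (_ : crossing f a b =
  (f b / (f b - f a)) *: a + (1 - f b / (f b - f a)) *: b).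
  by rewrite fa; field.
by apply/rowP => i; rewrite !mxE; field.
Qed.

Lemma crossing_id f a b : f b = 0 -> f a != 0 -> crossing f a b = b.
Proof.
by move=> b0 a0; apply/rowP => i; rewrite /crossing b0 !mxE; field; lra.
Qed.

Lemma crossing_idl f a b : f a = 0 -> f b != 0 -> crossing f a b = a.
Proof.
by move=> b0 a0; apply/rowP => i; rewrite /crossing b0 !mxE; field; lra.
Qed.

(** Projection from the centre [a] onto the zeros of [f] maps segments to segments; the weight of
    [x] is rescaled by the ratio of the heights of [x] and of the projected point above [a]. *)
Lemma crossing_combr f a x y b : affine f -> f a < 0 -> 0 <= f x -> 0 <= f y ->
  0 <= b <= 1 ->
  exists2 m, 0 <= m <= 1 & crossing f a (b *: x + (1 - b) *: y) =
    m *: crossing f a x + (1 - m) *: crossing f a y.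
Proof.
move=> fa a0 x0 y0 /andP[b0 b1].
have z0 : 0 <= f (b *: x + (1 - b) *: y).
  by rewrite fa addr_ge0// mulr_ge0//; lra.
exists (b * (f x - f a) / (f (b *: x + (1 - b) *: y) - f a)).
  apply/andP; split; first by rewrite divr_ge0 ?mulr_ge0//; lra.
  by rewrite ler_pdivrMr ?mul1r ?fa; nra.
apply/rowP => i; rewrite /crossing !mxE fa.
have ? : f x - f a != 0 by lra.
have ? : f y - f a != 0 by lra.
have ? : b * f x + (1 - b) * f y - f a != 0 by rewrite fa in z0; lra.
by field; rewrite ?mulN1r; do ?[apply/andP; split]; lra.
Qed.

Lemma crossing_combl f x y s b : affine f -> 0 < f s -> f x <= 0 -> f y <= 0 ->
  0 <= b <= 1 ->
  exists2 m, 0 <= m <= 1 & crossing f (b *: x + (1 - b) *: y) s =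
    m *: crossing f x s + (1 - m) *: crossing f y s.
Proof.
move=> fa a0 x0 y0 /andP[b0 b1].
have z0 : f (b *: x + (1 - b) *: y) <= 0 by rewrite fa; nra.
exists (b * (f s - f x) / (f s - f (b *: x + (1 - b) *: y))).
  apply/andP; split; first by rewrite divr_ge0 ?mulr_ge0//; lra.
  by rewrite ler_pdivrMr ?mul1r ?fa; nra.
apply/rowP => i; rewrite /crossing !mxE fa.
have ? : f s - f x != 0 by lra.
have ? : f s - f y != 0 by lra.
have ? : f s - (b * f x + (1 - b) * f y) != 0 by rewrite fa in z0; lra.
by field; rewrite ?mulN1r; do ?[apply/andP; split]; lra.
Qed.

(* Vertices of the part of a polytope below a hyperplane: the vertices below it
   and the points where it is crossed by segments between two vertices. *)
Definition section_vertices (f : V -> R) (S : set V) : set V :=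
  (S `&` [set x | f x <= 0]) `|`
  [set crossing f a b | a in S `&` [set x | f x <= 0]
                      & b in S `&` [set x | 0 < f x]].

Lemma finite_section f S : finite_set S -> finite_set (section_vertices f S).
Proof.
move=> fS; rewrite finite_setU; split; first exact: finite_setIl.
by apply: finite_image2; exact: finite_setIl.
Qed.

Lemma cvx_halfspace f : affine f -> cvx [set x | f x <= 0].
Proof. by move=> fa x y a /= ? ? ? ?; rewrite fa; nra. Qed.

Lemma hull_section f S : affine f ->
  hull S `&` [set x | f x <= 0] = hull (section_vertices f S).
Proof.
move=> fa; apply/seteqP; split; last first.
  apply: hull_min.
    by apply: cvx_setI; [exact: hull_cvx|exact: cvx_halfspace].
  move=> z [[Sz z0]|[a [Sa a0] [b [Sb b0] <-]]].
    by split => //; exact: sub_hull.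
  have a0' : f a <= 0 := a0.
  have b0' : 0 < f b := b0.
  split; last by rewrite /= crossing_affine//; lra.
  rewrite (_ : crossing f a b =
    (f b / (f b - f a)) *: a + (1 - f b / (f b - f a)) *: b).
    apply: hull_cvx; [exact: sub_hull|exact: sub_hull| |].
      by rewrite divr_ge0//; lra.
    by rewrite ler_pdivrMr; lra.
  apply/rowP => i; rewrite !mxE; field; lra.
pose K := hull (section_vertices f S).
have Kc : cvx K by exact: hull_cvx.
have KS : section_vertices f S `<=` K by exact: sub_hull.
(* A condition on the points below the hyperplane alone is not preserved by convex combinations. [Q]
   adds that a point above it has its crossings with the points of [K] strictly below in [K]. *)
pose Q := [set x | (f x <= 0 -> K x) /\
  (0 <= f x -> forall a, K a -> f a < 0 -> K (crossing f a x))].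
have Q0 x : f x <= 0 -> K x -> Q x.
  move=> x0 Kx; split=> // x0' a Ka a0; rewrite crossing_id//; lra.
have Qc : cvx Q.
  suff H x y a : Q x -> Q y -> 0 <= a -> a <= 1 -> f x <= f y ->
      Q (a *: x + (1 - a) *: y).
    move=> x y a Qx Qy a0 a1; have [|/ltW] := leP (f x) (f y); first exact: H.
    move=> yx; rewrite addrC -{2}[a](subKr 1); apply: H => //; lra.
  move=> [Kx Qx] [Ky Qy] a0 a1 xy.
  have [y0|y0] := leP (f y) 0.
    by apply: Q0; [rewrite fa; nra|apply: Kc => //; [apply: Kx|apply: Ky]; lra].
  have [x0|x0] := leP 0 (f x).
    split=> [z0|z0 b Kb b0]; last first.
      have [m /andP[m0 m1] ->] := crossing_combr fa b0 x0 (ltW y0)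
        (introT andP (conj a0 a1)).
      by apply: Kc => //; [exact: Qx|apply: Qy => //; exact: ltW].
    have a1' : a = 1 by rewrite fa in z0; nra.
    move: z0; rewrite a1' subrr scale1r scale0r addr0.
    exact: Kx.
  have Kc' : K (crossing f x y) by apply: Qy => //; [lra|apply: Kx; lra].
  have c0 : f (crossing f x y) = 0 by rewrite crossing_affine//; lra.
  have [z0|z0] := leP (f (a *: x + (1 - a) *: y)) 0.
    apply: Q0 => //.
    (* A combination below the hyperplane lies between [x] and the crossing. *)
    rewrite (_ : a *: x + (1 - a) *: y =
      (f (a *: x + (1 - a) *: y) / f x) *: x +
      (1 - f (a *: x + (1 - a) *: y) / f x) *: crossing f x y).
      apply: Kc => //; first by apply: Kx; lra.
        by rewrite ler_ndivlMr// mul0r.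
      by rewrite ler_ndivrMr// mul1r fa; nra.
    by apply/rowP => i; rewrite /crossing fa !mxE; field; apply/andP; split; lra.
  split; first by lra.
  move=> _ b Kb b0.
  pose c := f (a *: x + (1 - a) *: y) / f y.
  (* A combination above it lies between the crossing and [y]. *)
  have E : a *: x + (1 - a) *: y =
      (1 - c) *: crossing f x y + (1 - (1 - c)) *: y.
    apply/rowP => i; rewrite /c /crossing fa !mxE; field.
    by apply/andP; split; lra.
  have c1 : 0 <= 1 - c <= 1.
    rewrite subr_ge0 /c ler_pdivrMr// mul1r lerBlDr lerDl divr_ge0 ?andbT//;
      last by lra.
      by rewrite fa; nra.
    by lra.
  have c0' : 0 <= f (crossing f x y) by rewrite c0.
  have [m /andP[m0 m1]] := crossing_combr fa b0 c0' (ltW y0) c1.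
  rewrite -E => ->; apply: Kc => //; last by apply: Qy => //; exact: ltW.
  by rewrite crossing_id//; lra.
have SQ : S `<=` Q.
  move=> s Ss; have [s0|s0] := leP (f s) 0.
    by apply: Q0 => //; apply: KS; left.
  split; first by lra.
  move=> _ b Kb b0.
  (* With the vertex [s] fixed this set is convex, so that only section vertices [a] need a check;
     those on the hyperplane are their own crossings with [s]. *)
  suff : [set a | f a <= 0 /\ K (crossing f a s)] b by case.
  move: b Kb {b0}; apply: hull_min.
    move=> x y a [x0 Kx] [y0 Ky] a0 a1; split.
      by rewrite fa; nra.
    have [m /andP[m0 m1] ->] := crossing_combl fa s0 x0 y0
        (introT andP (conj a0 a1)).
    exact: Kc.
  move=> a Sa; have Ka := KS _ Sa; case: Sa => [[Sa a0]|[x [Sx x0] [y [Sy y0] E]]].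
    by split => //; apply: KS; right; exists a => //; exists s.
  have x0' : f x <= 0 := x0.
  have y0' : 0 < f y := y0.
  have a0 : f a = 0 by rewrite -E crossing_affine//; lra.
  by split; [rewrite a0|rewrite crossing_idl//; lra].
by move=> x [/(hull_min Qc SQ) [+ _]]; exact.
Qed.

Definition joins (p : R * V) (a : V) : V := p.1 *: a + (1 - p.1) *: p.2.

(** Makes the hull of a finite set an iterated continuous image of compact sets. The point [a] is
    listed apart because [hull S] may be empty. *)
Lemma hull_cons a (S : set V) : hull (a |` S) =
  a |` [set joins p a | p in `[0, 1]%classic `*` hull S].
Proof.
apply/seteqP; split; last first.
  move=> _ [->|[[c k] [/= + Kk] <-]]; first by apply: sub_hull; left.
  rewrite in_itv/= => /andP[c0 c1]; apply: hull_cvx => //.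
    by apply: sub_hull; left.
  by apply: hull_min Kk; [exact: hull_cvx|move=> x Sx; apply: sub_hull; right].
have Kc : cvx (hull S) by exact: hull_cvx.
set U := (X in _ `<=` X).
(* Weight 1 on [a] covers the exceptional point, and [k] is then arbitrary. *)
have UE x : U x <-> exists c k, [/\ 0 <= c, c <= 1, (c < 1 -> hull S k) &
    x = c *: a + (1 - c) *: k].
  split=> [[->|[[c k] [/= + Kk] <-]]|[c [k [c0 c1 ck ->]]]].
  - by exists 1, 0; split => //; rewrite ?ltxx// scaler0 scale1r addr0.
  - by rewrite in_itv/= => /andP[c0 c1]; exists c, k.
  - have [c1'|c1'] := ltP c 1.
      right; exists (c, k) => //; split; last exact: ck.
      by rewrite /= in_itv/= c0.
    by left; rewrite (_ : c = 1) ?subrr ?scale0r ?addr0 ?scale1r//; lra.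
apply: hull_min; last first.
  move=> x [->|Sx]; [by left|right].
  exists (0, x); first by split; rewrite /= ?in_itv/= ?lexx ?ler01//; exact: sub_hull.
  by rewrite /joins/= scale0r add0r subr0 scale1r.
move=> x y b /UE[c [k [c0 c1 ck ->]]] /UE[d [m [d0 d1 dm ->]]] b0 b1.
apply/UE.
(* The total weight that the combination puts on [hull S]. *)
pose g := b * (1 - c) + (1 - b) * (1 - d).
have [g0|g0] := eqVneq g 0.
  exists 1, 0; split => //; first by rewrite ltxx.
  have bc : b * (1 - c) = 0 by rewrite /g in g0; nra.
  have bd : (1 - b) * (1 - d) = 0 by rewrite /g in g0; nra.
  apply/rowP => i; rewrite !mxE; transitivity (a ord0 i +
    b * (1 - c) * (k ord0 i - a ord0 i) +
    (1 - b) * (1 - d) * (m ord0 i - a ord0 i)); first by ring.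
  by rewrite bc bd; ring.
have g0' : 0 < g by rewrite lt_neqAle eq_sym g0/= /g; nra.
have g1 : g <= 1 by rewrite /g; nra.
pose e := b * (1 - c) / g.
exists (1 - g), (e *: k + (1 - e) *: m); split; [lra|lra| |]; last first.
  by apply/rowP => i; rewrite !mxE /e /g; field.
move=> _.
have e0 : 0 <= e by rewrite /e divr_ge0 ?(ltW g0')// mulr_ge0// subr_ge0.
have e1 : e <= 1.
  by rewrite /e ler_pdivrMr// mul1r /g lerDl mulr_ge0// subr_ge0.
have [e00|e00] := eqVneq e 0.
  rewrite e00 subr0 scale0r add0r scale1r; apply: dm.
  rewrite lt_neqAle d1 andbT; apply: contra_neq g0 => d1'.
  move: e00; rewrite /e => /eqP; rewrite mulf_eq0 invr_eq0 => /orP[/eqP|/eqP//].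
  by rewrite /g d1'; lra.
have [e11|e11] := eqVneq e 1.
  rewrite e11 subrr scale0r addr0 scale1r; apply: ck.
  rewrite lt_neqAle c1 andbT; apply: contra_neq e00 => c1'.
  by rewrite /e c1' subrr mulr0 mul0r.
apply: Kc => //.
  apply: ck; rewrite lt_neqAle c1 andbT; apply: contra_neq e00 => c1'.
  by rewrite /e c1' subrr mulr0 mul0r.
apply: dm; rewrite lt_neqAle d1 andbT; apply: contra_neq e11 => d1'.
by rewrite /e /g d1' subrr mulr0 addr0 divff//; rewrite /g d1' in g0; lra.
Qed.

Lemma compact_hull (S : set V) : finite_set S -> compact (hull S).
Proof.
move=> /finite_seqP[s ->]; elim: s => [|a s IH].
  rewrite (_ : hull _ = set0); first exact: compact0.
  by apply/seteqP; split => //; apply: hull_min.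
have -> : [set` a :: s] = a |` [set` s].
  by apply/seteqP; split => x /=; rewrite inE; [move=> /predU1P|move=> H; apply/predU1P].
rewrite hull_cons; apply: compactU; first exact: compact_set1.
apply: continuous_compact.
  apply: continuous_subspaceT => -[c k]; rewrite /joins/=.
  apply: cvgD; first by apply: cvgZr_tmp; exact: cvg_fst.
  apply: cvgZ; last exact: cvg_snd.
  by apply: cvgB; [exact: cvg_cst|exact: cvg_fst].
by apply: compact_setX => //; exact: segment_compact.
Qed.

End Convexity.

(** * Cells and binary trees *)

Section Cells.
Context (R : realType) (l : nat).
Local Notation V := 'rV[R]_l.+1.
Local Notation hyp := (hyperplane R l).
Implicit Types (H : hyp) (h : word -> hyp) (e p : word).

Lemma dotpDl (x y u : V) : dotp (x + y) u = dotp x u + dotp y u.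
Proof.
by rewrite /dotp -big_split; apply: eq_bigr => i _; rewrite mxE mulrDl.
Qed.

Lemma dotpZl a (x u : V) : dotp (a *: x) u = a * dotp x u.
Proof.
by rewrite /dotp mulr_sumr; apply: eq_bigr => i _; rewrite mxE mulrA.
Qed.

Lemma dotpC (x u : V) : dotp x u = dotp u x.
Proof. by apply: eq_bigr => i _; rewrite mulrC. Qed.

Lemma dotp_continuous (u : V) : continuous (fun x : V => dotp x u).
Proof.
apply: (@continuous_big R^o _ +%R 0 xpredT _ V _
  (fun i x => x ord0 i * u ord0 i)); first exact: (@add_continuous R^o).
move=> i _ x; apply: continuousM; last exact: cst_continuous.
exact: (@coord_continuous R 1 l.+1 ord0 i x).
Qed.

Lemma normal_unit H : dotp (normal H) (normal H) = 1.
Proof. by have /set_mem[] := valP H. Qed.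

Definition sdist (b : bool) H (x : V) : R :=
  if b then dotp x (normal H) - offset H else offset H - dotp x (normal H).

Lemma half_sdist b H : Defs.half b H = [set x | 0 <= sdist b H x].
Proof. by apply/seteqP; split => x; case: b => /=; rewrite subr_ge0. Qed.

Lemma sdist_affine b H : affine (sdist b H).
Proof. by move=> x y a; case: b => /=; rewrite dotpDl !dotpZl; ring. Qed.

Lemma sdistN b H x : sdist (~~ b) H x = - sdist b H x.
Proof. by case: b => /=; rewrite opprB. Qed.

Lemma sdist_continuous b H : continuous (sdist b H).
Proof.
case: b => x.
- apply: (continuousB (f := fun x => dotp x (normal H)) (g := cst (offset H)));
    by [exact: cst_continuous|exact: dotp_continuous].
- apply: (continuousB (g := fun x => dotp x (normal H)) (f := cst (offset H)));
    by [exact: cst_continuous|exact: dotp_continuous].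
Qed.

Lemma half_closed b H : closed (Defs.half b H).
Proof.
rewrite half_sdist (_ : [set _ | _] = sdist b H @^-1` [set y | 0 <= y])//.
by apply: closed_comp => [x _|]; [exact: sdist_continuous|exact: closed_ge].
Qed.

Lemma half_cvx b H : cvx (Defs.half b H).
Proof.
rewrite half_sdist => x y a /= x0 y0 a0 a1; rewrite sdist_affine.
by rewrite addr_ge0// mulr_ge0// subr_ge0.
Qed.

Lemma sdist_move b H x a : sdist b H (x + a *: normal H) =
  sdist b H x + (if b then a else - a).
Proof. by case: b => /=; rewrite dotpDl dotpZl normal_unit; ring. Qed.

Lemma near_line (x u : V) (A : set V) : nbhs x A ->
  exists2 a : R, 0 < a & forall b, `|b| < a -> A (x + b *: u).
Proof.
move=> xA; have : \forall b \near (0 : R), A (x + b *: u).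
  have : (fun b : R => x + b *: u) b @[b --> (0 : R)] --> x.
    rewrite -[X in _ --> X]addr0 -[X in _ + X](scale0r u).
    by apply: cvgD; [exact: cvg_cst|apply: cvgZr_tmp; exact: cvg_id].
  by apply.
move=> /nbhs_ballP[a/= a0 aA]; exists a => // b ba; apply: aA.
by rewrite -ball_normE/= sub0r normrN.
Qed.

Lemma half_interior b H : (Defs.half b H)° = [set x | 0 < sdist b H x].
Proof.
rewrite half_sdist; apply/seteqP; split => [x xH|x x0] /=.
  have [a a0 aH] := near_line (normal H) xH.
  have /= := aH (if b then - (a / 2) else a / 2).
  rewrite (_ : `|_| = a / 2); last first.
    by case: (b); rewrite ?normrN ger0_norm// ltW// divr_gt0.
  have a2 : a / 2 < a by lra.
  by rewrite sdist_move => /(_ a2); case: (b) => /= ?; lra.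
have : open [set x | 0 < sdist b H x].
  rewrite (_ : [set _ | _] = sdist b H @^-1` [set y | 0 < y])//.
  by apply: open_comp => [y _|]; [exact: sdist_continuous|exact: open_gt].
rewrite openE => /(_ _ x0); apply: filterS => y /=; exact: ltW.
Qed.

(** The least signed distance from [x] to the hyperplanes on the path to [e], capped at 1. It turns
    cells and their interiors into inequalities that are continuous in [x] and measurable in [h]. *)
Fixpoint margin h e (x : V) : R :=
  if e is b :: p then Num.min (margin h p x) (sdist b (h p) x) else 1.

Lemma margin_continuous h e : continuous (margin h e).
Proof.
elim: e => [|b p IH] x /=; first exact: cst_continuous.
by apply: continuous_min; [exact: IH|exact: sdist_continuous].
Qed.

Lemma cellE W h e : cell W h e = W `&` [set x | 0 <= margin h e x].
Proof.
elim: e => [|b p IH] /=.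
  by rewrite (_ : [set _ | _] = setT) ?setIT//; apply/seteqP; split => x //= _.
rewrite IH half_sdist; apply/seteqP; split => x /=; rewrite le_min.
  by move=> [[? ->] ->].
by move=> [? /andP[]].
Qed.

Lemma cell_interiorE W h e :
  (cell W h e)° = W° `&` [set x | 0 < margin h e x].
Proof.
elim: e => [|b p IH] /=.
  by rewrite (_ : [set _ | _] = setT) ?setIT//; apply/seteqP; split => x //= _.
rewrite interiorI IH half_interior; apply/seteqP; split => x /=; rewrite lt_min.
  by move=> [[? ->] ->].
by move=> [? /andP[]].
Qed.

Lemma cell_sub W h e : cell W h e `<=` W.
Proof. by rewrite cellE => x []. Qed.

Lemma eq_margin h h' e : (forall p b, suffix (b :: p) e -> h p = h' p) ->
  margin h e = margin h' e.
Proof.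
elim: e => //= b p IH hh; rewrite (hh p b) ?suffix_refl// IH// => q c qp.
by apply: (hh _ c); exact: suffix_trans (suffix_cons _ _).
Qed.

Lemma eq_cell W h h' e : (forall p b, suffix (b :: p) e -> h p = h' p) ->
  cell W h e = cell W h' e.
Proof. by move=> hh; rewrite !cellE (eq_margin hh). Qed.

Lemma margin_suffix h p e x : suffix p e -> margin h e x <= margin h p x.
Proof.
move=> /suffixP[s ->]; elim: s => //= b s; apply: le_trans.
by rewrite ge_min lexx.
Qed.

Lemma suffix_cons_neq (b : bool) p e : suffix p (b :: e) -> p != b :: e ->
  suffix p e.
Proof.
move=> /suffixP[[|c s]] /=; first by move=> ->; rewrite eqxx.
by move=> [_ ->] _; exact: suffix_suffix.
Qed.

(** As the last letter is stored first, [suffix p e] means that [p] is [e] or an ancestor of [e].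
    Incomparable words separate at their last common ancestor. *)
Lemma suffix_split e e' : ~~ suffix e e' -> ~~ suffix e' e ->
  exists p b, suffix (b :: p) e /\ suffix (~~ b :: p) e'.
Proof.
elim: e => [|b p IH]; first by rewrite suffix0s.
move=> ee' e'e; have [pe'|pe'] := boolP (suffix p e').
  exists p, b; split; first exact: suffix_refl.
  move/suffixP : pe' => [s es]; move: ee' e'e; rewrite es {es}.
  case/lastP : s => [|s c]; first by rewrite cat0s suffix_cons.
  rewrite cat_rcons => ee' _; rewrite (_ : ~~ b = c) ?suffix_suffix//.
  move: b c ee' => [] [] //; by rewrite suffix_suffix.
have /(IH pe')[q [c [qp qe]]] : ~~ suffix e' p.
  by apply: contra e'e => e'p; exact: suffix_trans (suffix_cons _ _).
by exists q, c; split => //; exact: suffix_trans (suffix_cons _ _).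
Qed.

Lemma margin_disjoint h e e' x : ~~ suffix e e' -> ~~ suffix e' e ->
  0 < margin h e x -> 0 < margin h e' x -> False.
Proof.
move=> ee' e'e; have [p [b [be be']]] := suffix_split ee' e'e.
move=> /lt_le_trans/(_ (margin_suffix h x be)) /= + /lt_le_trans
  /(_ (margin_suffix h x be')) /=.
by rewrite !lt_min sdistN => /andP[_ +] /andP[_ +]; lra.
Qed.

(** The homothety with centre [x] and small ratio [b] maps a ball around [y] inside [A] to a ball
    inside [A] close to [x]. *)
Lemma cvx_interior_meets (A U : set V) x : cvx A -> A° !=set0 -> A x ->
  nbhs x U -> U `&` A° !=set0.
Proof.
move=> Ac [y Ay] Ax xU.
have [a a0 aU] := near_line (y - x) xU.
pose b := Num.min (a / 2) 1.
have b0 : 0 < b by rewrite lt_min divr_gt0//=.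
have b1 : b <= 1 by rewrite ge_min lexx orbT.
have ba : b < a.
  apply: (@le_lt_trans _ _ (a / 2)); first by rewrite ge_min lexx.
  by rewrite ltr_pdivrMr// mulr2n mulrDr mulr1 ltrDl.
exists (x + b *: (y - x)); split; first by apply: aU; rewrite gtr0_norm.
have [e /= e0 eA] := (nbhs_ballP y A).1 Ay.
apply/nbhs_ballP; exists (b * e) => /=; first by rewrite mulr_gt0.
move=> z; rewrite -ball_normE/= => ze.
rewrite (_ : z = b *: (y + b^-1 *: (z - (x + b *: (y - x)))) + (1 - b) *: x).
  apply: Ac => //; last exact: ltW.
  apply: eA; rewrite -ball_normE/= opprD addrA subrr sub0r normrN normrZ.
  by rewrite gtr0_norm ?invr_gt0// -normrN opprB ltr_pdivrMl.
by apply/rowP => i; rewrite !mxE; field; rewrite gt_eqF.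
Qed.

Lemma cvx_cell W h e : cvx W -> cvx (cell W h e).
Proof.
by move=> cW; elim: e => //= b p IH; apply: cvx_setI => //; exact: half_cvx.
Qed.

Lemma compact_cell W h e : compact W -> compact (cell W h e).
Proof.
move=> cW; elim: e => //= b p IH.
apply: (@subclosed_compact _ _ (cell W h p)) => //.
apply: closedI; last exact: half_closed.
by apply: compact_closed IH; exact: norm_hausdorff.
Qed.

Lemma polytope_cell W h e : polytope W -> polytope (cell W h e).
Proof.
move=> pW; elim: e => //= b p [S fS ->].
exists (section_vertices (sdist (~~ b) (h p)) S); first exact: finite_section.
rewrite -[RHS]/(hull _) -hull_section; last exact: sdist_affine.
congr (_ `&` _); rewrite half_sdist; apply/seteqP.
by split => x /=; rewrite sdistN oppr_le0.
Qed.

End Cells.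

Section Trees.
Context (R : realType) (l : nat) (W : set 'rV[R]_l.+1).
Hypothesis W_polytope : polytope W.
Local Notation V := 'rV[R]_l.+1.
Local Notation hyp := (hyperplane R l).
Implicit Types (h : word -> hyp) (e p : word) (es : seq word).

Lemma polytope_compact : compact W.
Proof. by case: W_polytope => S fS ->; exact: compact_hull. Qed.

Lemma polytope_cvx : cvx W.
Proof. by case: W_polytope => S fS ->; exact: hull_cvx. Qed.

Definition nondeg h e := (cell W h e)° !=set0.

Definition prefix_closed es := forall b p, b :: p \in es -> p \in es.

(* The leaves of the binary tree with set of inner nodes es. *)
Definition tree_leaf es e :=
  (e \notin es) && (if e is _ :: p then p \in es else true).

Definition tree_tess h es : set (set V) :=
  [set cell W h e | e in [set e | tree_leaf es e]].

Lemma prefix_closed_suffix es p e : prefix_closed es ->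
  suffix p e -> e \in es -> p \in es.
Proof.
move=> pc /suffixP[s ->]; elim: s => //= b s IH bs; apply: IH; exact: pc bs.
Qed.

Lemma tree_leaf_incomparable es e e' : prefix_closed es ->
  tree_leaf es e -> tree_leaf es e' -> e != e' -> ~~ suffix e e'.
Proof.
move=> pc /andP[ees _] /andP[_]; case: e' => [|b p] pes ee'.
  by rewrite suffixs0.
apply: contra ees => /suffix_cons_neq/(_ ee') ep.
exact: prefix_closed_suffix ep pes.
Qed.

Lemma finite_tree_leaf es : finite_set [set e | tree_leaf es e].
Proof.
apply: (@sub_finite_set _ _ [set` [::] :: allpairs cons [:: false; true] es]);
  last exact: finite_seq.
move=> [|b p] /andP[_ pes] /=; rewrite inE//.
apply/orP; right; rewrite !mem_cat in_nil orbF.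
by case: b; rewrite (map_f (cons _)) ?orbT.
Qed.

(** The descent from [e], always on a side containing [x], ends because the length of [es] bounds
    the depth of the inner nodes. *)
Lemma tree_cover h es e x : (forall p, p \in es -> (size p < size es)%N) ->
  (if e is _ :: p then p \in es else true) -> cell W h e x ->
  exists2 e', tree_leaf es e' & suffix e e' /\ cell W h e' x.
Proof.
move=> sz; move nE : (size es - size e)%N => n.
elim: n e nE => [|n IH] e nE ep ex.
  have [ees|ees] := boolP (e \in es).
    by have := sz _ ees; lia.
  by exists e; [rewrite /tree_leaf ees|rewrite suffix_refl].
have [ees|ees] := boolP (e \in es); last first.
  by exists e; [rewrite /tree_leaf ees|rewrite suffix_refl].
have [b bx] : exists b, Defs.half b (h e) x.
  have [|] := leP (dotp x (normal (h e))) (offset (h e)).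
    by exists false.
  by exists true => /=; exact: ltW.
have [] := IH (b :: e) => //=.
  by have := sz _ ees; lia.
move=> e' e'l [be e'x]; exists e' => //; split => //.
by apply: suffix_trans be; exact: suffix_cons.
Qed.

(** The leaf cells always cover [W] and have disjoint interiors, so that only their nondegeneracy is
    at stake. *)
Lemma tree_tessP h es : prefix_closed es ->
  (forall p, p \in es -> (size p < size es)%N) ->
  tessellation W (tree_tess h es) <->
  (forall e, tree_leaf es e -> nondeg h e).
Proof.
move=> pc sz; split=> [[_ TW _ _] e el|nd].
  by have [] := TW (cell W h e); [exists e|].
split.
- exact/finite_image/finite_tree_leaf.
- by move=> _ [e el <-]; split; [exact: polytope_cell|exact: nd].
- move=> _ _ [e el <-] [e' el' <-] [x []].
  rewrite !cell_interiorE => -[_ xe] [_ xe'].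
  have [->//|ee'] := eqVneq e e'.
  exfalso; apply: margin_disjoint xe xe'.
    exact: (tree_leaf_incomparable pc).
  by apply: (tree_leaf_incomparable pc); rewrite // eq_sym.
- apply/seteqP; split => [x [_ [e el <-]] /cell_sub//|x Wx].
  have [//|e el [_ ex]] := @tree_cover h es [::] x sz isT.
  by exists (cell W h e) => //; exists e.
Qed.

(** A boundary point of one leaf cell is not interior to another one, since interior points of the
    first cell accumulate at it. Boundaries are thereby expressed through margins. *)
Lemma tree_tbdry h es (K : set V) : prefix_closed es ->
  (forall p, p \in es -> (size p < size es)%N) ->
  (forall e, tree_leaf es e -> nondeg h e) -> K `<=` W ->
  tbdry (tree_tess h es) `&` K = set0 <->
  (forall x, K x -> exists2 e, tree_leaf es e & (cell W h e)° x).
Proof.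
move=> pc sz nd KW; split=> [bK x Kx|bK].
  have [e el [_ ex]] := @tree_cover h es [::] x sz isT (KW _ Kx).
  exists e => //; apply: contrapT => nex.
  suff : (tbdry (tree_tess h es) `&` K) x by rewrite bK.
  split => //; exists (cell W h e); first by exists e.
  by split => //; exact: subset_closure.
apply/eqP; apply/negP => /negP/set0P[x [[_ [e' el' <-]] [e'x ne'x] Kx]].
have [e el ex] := bK x Kx.
have [ee'|ee'] := eqVneq e e'; first by apply: ne'x; rewrite -ee'.
have e'x' : cell W h e' x.
  by apply: (compact_closed (@norm_hausdorff _ _)
    (compact_cell (h:=h) (e:=e') polytope_compact)).
have [y [ye ye']] := cvx_interior_meets (cvx_cell (h:=h) (e:=e') polytope_cvx)
  (nd _ el') e'x' (nbhs_interior ex).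
move: ye ye'; rewrite !cell_interiorE => -[_ ye] [_ ye'].
apply: margin_disjoint ye ye'.
  exact: (tree_leaf_incomparable pc).
by apply: (tree_leaf_incomparable pc); rewrite // eq_sym.
Qed.

End Trees.

(** * Measurability of geometric events *)

Section RealSets.
Context d (T : measurableType d) (R : realType).
Implicit Types (f g : T -> R).

Lemma measurable_ltc f c : measurable_fun setT f ->
  measurable [set t | f t < c].
Proof.
move=> mf; rewrite -[X in measurable X]setTI
  (_ : [set _ | _] = f @^-1` `]-oo, c[%classic); first exact: mf.
by apply/seteqP; split => t /=; rewrite in_itv.
Qed.

Lemma measurable_gtc f c : measurable_fun setT f ->
  measurable [set t | c < f t].
Proof.
move=> mf; rewrite -[X in measurable X]setTI
  (_ : [set _ | _] = f @^-1` `]c, +oo[%classic); first exact: mf.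
by apply/seteqP; split => t /=; rewrite in_itv/= andbT.
Qed.

Lemma measurable_pred (P : Prop) : measurable [set _ : T | P].
Proof.
have [p|p] := pselect P.
  by rewrite (_ : [set _ | P] = setT)//; apply/seteqP; split.
by rewrite (_ : [set _ | P] = set0)//; apply/seteqP; split.
Qed.

End RealSets.

Section Density.
Context (R : realType) (n : nat).
Local Notation V := 'rV[R]_n.

Lemma rat_dense_rV (x : V) (e : R) : 0 < e ->
  exists q : 'rV[rat]_n, ball x e (map_mx ratr q).
Proof.
move=> e0; have : forall i, exists q : rat, `|x ord0 i - ratr q| < e.
  move=> i; have xe : x ord0 i < x ord0 i + e by rewrite ltrDl.
  have [q] := rat_in_itvoo xe.
  rewrite in_itv/= => /andP[q1 q2]; exists q.
  by rewrite distrC ger0_norm ?ltrBlDl// subr_ge0 ltW.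
move=> /(@fin_all_exists 'I_n (fun=> rat)) [q xq]; exists (\row_i q i).
split => // i j; rewrite !mxE (ord1 i) -ball_normE; exact: xq.
Qed.

(** One point of [K] is chosen in each rational ball that meets [K]. The other balls receive the
    default 0, hence membership in [K] is part of the conclusion. *)
Lemma countable_dense_subset (K : set V) :
  exists c : 'rV[rat]_n * nat -> V,
    forall x (e : R), K x -> 0 < e -> exists2 i, K (c i) & ball x e (c i).
Proof.
pose c (p : 'rV[rat]_n * nat) : V :=
  xget 0 (K `&` ball (map_mx ratr p.1 : V) p.2.+1%:R^-1).
exists c => x e Kx e0.
have e20 : 0 < e / 2 by rewrite divr_gt0.
have [m] := ltr_add_invr e20; rewrite add0r => me.
have m0 : 0 < m.+1%:R^-1 :> R by rewrite invr_gt0.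
have [q xq] := rat_dense_rV x m0.
have [] := @xgetI _ 0 (K `&` ball (map_mx ratr q : V) m.+1%:R^-1) x.
  by split => //; exact: ball_sym.
move=> Kc bc; exists (q, m) => //.
apply: (@le_ball _ _ _ (m.+1%:R^-1 + m.+1%:R^-1)).
  by rewrite [leRHS]splitr lerD// ltW.
exact: ball_triangle xq bc.
Qed.

End Density.

Section CompactProjection.
Context d (T : measurableType d) (R : realType) (n : nat).
Local Notation V := 'rV[R]_n.+1.

(** The uncountable union reduces to a countable dense subset of [K]: by continuity it approximates
    a value at most 0, and conversely the minimum over the compact set [K] is attained. *)
Lemma measurable_exists_compact (K : set V) (f : V -> T -> R) : compact K ->
  (forall t, continuous (f ^~ t)) -> (forall x, measurable_fun setT (f x)) ->
  measurable [set t | exists2 x, K x & f x t <= 0].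
Proof.
move=> Kc fc fm; have [c cK] := countable_dense_subset K.
rewrite (_ : [set _ | _] =
    \bigcap_m \bigcup_i ([set _ | K (c i)] `&` [set t | f (c i) t < m.+1%:R^-1])).
  apply: bigcapT_measurable => m; apply: countable_bigcupT_measurable => // i.
  by apply: measurableI; [exact: measurable_pred|exact: measurable_ltc].
apply/seteqP; split => [t [x Kx fx] m _|t ft].
  have m0 : 0 < m.+1%:R^-1 :> R by rewrite invr_gt0.
  have : nbhs x [set y | f y t < m.+1%:R^-1].
    have : open [set y | f y t < m.+1%:R^-1].
      rewrite (_ : [set _ | _] = f ^~ t @^-1` [set y | y < m.+1%:R^-1])//.
      by apply: open_comp => [y _|]; [exact: fc|exact: open_lt].
    by rewrite openE => /(_ x); apply; rewrite /=; exact: le_lt_trans m0.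
  move=> /nbhs_ballP[e /= e0 xe].
  have [i Ki bi] := cK x e Kx e0; exists i => //; split => //; exact: xe.
have K0 : K !=set0.
  by have [i _ [? _]] := ft 0%N I; exists (c i).
have [x /set_mem Kx xmin] := EVT_min_rV K0 Kc (continuous_subspaceT (fc t)).
exists x => //; rewrite leNgt; apply/negP => fx0.
have [m] := ltr_add_invr fx0; rewrite add0r => mf.
have [i _ [Ki /= fi]] := ft m I.
have := xmin (c i) (mem_set Ki); rewrite leNgt => /negP; apply.
exact: lt_trans mf.
Qed.

End CompactProjection.

Section HyperplaneMeasurability.
Context (R : realType) (l : nat).
Local Notation V := 'rV[R]_l.+1.
Local Notation hyp := (hyperplane R l).

Lemma continuous_measurable_hyp (f : hyp_space R l -> R) : continuous f ->
  measurable_fun setT (f : hyp -> R).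
Proof.
move=> fc; apply: (measurability _ (RGenOInfty.measurableE R)).
move=> _ [_ [x ->] <-]; rewrite setTI; apply: sub_sigma_algebra.
apply: open_comp => [y _|]; first exact: fc.
exact: interval_open.
Qed.

Lemma measurable_offset : measurable_fun setT (@offset R l).
Proof.
apply: continuous_measurable_hyp => H.
apply: (@continuous_comp _ _ _ (fun H : hyp_space R l => sval H) fst).
  exact: initial_continuous.
exact: cvg_fst.
Qed.

Lemma measurable_normal i : measurable_fun setT (fun H : hyp => normal H ord0 i).
Proof.
apply: continuous_measurable_hyp => H.
apply: (@continuous_comp _ _ _ (fun H : hyp_space R l => sval H)
  (fun p => p.2 ord0 i)).
  exact: initial_continuous.
apply: (@continuous_comp _ _ _ snd (fun v : V => v ord0 i)).
  exact: cvg_snd.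
exact: coord_continuous.
Qed.

Lemma measurable_dotp_normal x :
  measurable_fun setT (fun H : hyp => dotp x (normal H)).
Proof.
apply: measurable_sum => i; apply: measurable_funM => //.
exact: measurable_normal.
Qed.

Lemma measurable_sdist b x : measurable_fun setT (fun H : hyp => sdist b H x).
Proof.
by case: b; apply: measurable_funB;
  by [exact: measurable_offset|exact: measurable_dotp_normal].
Qed.

Section Families.
Context d (T : measurableType d) (h : T -> word -> hyp).
Hypothesis mh : forall e, measurable_fun setT (h ^~ e).
Variable W : set V.
Hypothesis W_polytope : polytope W.

Lemma measurable_margin e x : measurable_fun setT (fun t => margin (h t) e x).
Proof.
elim: e => [|b p IH] //=.
apply: measurable_minr => //.
exact: (measurableT_comp (measurable_sdist b x)).
Qed.

Lemma measurable_hit_cell (g : T -> hyp) e : measurable_fun setT g ->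
  measurable [set t | hit (cell W (h t) e) (g t)].
Proof.
(* A single inequality [f x t <= 0] says that [x] lies both in the cell and on the hyperplane. *)
move=> mg; pose f x t := Num.max (- margin (h t) e x) `|sdist true (g t) x|.
rewrite (_ : [set _ | _] = [set t | exists2 x, W x & f x t <= 0]).
  apply: measurable_exists_compact; first exact: polytope_compact.
    move=> t x; rewrite /f; apply: (@continuous_max R _ (fun x => - margin (h t) e x)
      (fun x => `|sdist true (g t) x|)).
      by apply: continuousN; exact: margin_continuous.
    apply: (@continuous_comp _ _ _ (sdist true (g t)) (@Num.norm R R)).
      exact: sdist_continuous.
    exact: norm_continuous.
  move=> x; apply: measurable_maxr.
    by apply: measurableT_comp => //; exact: measurable_margin.
  apply: measurableT_comp => //.
  exact: (measurableT_comp (measurable_sdist true x)).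
apply/seteqP; split => [t [x [gx]]|t [x Wx]].
  rewrite cellE => -[Wx /= mx]; exists x => //.
  rewrite /f ge_max oppr_le0 mx normr_le0 /= /sdist gx; exact/eqP/subrr.
rewrite /f ge_max oppr_le0 normr_le0 subr_eq0 => /andP[mx /eqP gx].
by exists x; split; rewrite // cellE.
Qed.

(** A nonempty open set contains a rational point. *)
Lemma measurable_nondeg e : measurable [set t | nondeg W (h t) e].
Proof.
rewrite (_ : [set _ | _] = \bigcup_(q in [set: 'rV[rat]_l.+1])
  ([set _ | W° (map_mx ratr q)] `&` [set t | 0 < margin (h t) e (map_mx ratr q)])).
  apply: countable_bigcupT_measurable => // q; apply: measurableI.
    exact: measurable_pred.
  exact/measurable_gtc/measurable_margin.
apply/seteqP; split => [t [x /nbhs_interior/nbhs_ballP[r /= r0 xr]]|].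
  have [q xq] := rat_dense_rV x r0; exists q => //.
  by have := xr _ xq; rewrite cell_interiorE.
by move=> t [q _ [Wq mq]]; exists (map_mx ratr q); rewrite cell_interiorE.
Qed.

Variable es : seq word.
Hypothesis es_pc : prefix_closed es.
Hypothesis es_size : forall p, p \in es -> (size p < size es)%N.

Lemma measurable_all_nondeg :
  measurable [set t | forall e, tree_leaf es e -> nondeg W (h t) e].
Proof.
rewrite (_ : [set _ | _] =
    \bigcap_(e in [set e | tree_leaf es e]) [set t | nondeg W (h t) e]).
  apply: fin_bigcap_measurable; first exact: finite_tree_leaf.
  by move=> e _; exact: measurable_nondeg.
by [].
Qed.

Lemma measurable_tree_tess A : tess_sigma W A ->
  measurable [set t | A (tree_tess W (h t) es)].
Proof.
(* The sets with a measurable preimage form a sigma-algebra on the tessellations of [W], so that the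
   generators suffice. *)
suff : tess_sigma W `<=` [set A | A `<=` tessellation W /\
    measurable [set t | A (tree_tess W (h t) es)]].
  by move=> /[apply] -[].
have mT : measurable [set t | tessellation W (tree_tess W (h t) es)].
  rewrite (_ : [set _ | _] =
    [set t | forall e, tree_leaf es e -> nondeg W (h t) e]).
    exact: measurable_all_nondeg.
  by apply/seteqP; split => t /= /(tree_tessP W_polytope (h t) es_pc es_size).
apply: smallest_sub.
  split.
  - by split => //; rewrite [X in measurable X](_ : _ = set0).
  - move=> B [_ mB]; split; first exact: subDsetl.
    by rewrite [X in measurable X](_ : _ = [set t | tessellation W (tree_tess W (h t) es)]
      `\` [set t | B (tree_tess W (h t) es)])//; exact: measurableD.
  - move=> B mB; split; first by move=> T' [i _ /(mB i).1].
    rewrite [X in measurable X](_ : _ = \bigcup_i [set t | B i (tree_tess W (h t) es)]).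
      by apply: bigcupT_measurable => i; have [] := mB i.
    by apply/seteqP; split => t [i _ ?]; exists i.
move=> _ [K [Kc KW] <-]; split => [T' []//|].
rewrite (_ : [set _ | _] = [set t | tessellation W (tree_tess W (h t) es)] `&`
  [set t | forall x, K x ->
    exists2 e, tree_leaf es e & (cell W (h t) e)° x]); last first.
  apply/seteqP; split => t /= [Tt]; have nd := Tt; move: nd;
    rewrite (tree_tessP W_polytope (h t) es_pc es_size) => nd;
    by rewrite (tree_tbdry W_polytope es_pc es_size nd KW).
apply: measurableI => //.
(* No boundary point of [W] is interior to a leaf cell, so that the event is empty unless [K] lies
   in the interior of [W]. *)
have [KW'|KW'] := pselect (K `<=` W°); last first.
  rewrite (_ : [set _ | _] = set0)//; apply/seteqP; split => // t Kt.
  apply: KW' => x /Kt[e _]; rewrite cell_interiorE; by case.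
have [s sE] := (finite_seqP _).1 (finite_tree_leaf es).
(* The largest leaf margin: for [x] interior to [W] it is positive iff [x] is interior to a leaf
   cell. The base value -1 never makes it positive. *)
pose f x t := \big[Num.max/-1]_(e <- s) margin (h t) e x.
rewrite (_ : [set _ | _] = ~` [set t | exists2 x, K x & f x t <= 0]).
  apply: measurableC; apply: measurable_exists_compact => //.
    move=> t; rewrite /f; elim: (s) => [|e s' IH] x.
      under eq_fun do rewrite big_nil; exact: cst_continuous.
    under eq_fun do rewrite big_cons; apply: continuous_max; last exact: IH.
    exact: margin_continuous.
  move=> x; rewrite /f; elim: (s) => [|e s' IH].
    under eq_fun do rewrite big_nil; exact: measurable_cst.
  under eq_fun do rewrite big_cons; apply: measurable_maxr => //.
  exact: measurable_margin.
apply/seteqP; split => t /=.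
  move=> Kt [x /Kt[e el]]; rewrite cell_interiorE => -[_ /= em].
  apply/negP; rewrite -ltNge /f.
  have es' : e \in s by have : [set` s] e by rewrite -sE.
  elim: (s) es' => // e1 s' IH; rewrite in_cons big_cons lt_max.
  by move=> /predU1P[<-|/IH ->]; rewrite ?em ?orbT.
move=> Kt x Kx; have /negP : ~ (f x t <= 0) by move=> fx; apply: Kt; exists x.
rewrite -ltNge /f => fx.
suff [e es' me] : exists2 e, e \in s & 0 < margin (h t) e x.
  exists e; last by rewrite cell_interiorE; split => //; exact: KW'.
  by have : [set` s] e by []; rewrite -sE.
move: fx; elim: (s) => [|e s' IH]; first by rewrite big_nil ltr0N1.
rewrite big_cons lt_max => /orP[em|/IH[e' e's ?]].
  by exists e => //; rewrite mem_head.
by exists e' => //; rewrite in_cons e's orbT.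
Qed.

End Families.

Lemma measurable_hit (C : set V) : compact C -> measurable (hit C : set hyp).
Proof.
move=> Cc; pose f x (H : hyp) := `|sdist true H x|.
rewrite (_ : hit C = [set t | exists2 x, C x & f x t <= 0]).
  apply: measurable_exists_compact => //.
    move=> t x; apply: (@continuous_comp _ _ _ (sdist true t) (@Num.norm R R)).
      exact: sdist_continuous.
    exact: norm_continuous.
  move=> x; apply: measurableT_comp => //; exact: measurable_sdist.
apply/seteqP; split => [t [x [gx Cx]]|t [x Cx]].
  by exists x => //; rewrite /f normr_le0 /= /sdist gx; exact/eqP/subrr.
by rewrite /f normr_le0 subr_eq0 => /eqP gx; exists x.
Qed.

End HyperplaneMeasurability.

(** * Translation invariant measures on hyperplanes *)

Section Translations.
Context (R : realType) (l : nat).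
Local Notation V := 'rV[R]_l.+1.
Local Notation hyp := (hyperplane R l).
Implicit Types (H : hyp) (x : V) (C : set V).

Lemma hyp_eq H H' : offset H = offset H' -> normal H = normal H' -> H = H'.
Proof.
move=> oo nn; apply: val_inj => /=; move: oo nn; rewrite /offset /normal.
by case: (sval H) (sval H') => [a u] [b v] /= -> ->.
Qed.

(** The last non-zero coordinates of [u] and [v] have the same index and are both positive, which
    excludes [c = -1]. *)
Lemma upper_sphere_sign (u v : V) (c : R) : upper_sphere u -> upper_sphere v ->
  v = c *: u -> v = u.
Proof.
move=> [uu [i [i0 iz]]] [vv [j [j0 jz]]] vc.
have cc : c * c = 1.
  by move: vv; rewrite vc dotpZl dotpC dotpZl uu mulr1.
suff c0 : 0 < c by rewrite vc (_ : c = 1) ?scale1r//; nra.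
have c0 : c != 0 by apply: contra_eq_neq cc => ->; rewrite mul0r eq_sym oner_neq0.
have vE k : v ord0 k = c * u ord0 k by rewrite vc mxE.
have ij : i = j.
  have [ij|ij|/val_inj//] := ltngtP i j.
    by move: j0; rewrite vE iz// mulr0 ltxx.
  by move: (jz _ ij); rewrite vE => /eqP; rewrite mulf_eq0 (negbTE c0)/= gt_eqF.
by move: j0; rewrite vE -ij pmulr_lgt0.
Qed.

(** Translation invariance speaks of planes as sets of points; injectivity turns it into invariance
    under the map [translate]. *)
Lemma plane_inj H H' : plane H = plane H' -> H = H'.
Proof.
move=> HH'; set u := normal H; set v := normal H'.
have us : upper_sphere u by have /set_mem := valP H.
have vs : upper_sphere v by have /set_mem := valP H'.
have p1 : plane H (offset H *: u).
  by rewrite /plane /= dotpZl normal_unit mulr1.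
have uv (w : V) : dotp w u = 0 -> dotp w v = 0.
  move=> wu; have p2 : plane H (offset H *: u + w).
    by rewrite /plane /= dotpDl dotpZl normal_unit mulr1 wu addr0.
  move: p1 p2; rewrite HH' /plane /= dotpDl => ->; rewrite -/v; lra.
have vu : v = dotp v u *: u.
  (* The component of [v] orthogonal to [u] is orthogonal to [v] as well, hence to itself. *)
  pose w := v - dotp v u *: u.
  have wu : dotp w u = 0.
    by rewrite dotpDl -scaleNr dotpZl normal_unit mulr1 subrr.
  have wv := uv _ wu.
  have ww : dotp w w = 0.
    by rewrite {1}/w dotpDl -scaleNr dotpZl (dotpC v) (dotpC u) wv wu; ring.
  apply/eqP; rewrite -subr_eq0 -/w; apply/eqP/rowP => i.
  move: ww => /eqP; rewrite psumr_eq0; last by move=> j _; exact: sqr_ge0.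
  by move=> /allP/(_ i (mem_index_enum _)); rewrite mulf_eq0 orbb => /eqP ->; rewrite mxE.
have uvE : v = u := upper_sphere_sign us vs vu.
apply: hyp_eq => //; move: p1; rewrite HH' /plane /= -/v uvE dotpZl normal_unit.
by rewrite mulr1.
Qed.

Lemma translate_subproof x H :
  (offset H + dotp x (normal H), normal H) \in @hyp_params R l.
Proof. by apply/mem_set; have /set_mem := valP H. Qed.

Definition translate x H : hyp :=
  @exist _ (fun p => p \in @hyp_params R l) _ (translate_subproof x H).

Lemma offset_translate x H :
  offset (translate x H) = offset H + dotp x (normal H).
Proof. by []. Qed.

Lemma normal_translate x H : normal (translate x H) = normal H.
Proof. by []. Qed.

Lemma translateK x : cancel (translate x) (translate (- x)).
Proof.
move=> H; apply: hyp_eq => //.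
rewrite !offset_translate normal_translate -scaleN1r dotpZl; ring.
Qed.

Lemma plane_translate x H : plane (translate x H) = [set y + x | y in plane H].
Proof.
rewrite /plane /=; apply/seteqP; split => [y /= yx|_ [y /= yH <-]].
  exists (y - x); last by rewrite subrK.
  by rewrite dotpDl -scaleN1r dotpZl yx /offset/=; ring.
by rewrite dotpDl yH.
Qed.

Lemma measurable_translate x : measurable_fun setT (translate x).
Proof.
apply: (@measurability _ _ hyp hyp setT _ (@open (hyp_space R l))) => //.
move=> _ [U + <-]; rewrite setTI => -[Q oQ <-]; apply: sub_sigma_algebra.
rewrite -comp_preimage; apply: (@open_comp (hyp_space R l)) => // H _.
have cx : continuous (fun H : hyp_space R l => sval H).
  exact: initial_continuous.
have cd : continuous (fun p : R * V => dotp x p.2).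
  move=> p; apply: (@continuous_comp _ _ _ snd (fun v => dotp x v)).
    exact: cvg_snd.
  rewrite (_ : (fun v => _) = (fun v => dotp v x)); last first.
    by apply/funext => v; exact: dotpC.
  exact: dotp_continuous.
apply: (@continuous_comp _ _ _ (fun H : hyp_space R l => sval H)
  (fun p : R * V => (p.1 + dotp x p.2, p.2))); first exact: cx.
have cf : {for sval H, continuous (fun p : R * V => p.1 + dotp x p.2)}.
  by apply: continuousD; [exact: cvg_fst|exact: cd].
exact: (cvg_pair cf cvg_snd).
Qed.

Lemma translate_set x (S : set hyp) :
  [set H' | exists2 H, S H & plane H' = [set y + x | y in plane H]] =
  translate (- x) @^-1` S.
Proof.
apply/seteqP; split => [H' [H SH]|H' /= SH'].
  by rewrite -plane_translate => /plane_inj ->; rewrite /= translateK.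
exists (translate (- x) H') => //; rewrite -plane_translate.
by rewrite -{1}(opprK x) translateK.
Qed.

End Translations.

Section InvariantMeasure.
Context (R : realType) (l : nat).
Local Notation V := 'rV[R]_l.+1.
Local Notation hyp := (hyperplane R l).
Variable Lam : {measure set hyp -> \bar R}.
Hypothesis Lam_inv : translation_invariant Lam.
Implicit Types (H : hyp) (x : V) (C : set V).

Lemma Lam_translate x (S : set hyp) : measurable S ->
  Lam (translate x @^-1` S) = Lam S.
Proof.
by move=> mS; rewrite -(Lam_inv (- x) mS) translate_set opprK.
Qed.

Lemma Lam_hit_finite C : locally_finite Lam -> compact C ->
  (Lam (hit C) < +oo)%E.
Proof.
move=> Lam_lf Cc; apply: Lam_lf.
- exact: compact_bounded.
- have Ccl : closed C by apply: compact_closed Cc; exact: norm_hausdorff.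
  rewrite -(setCK C) -setTD; apply: sigma_algebraCD; apply: sub_sigma_algebra.
  exact: closed_openC.
- exact: measurable_hit.
Qed.

Lemma countable_null (S : set hyp) (F : (set hyp)^nat) : measurable S ->
  (forall n, measurable (F n)) -> (forall n, Lam (F n) = 0%E) ->
  S `<=` \bigcup_n F n -> Lam S = 0%E.
Proof.
move=> mS mF F0 SF; apply/eqP; rewrite eq_le measure_ge0 andbT.
have := measure_sigma_subadditive Lam mF mS SF.
by rewrite eseries0// => n _ _; exact: F0.
Qed.

(** Countably many translates of [hit C] by rational vectors cover all hyperplanes and have the same
    measure, so that a null [hit C] would make [Lam] zero. *)
Lemma Lam_hit_gt0 C : Lam setT != 0%E -> compact C -> C° !=set0 ->
  (0 < Lam (hit C))%E.
Proof.
move=> Lam0 Cc [x0 /nbhs_ballP[r /= r0 xr]].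
rewrite lt_neqAle measure_ge0 andbT; apply: contra Lam0 => /eqP/esym hit0.
have mC := measurable_hit Cc.
pose F n : set hyp := if @unpickle 'rV[rat]_l.+1 n is Some q
  then translate (- map_mx ratr q) @^-1` hit C else set0.
have mF n : measurable (F n).
  rewrite /F; case: unpickle => [q|] //.
  by rewrite -[X in measurable X]setTI; exact: measurable_translate.
have F0 n : Lam (F n) = 0%E.
  rewrite /F; case: unpickle => [q|]; last exact: measure0.
  by rewrite Lam_translate.
apply/eqP; have TF : setT `<=` \bigcup_n F n.
  move=> H _; pose p := offset H *: normal H.
  have [q pq] := rat_dense_rV (p - x0) r0.
  exists (pickle q) => //; rewrite /F pickleK.
  exists (p - map_mx ratr q); split.
    rewrite plane_translate; exists p => //.
    by rewrite /plane /= dotpZl normal_unit mulr1.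
  apply: xr; move: pq; rewrite -!ball_normE /= opprB addrA.
  by rewrite -normrN; congr (`|_| < r); apply/rowP => j; rewrite !mxE; ring.
exact: countable_null TF.
Qed.

Lemma nondeg_touch C b H : nondeg C (fun=> H) [:: b] <->
  exists2 x, C° x & 0 < sdist b H x.
Proof.
split=> [[x]|[x Cx xH]].
  by rewrite cell_interiorE /= => -[Cx]; rewrite lt_min ltr01/=; exists x.
by exists x; rewrite cell_interiorE; split => //=; rewrite lt_min ltr01.
Qed.

(* A hyperplane hitting C without splitting it supports C, so that it is
   determined by its normal u.  Those with u_i <> 0 have pairwise disjoint
   translates along e_i / n, all of them hitting a common compact set. *)
Lemma Lam_touch C b : locally_finite Lam -> polytope C -> C° !=set0 ->
  Lam (hit C `&` [set H | ~ nondeg C (fun=> H) [:: b]]) = 0%E.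
Proof.
move=> Lam_lf Cp C0.
have Cc := polytope_compact Cp.
have Cv := polytope_cvx Cp.
set S := _ `&` _.
have mS : measurable S.
  apply: measurableI; first exact: measurable_hit.
  apply: measurableC.
  exact: (@measurable_nondeg _ _ _ hyp (fun H _ => H)).
have SP H : S H -> (forall x, C x -> sdist b H x <= 0) /\
    (exists2 x, C x & sdist b H x = 0).
  move=> [[x [xH Cx]] /= nd]; split; last first.
    by exists x => //; case: (b); rewrite /sdist xH subrr.
  move=> y Cy; rewrite leNgt; apply/negP => y0; apply: nd; apply/nondeg_touch.
  have : nbhs y [set z | 0 < sdist b H z].
    have : open [set x | 0 < sdist b H x].
      rewrite (_ : [set _ | _] = sdist b H @^-1` [set y | 0 < y])//.
      by apply: open_comp => [z _|]; [exact: sdist_continuous|exact: open_gt].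
    by rewrite openE; exact.
  by move=> /(cvx_interior_meets Cv C0 Cy)[z [? ?]]; exists z.
have offE H H' : S H -> S H' -> normal H = normal H' -> offset H = offset H'.
  move=> /SP[Hle [x Cx xH]] /SP[Hle' [x' Cx' xH']] nn.
  have := Hle _ Cx'; have := Hle' _ Cx; move: xH xH'.
  by case: (b) => /=; rewrite nn; lra.
pose e (i : 'I_l.+1) : V := delta_mx ord0 i.
have dotpe i u : dotp (e i) u = u ord0 i.
  rewrite /dotp (bigD1 i)//= big1 ?addr0; first by rewrite !mxE !eqxx mul1r.
  by move=> j ji; rewrite !mxE (negbTE ji) mul0r.
pose Si i := S `&` [set H | normal H ord0 i != 0].
have mSi i : measurable (Si i).
  apply: measurableI => //.
  rewrite (_ : [set _ | _] =
    [set H : hyp | normal H ord0 i < 0] `|` [set H | 0 < normal H ord0 i]).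
    by apply: measurableU; [apply: measurable_ltc|apply: measurable_gtc];
      exact: measurable_normal.
  by apply/seteqP; split => H /=; rewrite neq_lt => /orP.
suff Si0 i : Lam (Si i) = 0%E.
  pose F n := if insub n is Some i then Si i else set0.
  apply: (@countable_null _ F) => // [n|n|H SH].
  - by rewrite /F; case: insub.
  - by rewrite /F; case: insub => //; rewrite measure0.
  have [i [i0 _]] : exists i, 0 < normal H ord0 i /\
      forall j : 'I_l.+1, (i < j)%N -> normal H ord0 j = 0.
    by have /set_mem[] := valP H.
  by exists i => //; rewrite /F valK; split => //=; rewrite gt_eqF.
pose D := [set p.1 + p.2 *: e i | p in C `*` `[0, 1]%classic].
have Dc : compact D.
  apply: continuous_compact.
    apply: continuous_subspaceT => -[x a] /=.
    apply: cvgD; first exact: cvg_fst.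
    by apply: cvgZr_tmp; exact: cvg_snd.
  by apply: compact_setX => //; exact: segment_compact.
pose F n := translate (- (n.+1%:R^-1 *: e i)) @^-1` Si i.
have mF n : measurable (F n).
  by rewrite -[X in measurable X]setTI; exact: measurable_translate.
have FD n : F n `<=` hit D.
  move=> H [[[x [+ Cx]] _] _].
  have n1 : n.+1%:R^-1 <= 1 :> R by rewrite invf_le1// ler1n.
  rewrite plane_translate => -[y yH yx]; exists y; split => //.
  exists (x, n.+1%:R^-1); last by rewrite -yx /= subrK.
  by split => //=; rewrite in_itv/= invr_ge0 ler0n.
have tF : trivIset setT F.
  apply/trivIsetP => m n _ _ mn; apply/seteqP; split => // H [[Sm um] [Sn _]].
  (* Both translates have the normal [u] of [H] and lie in [S], hence have equal offsets, whereas
     the translations shift the offset by -u_i / (m+1) and -u_i / (n+1). *)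
  move: um => /=; have := offE _ _ Sm Sn erefl.
  rewrite /translate /offset /normal /= -!/(offset _) -!/(normal _).
  rewrite -!scaleNr !dotpZl !dotpe => /addrI/eqP.
  rewrite -subr_eq0 -mulrBl mulf_eq0 => /orP[|/eqP->]; last by rewrite eqxx.
  rewrite opprK addrC subr_eq0 => /eqP/invr_inj/eqP.
  by rewrite eqr_nat eqSS eq_sym (negbTE mn).
have FS n : Lam (F n) = Lam (Si i) by exact: Lam_translate.
have Lf := Lam_hit_finite Lam_lf Dc.
(* Arbitrarily many disjoint sets of equal measure fit into a set of finite measure. *)
have SD n : (\sum_(j < n) Lam (Si i) <= Lam (hit D))%E.
  apply: (@le_trans _ _ (Lam (\big[setU/set0]_(j < n) F j))); last first.
    apply: le_measure; rewrite ?inE; [|exact: measurable_hit|].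
      by apply: bigsetU_measurable.
    by rewrite -bigcup_mkord => H [j _]; exact: FD.
  rewrite measure_bigsetU//; apply: lee_sum => j _.
  by have := lexx (Lam (Si i)); rewrite -{2}(FS j).
have [//|S0] := eqVneq (Lam (Si i)) 0%E; exfalso.
have {}S0 : (0 < Lam (Si i))%E by rewrite lt0e S0 measure_ge0.
have := SD 1%N; rewrite big_ord1 => /le_lt_trans/(_ Lf).
move: SD S0 Lf; case: (Lam (Si i)) => [a| |]//.
have : (0 <= Lam (hit D))%E by exact: measure_ge0.
case: (Lam (hit D)) => [c| |]//.
rewrite !lee_fin lte_fin => c0 SD a0 _ _.
have := archi_boundP (divr_ge0 c0 (ltW a0)).
rewrite ltr_pdivrMr// mulr_natl ltNge => /negP; apply.
by have := SD (Num.bound (c / a)); rewrite sumEFin sumr_const card_ord lee_fin.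
Qed.

End InvariantMeasure.

(** * Independence *)

Section Freezing.
Context d (Omega : measurableType d) (R : realType) (P : probability Omega R).

(** Both sides are finite measures in [A] that agree on a pi-system. *)
Lemma independent_pi (G : set (set Omega)) (B : set Omega) : setI_closed G ->
  G setT -> G `<=` measurable -> measurable B ->
  (forall A, G A -> P (A `&` B) = P A * P B)%E ->
  forall A, <<s G >> A -> P (A `&` B) = (P A * P B)%E.
Proof.
move=> GI GT Gm mB GB A sA.
pose r : {nonneg R} := NngNum (fine_ge0 (measure_ge0 P B)).
have PB : P B = (r%:num)%:E by rewrite /= fineK// fin_num_measure.
pose m1 : {measure set Omega -> \bar R} := mrestr P mB.
pose m2 : {measure set Omega -> \bar R} := mscale r P.
suff : m1 A = m2 A by rewrite /m2/= /mscale muleC -PB.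
apply: (@g_sigma_algebra_measure_unique _ R _ G Gm (fun=> setT)) => //.
- by rewrite bigcup_const.
- by move=> C GC; have := GB C GC; rewrite PB muleC.
- by move=> _; rewrite ltey_eq fin_num_measure.
Qed.

(** Independence makes the law of the pair a product measure, to which Tonelli's theorem applies. *)
Lemma freezing d1 d2 (T1 : measurableType d1) (T2 : measurableType d2)
    (X : Omega -> T1) (Y : Omega -> T2) (nu : probability T2 R)
    (f : T1 * T2 -> \bar R) :
  measurable_fun setT X -> measurable_fun setT Y ->
  (forall A B, measurable A -> measurable B ->
    P (X @^-1` A `&` Y @^-1` B) = P (X @^-1` A) * nu B)%E ->
  measurable_fun setT f -> (forall z, 0 <= f z)%E ->
  (\int[P]_w f (X w, Y w) = \int[P]_w \int[nu]_y f (X w, y))%E.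
Proof.
move=> mX mY XY mf f0.
have mXY : measurable_fun setT (fun w => (X w, Y w)).
  exact: measurable_fun_pair.
pose X' : {mfun Omega >-> T1} := HB.pack X (isMeasurableFun.Build _ _ _ _ X mX).
pose XY' : {mfun Omega >-> (T1 * T2)%type} :=
  HB.pack (fun w => (X w, Y w)) (isMeasurableFun.Build _ _ _ _ _ mXY).
pose m : probability (T1 * T2)%type R := distribution P XY'.
pose m1 : probability T1 R := distribution P X'.
transitivity (\int[m]_z f z)%E.
  by rewrite [RHS](ge0_integral_pushforward mXY).
transitivity (\int[m1 \x nu]_z f z)%E.
  apply: eq_measure_integral => A mA _; apply/esym.
  apply: product_measure_unique => // B C mB mC.
rewrite fubini_tonelli1// [LHS](ge0_integral_pushforward mX)//.
  exact: measurable_fun_fubini_tonelli_F.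
by move=> x _; exact: integral_ge0.
Qed.

End Freezing.

Section MutualIndependence.
Context d (Omega : measurableType d) (R : realType) (P : probability Omega R).
Context (I : choiceType) (D : set I) (F : I -> set (set Omega)).
Hypothesis F_indep : mutually_independent P D F.
Hypothesis F_I : forall i, setI_closed (F i).
Hypothesis F_T : forall i, F i setT.
Hypothesis F_meas : forall i, D i -> F i `<=` measurable.

(** A pi-system that generates the joint sigma-algebra of the families with indices in [S]. *)
Definition finite_meets (S : set I) : set (set Omega) :=
  [set A | exists s (E : I -> set Omega), [/\ uniq s, [set` s] `<=` S,
    (forall i, F i (E i)) & A = \bigcap_(i in [set` s]) E i]].

Lemma finite_meetsI S : setI_closed (finite_meets S).
Proof.
move=> _ _ [s [E [us sS FE ->]]] [s' [E' [us' sS' FE' ->]]].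
pose EE i := (if i \in s then E i else setT) `&` (if i \in s' then E' i else setT).
exists (undup (s ++ s')), EE; split.
- exact: undup_uniq.
- by move=> i /=; rewrite mem_undup mem_cat => /orP[/sS|/sS'].
- by move=> i; apply: F_I; case: ifP.
- apply/seteqP; split => w.
    by move=> [sw sw'] i _; split; case: ifP => // ?; [apply: sw|apply: sw'].
  by move=> EEw; split => i /= si; have := EEw i; rewrite /= mem_undup mem_cat
    /EE si ?orbT => /(_ isT)[].
Qed.

Lemma finite_meetsT S : finite_meets S setT.
Proof.
exists [::], (fun=> setT); split => //; apply/seteqP; split => //.
Qed.

Lemma sub_finite_meets S i : S i -> F i `<=` finite_meets S.
Proof.
move=> Si A FA; exists [:: i], (fun j => if j == i then A else setT); split => //.
- by move=> j /=; rewrite inE => /eqP ->.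
- by move=> j; case: eqP => // ->.
- apply/seteqP; split => w.
    by move=> Aw j /=; rewrite inE => ->.
  by move=> /(_ i); rewrite /= mem_head eqxx; exact.
Qed.

Lemma finite_meets_measurable S : S `<=` D -> finite_meets S `<=` measurable.
Proof.
move=> SD _ [s [E [us sS FE ->]]]; apply: fin_bigcap_measurable => //.
by move=> i /sS /SD Di; apply: F_meas (FE i).
Qed.

Lemma finite_meets_indep S i A B : S `<=` D -> D i -> ~ S i ->
  finite_meets S A -> F i B -> P (A `&` B) = (P A * P B)%E.
Proof.
move=> SD Di Si [s [E [us sS FE ->]]] FB.
have is' : i \notin s by apply: contra_notN Si; exact: sS.
rewrite (F_indep us) => [||j _]//; last exact: subset_trans SD.
pose E' j := if j == i then B else E j.
transitivity (P (\bigcap_(j in [set` (i :: s)]) E' j)).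
  congr (P _); apply/seteqP; split => w.
    move=> [Ew Bw] j /=; rewrite inE /E'; case: eqP => //= _; exact: Ew.
  move=> E'w; split => [j js|].
    have := E'w j; rewrite /= inE js orbT /E'; case: eqP => [ji|_]; last exact.
    by move: is'; rewrite -ji (js : j \in s).
  by have := E'w i; rewrite /= mem_head /E' eqxx; exact.
rewrite F_indep/=; last 3 first.
- by rewrite is'.
- by move=> j /=; rewrite inE => /predU1P[->//|/sS/SD].
- by move=> j _; rewrite /E'; case: eqP => // ->.
rewrite big_cons /E' eqxx muleC; congr (_ * _)%E; apply: eq_big_seq => j js.
by case: eqP => // ji; move: is'; rewrite -ji js.
Qed.

Lemma bigcup_independent S i A B : S `<=` D -> D i -> ~ S i ->
  <<s \bigcup_(j in S) F j >> A -> F i B -> P (A `&` B) = (P A * P B)%E.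
Proof.
move=> SD Di Si sA FB; apply: (independent_pi (@finite_meetsI S)).
- exact: finite_meetsT.
- exact: finite_meets_measurable.
- exact: F_meas FB.
- by move=> C SC; apply: finite_meets_indep SC FB.
- apply: sub_sigma_algebra2 sA => C [j Sj FC].
  exact: sub_finite_meets FC.
Qed.

End MutualIndependence.

(** * The order of words *)

(** The rank of a word: in this breadth-first numbering the successors of number n are 2n + 1 and 2n
    + 2. *)
Fixpoint word_index (e : word) : nat :=
  if e is b :: p then (word_index p).*2.+1 + b else 0.

Lemma word_index_lt b p : (word_index p < word_index (b :: p))%N.
Proof. rewrite /=; lia. Qed.

Lemma word_index_inj : injective word_index.
Proof.
elim=> [|b p IH] [|b' p'] //= bp.
have bb : b = b' by case: (b) (b') bp => [] [] //=; lia.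
by congr (_ :: _) => //; apply: IH; rewrite bb in bp; lia.
Qed.

(** A predecessor has a smaller number, so that fuel [n] suffices for the number [n]. *)
Fixpoint word_of_fuel (f n : nat) : word :=
  if f is f'.+1 then
    if n is n'.+1 then odd n' :: word_of_fuel f' n'./2 else [::]
  else [::].

Definition word_of n := word_of_fuel n n.

Lemma word_ofK : cancel word_of word_index.
Proof.
suff H f n : (n <= f)%N -> word_index (word_of_fuel f n) = n.
  by move=> n; exact: H.
elim: f n => [|f IH] [|n] //= nf; rewrite IH; last lia.
rewrite -[in RHS](odd_double_half n); lia.
Qed.

Lemma word_indexK : cancel word_index word_of.
Proof. by move=> e; apply: word_index_inj; rewrite word_ofK. Qed.

Lemma word_index_size e : ((2 ^ size e).-1 <= word_index e < (2 ^ (size e).+1).-1)%N.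
Proof.
elim: e => //= b p /andP[IH1 IH2]; rewrite !expnS in IH2 *.
have : (0 < 2 ^ size p)%N by rewrite expn_gt0.
by move=> ?; apply/andP; split; case: b; lia.
Qed.

Lemma ltxi_rcons (s s' : seq bool) (x y : bool) : size s = size s' ->
  @Order.lt _ (seqlexi bool) (rcons s x) (rcons s' y) =
  @Order.lt _ (seqlexi bool) s s' || ((s == s') && (x < y)%O).
Proof.
elim: s s' => [|a s IH] [|b s'] //=.
  by rewrite !ltxi_cons ltxi0s /= implybF -ltNge; case: x y => [] [].
move=> [sz]; rewrite !ltxi_cons IH// eqseq_cons.
by case: a b => [] [] /=.
Qed.

Lemma rev_lexi_index (e e' : word) : size e = size e' ->
  @Order.lt _ (seqlexi bool) (rev e) (rev e') = (word_index e < word_index e')%N.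
Proof.
elim: e e' => [|b p IH] [|b' p'] //= [sz].
rewrite !rev_cons ltxi_rcons ?size_rev// IH// (inj_eq (can_inj revK)).
have -> : (p == p') = (word_index p == word_index p').
  by rewrite (inj_eq word_index_inj).
by case: b b' => [] [] /=; lia.
Qed.

Lemma word_ltE e e' : word_lt e e' = (word_index e < word_index e')%N.
Proof.
rewrite /word_lt; have [ee'|ee'|ee'] := ltngtP (size e) (size e') => /=.
- have /andP[_ h] := word_index_size e; have /andP[h' _] := word_index_size e'.
  apply/esym; apply: (leq_trans h); apply: leq_trans h'.
  by rewrite -!subn1 leq_sub2r// leq_exp2l.
- have /andP[h _] := word_index_size e; have /andP[_ h'] := word_index_size e'.
  apply/esym/negbTE; rewrite -leqNgt; apply: leq_trans h; apply: ltnW.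
  by apply: (leq_trans h'); rewrite -!subn1 leq_sub2r// leq_exp2l.
- exact: rev_lexi_index.
Qed.

Lemma word_index_suffix p e : suffix p e -> (word_index p <= word_index e)%N.
Proof.
move=> /suffixP[s ->]; elim: s => //= b s IH.
by have := word_index_lt b (s ++ p); rewrite /=; lia.
Qed.

Definition upd (T : Type) (h : word -> T) e x : word -> T :=
  fun e' => if e' == e then x else h e'.

Lemma upd_eq T (h : word -> T) e x : upd h e x e = x.
Proof. by rewrite /upd eqxx. Qed.

Lemma updC T (h : word -> T) e e' x x' : e != e' ->
  upd (upd h e x) e' x' = upd (upd h e' x') e x.
Proof.
move=> ee'; apply/funext => p; rewrite /upd.
by case: eqP => // ->; rewrite eq_sym (negbTE ee').
Qed.

(* Measurability for the product sigma-algebra on (word -> X), tested on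
   families of measurable functions. *)
Definition cmeas dX (X : measurableType dX) (R : realType)
    (F : (word -> X) -> \bar R) :=
  forall d (T : measurableType d) (h : T -> word -> X),
  (forall e, measurable_fun setT (h ^~ e)) ->
  measurable_fun setT (fun t => F (h t)).

Lemma measurable_upd dX (X : measurableType dX) d (T : measurableType d)
    (h : T -> word -> X) e (g : T -> X) :
  (forall e, measurable_fun setT (h ^~ e)) -> measurable_fun setT g ->
  forall e', measurable_fun setT (fun t => upd (h t) e (g t) e').
Proof. by move=> mh mg e'; rewrite /upd; case: (e' == e). Qed.

Lemma cmeas_cst dX (X : measurableType dX) (R : realType) (c : \bar R) :
  cmeas (fun _ : word -> X => c).
Proof. by move=> d T h mh; exact: measurable_cst. Qed.

Lemma cmeasM dX (X : measurableType dX) (R : realType)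
    (F F' : (word -> X) -> \bar R) :
  cmeas F -> cmeas F' -> cmeas (fun h => F h * F' h)%E.
Proof. by move=> mF mF' d T h mh; apply: emeasurable_funM; [exact: mF|exact: mF']. Qed.

(** * Division of a cell by a random hyperplane *)

Section DivisionOperator.
Context (R : realType) (l : nat).
Local Notation V := 'rV[R]_l.+1.
Local Notation hyp := (hyperplane R l).
Implicit Types (h : word -> hyp) (e p : word) (F : (word -> hyp) -> \bar R).

Definition psuffix e e' := suffix e e' && (e != e').

Lemma psuffix_cons b p e : suffix (b :: p) e -> psuffix p e.
Proof.
move=> be; rewrite /psuffix (suffix_trans (suffix_cons p b) be)/=.
by apply: contraTN (size_suffix be) => /eqP <-; rewrite /= ltnn.
Qed.

Lemma psuffix_index p e : psuffix p e -> (word_index p < word_index e)%N.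
Proof.
move=> /andP[pe ne]; rewrite ltn_neqAle word_index_suffix// andbT.
by rewrite (inj_eq word_index_inj).
Qed.

Lemma cell_upd W h e H e' : ~~ psuffix e e' ->
  cell W (upd h e H) e' = cell W h e'.
Proof.
move=> ee'; apply: eq_cell => p b /psuffix_cons pe'; rewrite /upd.
by case: eqP => // pe; rewrite -pe pe' in ee'.
Qed.

Lemma psuffixxx e : ~~ psuffix e e. Proof. by rewrite /psuffix eqxx andbF. Qed.

Variables (W : set V) (nu : probability hyp R).
Hypothesis W_polytope : polytope W.

Definition hit_prob e h : R := fine (nu (hit (cell W h e))).

(* Integration over the hyperplane dividing the cell of e, with law nu
   conditioned on hitting this cell. *)
Definition divide e F h : \bar R :=
  ((hit_prob e h)^-1%:E * \int[nu]_(H in hit (cell W h e)) F (upd h e H))%E.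

Lemma cell_compact h e : compact (cell W h e).
Proof. by apply: compact_cell; exact: polytope_compact. Qed.

Lemma hit_cell_measurable h e : measurable (hit (cell W h e)).
Proof. by apply: measurable_hit; exact: cell_compact. Qed.

Lemma hit_probE e h : nu (hit (cell W h e)) = (hit_prob e h)%:E.
Proof. by rewrite fineK// fin_num_measure//; exact: hit_cell_measurable. Qed.

Lemma hit_prob_ge0 e h : 0 <= hit_prob e h. Proof. exact: fine_ge0. Qed.

Lemma hit_prob_le1 e h : hit_prob e h <= 1.
Proof.
by rewrite -lee_fin -hit_probE; apply: probability_le1; exact: hit_cell_measurable.
Qed.

Lemma divide_ge0 e F h : (forall h, 0 <= F h)%E -> (0 <= divide e F h)%E.
Proof.
move=> F0; apply: mule_ge0; last exact: integral_ge0.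
by rewrite lee_fin invr_ge0 hit_prob_ge0.
Qed.

Lemma cmeas_hit_integral e F : cmeas F -> (forall h, 0 <= F h)%E ->
  cmeas (fun h => \int[nu]_(H in hit (cell W h e)) F (upd h e H))%E.
Proof.
move=> mF F0 d T h mh.
pose D : set (T * hyp) := [set z | hit (cell W (h z.1) e) z.2].
have mhf e' : measurable_fun setT (fun z : T * hyp => h z.1 e').
  exact: (measurableT_comp (mh e')).
have mD : measurable D.
  by apply: (@measurable_hit_cell _ _ _ _ (fun z => h z.1)).
(* The domain of integration varies with the parameter; extension by 0 makes it constant. *)
pose f : T * hyp -> \bar R := (fun z => F (upd (h z.1) e z.2)) \_ D.
have mf : measurable_fun setT f.
  apply: (measurable_restrictT _ mD).1; apply: measurable_funTS.
  apply: (mF _ _ (fun z : T * hyp => upd (h z.1) e z.2)) => e'.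
  exact: (measurable_upd (h := fun z : T * hyp => h z.1)).
have f0 z : (0 <= f z)%E by apply: erestrict_ge0.
have := @measurable_fun_fubini_tonelli_F _ _ _ _ _ nu f mf f0.
congr measurable_fun; apply/funext => t; rewrite /fubini_F [RHS]integral_mkcond.
apply: eq_integral => H _; rewrite /f !patchE; congr (if _ then _ else _).
Qed.

Lemma cmeas_hit_prob e : cmeas (fun h => (hit_prob e h)%:E).
Proof.
have : cmeas (fun h => \int[nu]_(H in hit (cell W h e)) (cst 1%E) H)%E.
  by apply: (@cmeas_hit_integral e (fun=> 1%E)) => //; exact: cmeas_cst.
move=> + d T h mh => /(_ d T h mh); congr measurable_fun; apply/funext => t.
by rewrite (integral_cst _ (hit_cell_measurable _ _)) mul1e; exact: hit_probE.
Qed.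

Lemma cmeas_comp (f : R -> R) (g : (word -> hyp) -> R) :
  measurable_fun setT f -> cmeas (fun h => (g h)%:E) ->
  cmeas (fun h => (f (g h))%:E).
Proof.
move=> mf mg d T h mh; apply/measurable_EFinP; apply: measurableT_comp => //.
by apply/measurable_EFinP; exact: mg.
Qed.

Lemma cmeas_divide e F : cmeas F -> (forall h, 0 <= F h)%E -> cmeas (divide e F).
Proof.
move=> mF F0; apply: cmeasM; last exact: cmeas_hit_integral.
(* The inverse is the power of exponent -1 on nonnegative numbers, including the value 0 at 0. *)
have := cmeas_comp (measurable_powR (-1)) (cmeas_hit_prob e).
congr cmeas; apply/funext => h; rewrite powR_inv1//; exact: hit_prob_ge0.
Qed.

End DivisionOperator.

(** * The dividing hyperplanes *)

Section Hitting.
Context (R : realType) (l : nat).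
Local Notation V := 'rV[R]_l.+1.
Local Notation hyp := (hyperplane R l).
Implicit Types (h : word -> hyp) (e p : word) (g : nat -> hyp) (s : seq nat).
Variables (W : set V) (nu : probability hyp R).
Hypothesis W_polytope : polytope W.
Hypothesis W_int : W° !=set0.
Hypothesis hit_prob_gt0 : forall e h, nondeg W h e -> 0 < hit_prob W nu e h.
Hypothesis touch_null : forall h e b, nondeg W h e ->
  nu (hit (cell W h e) `&` [set H | ~ nondeg W (upd h e H) (b :: e)]) = 0%E.

(** The default 0 lets the search for the first hyperplane begin at index 1. *)
Definition latest (s : seq nat) : nat := head 0%N s.

(* The hyperplanes of the first words when kappa takes on them the values
   listed in s, the last one first. *)
Definition seqh g s e : hyp := nth point (rev (map g s)) (word_index e).

Definition splits h e H :=
  hit (cell W h e) H /\ forall b, nondeg W (upd h e H) (b :: e).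

Definition misses g s j := forall i, (latest s < i)%N -> (i <= latest s + j)%N ->
  ~ hit (cell W (seqh g s) (word_of (size s))) (g i).

(* s lists, the last one first, the values of kappa on the first words, and the
   hyperplanes found split their cells into two cells with interior points. *)
Fixpoint valid g s : Prop := if s is n :: s' then
  [/\ valid g s', (latest s' < n)%N, misses g s' (n - latest s').-1%N
    & splits (seqh g s') (word_of (size s')) (g n)]
  else True.

(** A condition on [s] alone, which makes [seqh g s] depend only on the variables with indices from
    1 to [latest s]. *)
Fixpoint increasing s := if s is n :: s' then (latest s' < n)%N && increasing s'
  else true.

Lemma valid_increasing g s : valid g s -> increasing s.
Proof. by elim: s => //= n s IH [/IH -> -> _ _]. Qed.

Lemma increasing_head s n : increasing s -> n \in s -> (0 < n <= latest s)%N.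
Proof.
elim: s => //= m s IH /andP[hm /IH {}IH]; rewrite inE => /predU1P[->|/IH]; lia.
Qed.

Lemma seqh_cons g s n : seqh g (n :: s) = upd (seqh g s) (word_of (size s)) (g n).
Proof.
apply/funext => e; rewrite /seqh /upd /= rev_cons nth_rcons size_rev size_map.
rewrite -(inj_eq word_index_inj) word_ofK; case: ltngtP => // es.
by rewrite nth_default// size_rev size_map ltnW.
Qed.

Lemma seqh_nth g s e : (word_index e < size s)%N ->
  seqh g s e = g (nth 0 (rev s) (word_index e)).
Proof. by move=> es; rewrite /seqh -map_rev (nth_map 0)// size_rev. Qed.

Lemma cell_seqh_cons g s n e : (word_index (behead e) < size s)%N || (e == [::]) ->
  cell W (seqh g (n :: s)) e = cell W (seqh g s) e.
Proof.
move=> es; rewrite seqh_cons cell_upd//; apply/negP => /andP[].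
case/orP: es => [es|/eqP ->]; last by rewrite suffixs0 => /eqP ->.
case: e es => [|b p] /= es we; first by move: we; rewrite suffixs0 => ->.
by move=> /(suffix_cons_neq we)/word_index_suffix; rewrite word_ofK; lia.
Qed.

Lemma valid_nondeg g s e : valid g s ->
  (word_index (behead e) < size s)%N || (e == [::]) -> nondeg W (seqh g s) e.
Proof.
elim: s => [_ /= /eqP -> //|n s IH [vs _ _ [_ sp]] es].
have [->//|e0] := eqVneq e [::].
have [es'|es'] := boolP (word_index (behead e) < size s)%N.
  by rewrite /nondeg cell_seqh_cons ?es'//; apply: IH; rewrite ?es'.
move: es es'; rewrite (negbTE e0) orbF /= ltnS => es es'.
(* In this case the last hyperplane found is the one dividing the predecessor of [e]. *)
have eE : word_of (size s) = behead e.
  by apply: word_index_inj; rewrite word_ofK; lia.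
move: sp; rewrite eE seqh_cons => sp.
by case: e e0 {es es' IH} eE sp => // b p _ /= -> /(_ b).
Qed.

Lemma valid_nondeg_next g s : valid g s -> nondeg W (seqh g s) (word_of (size s)).
Proof.
move=> vs; apply: valid_nondeg => //; case E: (word_of (size s)) => [|b p] /=.
  by rewrite orbT.
rewrite orbF; have := word_index_lt b p; rewrite -E word_ofK; lia.
Qed.

(** Where two sequences first differed, the smaller value would be a hit among the misses required
    before the larger one. *)
Lemma valid_uniq g s s' : valid g s -> valid g s' -> size s = size s' -> s = s'.
Proof.
elim: s s' => [|n s IH] [|n' s'] // vs vs' [sz].
have [vs1 hn mn [hs _]] := vs; have [vs1' hn' mn' [hs' _]] := vs'.
have ss := IH _ vs1 vs1' sz; rewrite -{}ss in hn' mn' hs' *.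
congr (_ :: _); have [nn|nn|//] := ltngtP n n'; exfalso.
  by apply: (mn' n _ _ hs) => //; lia.
by apply: (mn n' _ _ hs') => //; lia.
Qed.

Section Measurability.
Context d (T : measurableType d) (g : T -> nat -> hyp) (N : nat).
Hypothesis mg : forall i, (0 < i <= N)%N -> measurable_fun setT (g ^~ i).

(** Measurability is assumed for the indices from 1 to [N] only, so that [T] may carry the
    sigma-algebra of the past. *)
Lemma measurable_seqh s e : increasing s -> (latest s <= N)%N ->
  measurable_fun setT (fun t => seqh (g t) s e).
Proof.
move=> si sN; have [es|es] := ltnP (word_index e) (size s); last first.
  rewrite (_ : (fun t => _) = fun=> point)//; apply/funext => t.
  by rewrite /seqh nth_default// size_rev size_map.
rewrite (_ : (fun t => _) = g ^~ (nth 0%N (rev s) (word_index e))).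
  apply: mg; have := @increasing_head s (nth 0%N (rev s) (word_index e)) si.
  by rewrite -mem_rev mem_nth ?size_rev// => /(_ isT); lia.
by apply/funext => t; rewrite seqh_nth.
Qed.

Lemma measurable_misses s j : increasing s -> (latest s + j <= N)%N ->
  measurable [set t | misses (g t) s j].
Proof.
move=> si sN; rewrite (_ : [set _ | _] =
  \bigcap_i (if (latest s < i <= latest s + j)%N then
    ~` [set t | hit (cell W (seqh (g t) s) (word_of (size s))) (g t i)]
    else setT)).
  apply: bigcapT_measurable => i; case: ifPn => // si'.
  apply: measurableC; apply: (@measurable_hit_cell _ _ _ _ (fun t => seqh (g t) s)).
  - by move=> e; apply: measurable_seqh => //; lia.
  - exact: W_polytope.
  - by apply: mg; lia.
apply/seteqP; split => [t mt i _|t mt i i1 i2].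
  by case: ifPn => // /andP[]; exact: mt.
by have := mt i I; rewrite i1 i2.
Qed.

Lemma measurable_splits (h : T -> word -> hyp) (H : T -> hyp) e :
  (forall e, measurable_fun setT (h ^~ e)) -> measurable_fun setT H ->
  measurable [set t | splits (h t) e (H t)].
Proof.
move=> mh mH; apply: measurableI.
  exact: (measurable_hit_cell (h := h)).
rewrite [X in measurable X](_ : _ =
  [set t | nondeg W (upd (h t) e (H t)) (false :: e)] `&`
  [set t | nondeg W (upd (h t) e (H t)) (true :: e)]).
  by apply: measurableI; apply: (@measurable_nondeg _ _ _ _ (fun t => upd (h t) e (H t)));
    move=> e'; exact: measurable_upd.
apply/seteqP; split => [t nd|t [? ?] []//]; split; exact: nd.
Qed.

Lemma measurable_valid s : (latest s <= N)%N -> measurable [set t | valid (g t) s].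
Proof.
elim: s => [_|n s IH /= nN].
  by rewrite [X in measurable X](_ : _ = setT)//; apply/seteqP.
have [si|si] := boolP (increasing (n :: s)); last first.
  rewrite [X in measurable X](_ : _ = set0)//; apply/seteqP; split => // t.
  by move=> /(@valid_increasing _ (n :: s)); apply/negP.
move: si => /= /andP[hn si].
rewrite [X in measurable X](_ : _ = [set t | valid (g t) s] `&`
  ([set t | misses (g t) s (n - latest s).-1] `&`
   [set t | splits (seqh (g t) s) (word_of (size s)) (g t n)])).
  apply: measurableI; first by apply: IH; lia.
  apply: measurableI; first by apply: measurable_misses => //; lia.
  apply: measurable_splits; last by apply: mg; lia.
  by move=> e; apply: measurable_seqh => //; lia.
by apply/seteqP; split => [t [? ? ? ?]|t [? [? ?]]].
Qed.

End Measurability.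

Section Probability.
Context d (Omega : measurableType d) (P : probability Omega R).
Variable G : nat -> Omega -> hyp.
Hypothesis mG : forall n, measurable_fun setT (G n).

Definition past n : set (set Omega) :=
  \bigcup_(i in [set i | (0 < i < n)%N]) g_sigma_algebra_preimage (G i).

Hypothesis G_indep : forall n A B, (0 < n)%N -> <<s past n >> A -> measurable B ->
  P (A `&` G n @^-1` B) = (P A * nu B)%E.

Local Notation pastT n := (g_sigma_algebraType (past n)).
Local Notation g w := (fun n => G n w).

Lemma measurable_past n (A : set Omega) :
  measurable (A : set (pastT n)) -> measurable A.
Proof.
apply: smallest_sub; first exact: sigma_algebra_measurable.
by move=> _ [i _ [B mB <-]]; exact: mG.
Qed.

Lemma measurable_fun_past n i : (0 < i < n)%N ->
  measurable_fun setT (G i : pastT n -> hyp).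
Proof.
move=> iN _ B mB; apply: sub_sigma_algebra; exists i => //.
by exists B.
Qed.

(** The set [D] restricts the next hyperplane by conditions known from the past; extension by 0
    brings this under [freezing]. *)
Lemma freeze_next n (D : set (pastT n * hyp)) (f : pastT n * hyp -> \bar R) :
  (0 < n)%N -> measurable D -> measurable_fun setT f -> (forall z, 0 <= f z)%E ->
  (\int[P]_(w in [set w | D (w, G n w)]) f (w, G n w) =
   \int[P]_w \int[nu]_(y in [set y | D (w, y)]) f (w, y))%E.
Proof.
move=> n0 mD mf f0.
have := @freezing _ Omega R P _ _ (pastT n) hyp id (G n) nu (f \_ D).
move=> H.
transitivity (\int[P]_w (f \_ D) (w, G n w))%E.
  rewrite integral_mkcond; apply: eq_integral => w _.
  by rewrite !patchE.
transitivity (\int[P]_w \int[nu]_y (f \_ D) (w, y))%E; last first.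
  by apply: eq_integral => w _; rewrite [RHS]integral_mkcond.
apply: H.
- by move=> _ A mA; rewrite setTI; exact: (measurable_past mA).
- exact: mG.
- by move=> A B mA mB; apply: G_indep.
- by apply: (measurable_restrictT _ mD).1; exact: measurable_funTS.
- by move=> z; apply: erestrict_ge0.
Qed.

(** The last variable is integrated out first. Each miss contributes the probability of missing a
    cell that is already known, and this factor is moved into [f] for the induction. *)
Lemma integral_misses s j (f : (word -> hyp) -> \bar R) : increasing s ->
  cmeas f -> (forall h, 0 <= f h)%E ->
  (\int[P]_(w in [set w | valid (g w) s /\ misses (g w) s j]) f (seqh (g w) s) =
   \int[P]_(w in [set w | valid (g w) s])
     (((1 - hit_prob W nu (word_of (size s)) (seqh (g w) s)) ^+ j)%:E *
      f (seqh (g w) s)))%E.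
Proof.
move=> si; elim: j f => [|j IH] f mf f0.
  under [RHS]eq_integral do rewrite expr0 mul1e.
  congr (integral _ _ _); apply/seteqP; split => [w []//|w vw]; split => //.
  by move=> i; lia.
set e := word_of (size s); set n := (latest s + j.+1)%N.
have mseq n' e' : (latest s < n')%N ->
    measurable_fun setT (fun w : pastT n' => seqh (g w) s e').
  move=> sn; apply: (@measurable_seqh _ (pastT n') (fun w => g w) (latest s)) => //.
  by move=> i i0; apply: measurable_fun_past; lia.
pose D : set (pastT n * hyp) := [set z | (valid (g z.1) s /\ misses (g z.1) s j) /\
   ~ hit (cell W (seqh (g z.1) s) e) z.2].
have sn : (latest s < n)%N by rewrite /n; lia.
have mS : measurable ([set w | valid (g w) s /\ misses (g w) s j] : set (pastT n)).
  apply: measurableI.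
    apply: (@measurable_valid _ (pastT n) (fun w => g w) (latest s)) => //.
    by move=> i i0; apply: measurable_fun_past; lia.
  apply: (@measurable_misses _ (pastT n) (fun w => g w) (latest s + j)%N) => //.
  by move=> i i0; apply: measurable_fun_past; rewrite /n; lia.
have mseq1 e' : measurable_fun setT (fun z : pastT n * hyp => seqh (g z.1) s e').
  exact: (measurableT_comp (mseq n e' sn)).
have mD : measurable D.
  apply: measurableI.
    rewrite -[X in measurable X]setTI.
    exact: (@measurable_fst _ _ (pastT n) hyp measurableT _ mS).
  apply: measurableC.
  by apply: (@measurable_hit_cell _ _ _ _ (fun z : pastT n * hyp => seqh (g z.1) s)).
transitivity (\int[P]_(w in [set w | D (w, G n w)]) f (seqh (g w) s))%E.
  congr (integral _ _ _); apply/seteqP; split => w.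
    move=> [vw mw]; split; first by split => // i i1 i2; apply: mw => //; lia.
    by apply: mw; rewrite /n; lia.
  move=> [[vw mw] nh]; split => // i i1 i2.
  have [ij|ij] := leqP i (latest s + j); first exact: mw.
  by rewrite (_ : i = n); [exact: nh|rewrite /n; lia].
rewrite (freeze_next (f := fun z => f (seqh (g z.1) s)))//; last 2 first.
- by rewrite /n; lia.
- exact: mf.
pose p w := hit_prob W nu e (seqh (g w) s).
pose f' h := ((1 - hit_prob W nu e h)%:E * f h)%E.
transitivity (\int[P]_(w in [set w | valid (g w) s /\ misses (g w) s j])
   f' (seqh (g w) s))%E.
  rewrite [RHS]integral_mkcond; apply: eq_integral => w _; rewrite patchE.
  case: ifPn => [/set_mem vw|/negP vw].
    rewrite (_ : [set y | _] = ~` hit (cell W (seqh (g w) s) e)); last first.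
      by apply/seteqP; split => H // [].
    have mC : measurable (hit (cell W (seqh (g w) s) e)).
      exact: hit_cell_measurable.
    transitivity (\int[nu]_(y in ~` hit (cell W (seqh (g w) s) e))
      cst (f (seqh (g w) s)) y)%E; first by [].
    rewrite (integral_cst _ (measurableC mC)) muleC /f'; congr (_ * _)%E.
    by rewrite [LHS]probability_setC// [nu _]hit_probE.
  rewrite (_ : [set y | _] = set0) ?integral_set0//.
  apply/seteqP; split => // H [vw' _]; apply: vw; exact/mem_set.
rewrite IH.
- by apply: eq_integral => w _; rewrite /f' muleA -EFinM exprSr.
- apply: cmeasM => //.
  apply: (@cmeas_comp _ _ (fun x => 1 - x) (hit_prob W nu e)).
    exact: measurable_funB.
  exact: cmeas_hit_prob.
- by move=> h; apply: mule_ge0 => //; rewrite lee_fin subr_ge0 hit_prob_le1.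
Qed.

Lemma splits_null h e (f : hyp -> \bar R) : nondeg W h e ->
  measurable_fun setT f -> (forall H, 0 <= f H)%E ->
  (\int[nu]_(H in [set H | splits h e H]) f H =
   \int[nu]_(H in hit (cell W h e)) f H)%E.
Proof.
move=> nd mf f0.
have mC : measurable (hit (cell W h e)) by exact: hit_cell_measurable.
pose N b := hit (cell W h e) `&` [set H | ~ nondeg W (upd h e H) (b :: e)].
have mN b : measurable (N b).
  apply: measurableI => //; apply: measurableC.
  apply: (@measurable_nondeg _ _ _ hyp (fun H => upd h e H)) => e'.
  by apply: (measurable_upd (h := fun _ : hyp => h)).
rewrite [RHS](@ge0_negligible_integral _ _ _ _ _ (N false `|` N true))//.
- congr (integral _ _ _); apply/seteqP; split => H.
    by move=> [CH sp]; split => // -[[_]|[_]]; apply.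
  move=> [CH nN]; split => // b; apply: contrapT => nd'; apply: nN.
  by case: b nd' => ?; [right|left].
- exact: measurableU.
- exact: measurable_funTS.
- transitivity (nu (N false)); last exact: touch_null.
  by apply: measureU0 => //; exact: touch_null.
Qed.

(** A hit after [j] misses gives an unnormalized integral over the hitting hyperplanes, whence the
    factor [hit_prob] in front of [divide]. Asking for a split as well removes only a null set. *)
Lemma integral_splits s j (f : (word -> hyp) -> \bar R) : increasing s ->
  cmeas f -> (forall h, 0 <= f h)%E ->
  (\int[P]_(w in [set w | valid (g w) ((latest s + j).+1 :: s)])
     f (seqh (g w) ((latest s + j).+1 :: s)) =
   \int[P]_(w in [set w | valid (g w) s])
     (((1 - hit_prob W nu (word_of (size s)) (seqh (g w) s)) ^+ j *
       hit_prob W nu (word_of (size s)) (seqh (g w) s))%:E *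
      divide W nu (word_of (size s)) f (seqh (g w) s)))%E.
Proof.
move=> si mf f0; set e := word_of (size s); set n := (latest s + j).+1.
have sn : (latest s < n)%N by rewrite /n; lia.
have mseq e' : measurable_fun setT (fun w : pastT n => seqh (g w) s e').
  apply: (@measurable_seqh _ (pastT n) (fun w => g w) (latest s)) => //.
  by move=> i i0; apply: measurable_fun_past; lia.
pose D : set (pastT n * hyp) := [set z | (valid (g z.1) s /\ misses (g z.1) s j) /\
   splits (seqh (g z.1) s) e z.2].
have mS : measurable ([set w | valid (g w) s /\ misses (g w) s j] : set (pastT n)).
  apply: measurableI.
    apply: (@measurable_valid _ (pastT n) (fun w => g w) (latest s)) => //.
    by move=> i i0; apply: measurable_fun_past; lia.
  apply: (@measurable_misses _ (pastT n) (fun w => g w) (latest s + j)%N) => //.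
  by move=> i i0; apply: measurable_fun_past; rewrite /n; lia.
have mseq1 e' : measurable_fun setT (fun z : pastT n * hyp => seqh (g z.1) s e').
  exact: (measurableT_comp (mseq e')).
have mD : measurable D.
  apply: measurableI.
    rewrite -[X in measurable X]setTI.
    exact: (@measurable_fst _ _ (pastT n) hyp measurableT _ mS).
  by apply: (@measurable_splits _ _ (fun z : pastT n * hyp => seqh (g z.1) s) snd).
have nE : (n - latest s).-1 = j by rewrite /n; lia.
pose f1 (z : pastT n * hyp) := f (upd (seqh (g z.1) s) e z.2).
transitivity (\int[P]_(w in [set w | D (w, G n w)]) f1 (w, G n w))%E.
  rewrite (_ : [set w | valid _ _] = [set w | D (w, G n w)]).
    by apply: eq_integral => w _; rewrite seqh_cons.
  apply/seteqP; split => w.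
    by move=> [vs _ mis sp]; rewrite nE in mis.
  by move=> [[vs mis] sp]; split; rewrite ?nE.
rewrite (freeze_next (f := f1))//; last 2 first.
- apply: (mf _ _ (fun z : pastT n * hyp => upd (seqh (g z.1) s) e z.2)) => e'.
  by apply: (measurable_upd (h := fun z : pastT n * hyp => seqh (g z.1) s)).
- by move=> z; exact: f0.
pose f' h := ((hit_prob W nu e h)%:E * divide W nu e f h)%E.
transitivity (\int[P]_(w in [set w | valid (g w) s /\ misses (g w) s j])
   f' (seqh (g w) s))%E.
  rewrite [RHS]integral_mkcond; apply: eq_integral => w _; rewrite patchE.
  case: ifPn => [/set_mem vw|/negP vw].
    have nd : nondeg W (seqh (g w) s) e by apply: valid_nondeg_next; case: vw.
    rewrite (_ : [set y | _] = [set y | splits (seqh (g w) s) e y]); last first.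
      by apply/seteqP; split => H // [].
    rewrite splits_null//; last 2 first.
    - apply: (mf _ _ (fun y : hyp => upd (seqh (g w) s) e y)) => e'.
      by apply: (measurable_upd (h := fun _ : hyp => seqh (g w) s)).
    - by move=> H; exact: f0.
    rewrite /f' /divide muleA -EFinM divff ?mul1e//.
    by rewrite gt_eqF// hit_prob_gt0.
  rewrite (_ : [set y | _] = set0) ?integral_set0//.
  apply/seteqP; split => // H [vw' _]; apply: vw; exact/mem_set.
rewrite integral_misses//.
- by apply: eq_integral => w _; rewrite /f' muleA -EFinM.
- by apply: cmeasM; [exact: cmeas_hit_prob|exact: cmeas_divide].
- by move=> h; apply: mule_ge0; [rewrite lee_fin hit_prob_ge0|exact: divide_ge0].
Qed.

Lemma geometric_esum (p : R) (c : \bar R) : 0 < p -> p <= 1 -> (0 <= c)%E ->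
  (\sum_(j <oo) (((1 - p) ^+ j * p)%:E * c) = c)%E.
Proof.
move=> p0 p1 c0; have pj j : 0 <= (1 - p) ^+ j * p.
  by rewrite mulr_ge0 ?exprn_ge0 ?subr_ge0// ltW.
have H : (\sum_(j <oo) ((1 - p) ^+ j * p)%:E = 1)%E.
  apply/cvg_lim => //.
  rewrite (_ : (fun n => _) = EFin \o series (geometric p (1 - p))); last first.
    apply/funext => n; rewrite /= /series/= -sumEFin; apply: eq_bigr => i _.
    by rewrite mulrC.
  apply: cvg_EFin; first by apply: nearW.
  have := @cvg_geometric_series _ p (1 - p).
  rewrite subKr divff ?gt_eqF//; apply.
  by rewrite ger0_norm ?subr_ge0// ltrBlDl ltrDr.
case: c c0 => [c c0| _|//].
  under eq_eseriesr do rewrite muleC.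
  by rewrite nneseriesZl ?H ?mule1// => i _; rewrite lee_fin.
(* For [c = +oo] the term with [j = 0] is already infinite. *)
apply/eqP; rewrite eq_le leey/=.
have := @nneseries_lim_ge R (fun j => ((1 - p) ^+ j * p)%:E * +oo)%E xpredT 0%N 1%N.
rewrite big_nat1 expr0 mul1r gt0_muley ?lte_fin//; apply => n _ _.
by rewrite mule_ge0// lee_fin.
Qed.

(** Summing over the number [j] of misses frees the law of the next hyperplane from the search. *)
Lemma integral_valid_next s (f : (word -> hyp) -> \bar R) : increasing s ->
  cmeas f -> (forall h, 0 <= f h)%E ->
  (\sum_(j <oo) \int[P]_(w in [set w | valid (g w) ((latest s + j).+1 :: s)])
     f (seqh (g w) ((latest s + j).+1 :: s)) =
   \int[P]_(w in [set w | valid (g w) s])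
      divide W nu (word_of (size s)) f (seqh (g w) s))%E.
Proof.
move=> si mf f0; under eq_eseriesr do rewrite integral_splits//.
have mG' i : (0 < i <= latest s)%N -> measurable_fun setT (G i) by [].
have mseq e' : measurable_fun setT (fun w => seqh (g w) s e').
  exact: (measurable_seqh mG').
rewrite -integral_nneseries.
- apply: eq_integral => w /set_mem vw; rewrite geometric_esum//.
  + by apply: hit_prob_gt0; exact: valid_nondeg_next.
  + exact: hit_prob_le1.
  + exact: divide_ge0.
- exact: (measurable_valid mG').
- move=> j; apply: measurable_funTS; apply: emeasurable_funM.
    apply/measurable_EFinP; apply: measurable_funM; last first.
      by apply/measurable_EFinP; exact: cmeas_hit_prob.
    apply: measurable_funX; apply: measurable_funB => //.
    by apply/measurable_EFinP; exact: cmeas_hit_prob.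
  exact: cmeas_divide.
- move=> j w _; apply: mule_ge0; last exact: divide_ge0.
  by rewrite lee_fin mulr_ge0 ?exprn_ge0 ?subr_ge0 ?hit_prob_le1 ?hit_prob_ge0.
Qed.

End Probability.

(* The hyperplane dividing the cell of e, H'(e) in the paper; unlike kappa it is
   a measurable function of g everywhere. *)
Definition hdiv g e : hyp :=
  seqh g (xget [::] [set s | size s = (word_index e).+1 /\ valid g s]) e.

Lemma hdivE g s e : valid g s -> (word_index e < size s)%N ->
  hdiv g e = seqh g s e.
Proof.
elim: s => // n s IH vs /=; rewrite ltnS leq_eqVlt => /predU1P[es|es].
  rewrite /hdiv; congr (seqh _ _ _); apply: xget_unique; first by rewrite es.
  by move=> s' [ss' vs']; apply: (valid_uniq vs' vs); rewrite ss' es.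
rewrite IH//; last by case: vs.
rewrite seqh_cons /upd; case: eqP => // ee.
by rewrite ee word_ofK ltnn in es.
Qed.

Lemma measurable_hdiv d (T : measurableType d) (g : T -> nat -> hyp) e :
  (forall i, (0 < i)%N -> measurable_fun setT (g ^~ i)) ->
  measurable_fun setT (fun t => hdiv (g t) e).
Proof.
move=> mg _ B mB; rewrite setTI.
pose U s := [set t | size s = (word_index e).+1 /\ valid (g t) s].
have mU s : measurable (U s).
  apply: measurableI; first exact: measurable_pred.
  by apply: (@measurable_valid _ _ _ (latest s)) => // i /andP[i0 _]; exact: mg.
have mUU : measurable (\bigcup_s U s).
  by apply: countable_bigcupT_measurable.
(* Only countably many [s] are possible; without a valid one, [xget] returns the empty sequence, for
   which [seqh] is [point]. *)
rewrite (_ : _ @^-1` _ =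
  (\bigcup_s (U s `&` (if increasing s then [set t | B (seqh (g t) s e)] else set0)))
  `|` (~` (\bigcup_s U s) `&` [set _ | B point])).
  apply: measurableU; last first.
    by apply: measurableI; [exact: measurableC|exact: measurable_pred].
  apply: countable_bigcupT_measurable => // s; apply: measurableI => //.
  case: ifPn => // si; rewrite -[X in measurable X]setTI.
  by apply: (@measurable_seqh _ _ _ (latest s)) => // i /andP[i0 _]; exact: mg.
apply/seteqP; split => t.
  rewrite /hdiv /=; case: xgetP => [s _ [ss vs] Bs|nU Bp].
    left; exists s => //; split; first by split.
    by rewrite (valid_increasing vs).
  right; split; first by move=> [s _ Us]; exact: (nU s).
  by move: Bp; rewrite /seqh /= nth_nil.
move=> [[s _ [[ss vs]]]|[nU Bp]].
  by rewrite (valid_increasing vs) /= (hdivE vs)// ss.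
rewrite /= /hdiv xgetPN; first by rewrite /seqh /= nth_nil.
by move=> s Us; apply: nU; exists s.
Qed.

Section Law.
Context d (Omega : measurableType d) (P : probability Omega R).
Variable G : nat -> Omega -> hyp.
Hypothesis mG : forall n, measurable_fun setT (G n).
Hypothesis G_indep : forall n A B, (0 < n)%N -> <<s past G n >> A -> measurable B ->
  P (A `&` G n @^-1` B) = (P A * nu B)%E.
Local Notation g w := (fun n => G n w).

Definition found m : set Omega := [set w | exists2 s, size s = m & valid (g w) s].

Lemma measurable_validG s : measurable [set w | valid (g w) s].
Proof. exact: (@measurable_valid _ _ (fun w => g w) (latest s)). Qed.

Lemma measurable_found m : measurable (found m).
Proof.
rewrite (_ : found m =
  \bigcup_s ([set _ | size s = m] `&` [set w | valid (g w) s])).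
  apply: countable_bigcupT_measurable => // s; apply: measurableI.
    exact: measurable_pred.
  exact: measurable_validG.
by apply/seteqP; split => w; [move=> [s ? ?]; exists s|move=> [s _ [? ?]]; exists s].
Qed.

Definition extended s : set Omega :=
  \bigcup_j [set w | valid (g w) ((latest s + j).+1 :: s)].

Lemma measurable_extended s : measurable (extended s).
Proof. by apply: bigcupT_measurable => j; exact: measurable_validG. Qed.

Lemma extended_sub s : extended s `<=` [set w | valid (g w) s].
Proof. by move=> w [j _ []]. Qed.

Lemma trivIset_extended s :
  trivIset setT (fun j => [set w | valid (g w) ((latest s + j).+1 :: s)]).
Proof.
move=> i j _ _ [w [vi vj]].
by have [] := valid_uniq vi vj erefl; lia.
Qed.

Lemma divide1 e h : nondeg W h e -> divide W nu e (fun=> 1%E) h = 1%E.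
Proof.
move=> nd; rewrite /divide.
have mC : measurable (hit (cell W h e)) by exact: hit_cell_measurable.
rewrite (integral_cst _ mC) mul1e.
transitivity ((hit_prob W nu e h)^-1%:E * (hit_prob W nu e h)%:E)%E.
  by congr (_ * _)%E; exact: hit_probE.
by rewrite -EFinM mulVf// gt_eqF// hit_prob_gt0.
Qed.

(** The summation over misses, applied to the constant 1, shows that no mass is lost when the
    sequence is extended. *)
Lemma extended_null s : P ([set w | valid (g w) s] `\` extended s) = 0%E.
Proof.
have [si|si] := boolP (increasing s); last first.
  rewrite (_ : _ `\` _ = set0) ?measure0//; apply/seteqP; split => // w [vw _].
  by move/negP : si; apply; exact: valid_increasing vw.
have PE : P (extended s) = P [set w | valid (g w) s].
  rewrite measure_semi_bigcup//; last 3 first.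
  - by move=> j; exact: measurable_validG.
  - exact: trivIset_extended.
  - exact: measurable_extended.
  transitivity (\int[P]_(w in [set w | valid (g w) s]) cst 1%E w)%E; last first.
    by rewrite [LHS]integral_cst ?mul1e//; exact: measurable_validG.
  transitivity (\sum_(j <oo) \int[P]_(w in [set w | valid (g w) ((latest s + j).+1 :: s)])
     (cst 1%E) (seqh (g w) ((latest s + j).+1 :: s)))%E.
    apply: eq_eseriesr => j _; apply/esym.
    by rewrite [LHS](@integral_cst _ _ _ P _ (measurable_validG _) 1%E) mul1e.
  have c0 (h : word -> hyp) : (0 <= (1 : \bar R))%E by exact: lee01.
  have := integral_valid_next mG G_indep si (@cmeas_cst _ (hyperplane R l) R 1%E) c0.
  move=> -> .
  apply: eq_integral => w /set_mem vw; apply: divide1.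
  exact: valid_nondeg_next.
have mv := measurable_validG s; have me := measurable_extended s.
rewrite measureD//= ?(ltey_eq, fin_num_measure)//.
rewrite setIidr; last exact: extended_sub.
by rewrite PE subee// fin_num_measure.
Qed.

Lemma found_ae m : P (~` found m) = 0%E.
Proof.
elim: m => [|m IH].
  rewrite (_ : ~` _ = set0) ?measure0//; apply/seteqP; split => // w.
  by apply; exists [::].
pose F i := if @unpickle (seq nat) i is Some s
  then [set w | valid (g w) s] `\` extended s else set0.
have mF i : measurable (F i).
  rewrite /F; case: unpickle => // s; apply: measurableD.
    exact: measurable_validG.
  exact: measurable_extended.
have F0 i : P (F i) = 0%E.
  by rewrite /F; case: unpickle => [s|]; [exact: extended_null|rewrite measure0].
have sub : ~` found m.+1 `<=` ~` found m `|` \bigcup_i F i.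
  move=> w nf; have [[s ss vs]|nf'] := pselect (found m w); last by left.
  right; exists (pickle s) => //; rewrite /F pickleK; split => // -[j _ vj].
  by apply: nf; exists ((latest s + j).+1 :: s) => //=; rewrite ss.
have mU : measurable (\bigcup_i F i) by exact: bigcupT_measurable.
have FU0 : P (\bigcup_i F i) = 0%E.
  apply/eqP; rewrite eq_le measure_ge0 andbT.
  have := measure_sigma_subadditive P mF mU (@subset_refl _ _).
  by rewrite eseries0// => n _ _; exact: F0.
have mfd := measurableC (measurable_found m).
apply: (subset_measure0 (measurableC (measurable_found _)) _ sub).
  exact: measurableU.
by transitivity (P (~` found m)) => //; apply: measureU0.
Qed.

Definition depends_below m (f : (word -> hyp) -> \bar R) := forall h h',
  (forall e, (word_index e < m)%N -> h e = h' e) -> f h = f h'.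

Lemma divide_depends e f : depends_below (word_index e).+1 f ->
  depends_below (word_index e) (divide W nu e f).
Proof.
move=> df h h' hh.
have ce : cell W h e = cell W h' e.
  by apply: eq_cell => p b /psuffix_cons/psuffix_index; exact: hh.
rewrite /divide /hit_prob ce; congr (_ * _)%E; apply: eq_integral => H _.
apply: df => e' e'e; rewrite /upd; case: eqP => // ne; apply: hh.
by rewrite ltn_neqAle (inj_eq word_index_inj) -ltnS e'e andbT; exact/eqP.
Qed.

Lemma integral_found (f : Omega -> \bar R) S : measurable S -> P (~` S) = 0%E ->
  measurable_fun setT f -> (forall w, 0 <= f w)%E ->
  (\int[P]_w f w = \int[P]_(w in S) f w)%E.
Proof.
move=> mS S0 mf f0.
rewrite (@ge0_negligible_integral _ _ _ _ _ (~` S))//; last exact: measurableC.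
by rewrite setTD setCK.
Qed.

Lemma measurable_hdivG e : measurable_fun setT (fun w => hdiv (g w) e).
Proof. by apply: measurable_hdiv. Qed.

(** On each event that fixes the values of [kappa] before [e], the next value is summed out. As [f]
    sees no word after [e], a finite sequence determines its argument. *)
Lemma first_hit e (f : (word -> hyp) -> \bar R) : cmeas f ->
  (forall h, 0 <= f h)%E -> depends_below (word_index e).+1 f ->
  (\int[P]_w f (hdiv (g w)) = \int[P]_w divide W nu e f (hdiv (g w)))%E.
Proof.
move=> mf f0 df; set m := word_index e.
have d0 h : (0 <= divide W nu e f h)%E by exact: divide_ge0.
have md : cmeas (divide W nu e f) by exact: cmeas_divide.
have mh := measurable_hdivG.
rewrite !(@integral_found _ (found m))//; [|exact: measurable_found|exact: found_ae
  |exact: md|exact: measurable_found|exact: found_ae|exact: mf].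
(* With [pickle_inv] each sequence has exactly one index, which makes the pieces disjoint. *)
pose F i := if @pickle_inv (seq nat) i is Some s then
  if size s == m then [set w | valid (g w) s] else set0 else set0.
have mF i : measurable (F i).
  rewrite /F; case: pickle_inv => // s; case: ifP => // _; exact: measurable_validG.
have FE : found m = \bigcup_i F i.
  apply/seteqP; split => [w [s ss vs]|w [i _]].
    by exists (pickle s) => //; rewrite /F pickleK_inv ss eqxx.
  by rewrite /F; case: pickle_inv => // s; case: ifP => // /eqP ss vs; exists s.
have tF : trivIset setT F.
  move=> i j _ _ [w []]; rewrite /F.
  have Ki := @pickle_invK (seq nat) i; have Kj := @pickle_invK (seq nat) j.
  case Ei : (pickle_inv i) Ki => [s|]//= Ki; case: ifP => // /eqP ss vs.
  case Ej : (pickle_inv j) Kj => [s'|]//= Kj; case: ifP => // /eqP ss' vs'.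
  by rewrite -Ki -Kj (valid_uniq vs vs')// ss ss'.
rewrite FE !ge0_integral_bigcup//; [|by apply: measurable_funTS; exact: md
  |by apply: measurable_funTS; exact: mf].
apply: eq_eseriesr => i _; rewrite /F; case: pickle_inv => [s|]; last first.
  by rewrite !integral_set0.
case: ifP => [/eqP sm|_]; last by rewrite !integral_set0.
have [si|si] := boolP (increasing s); last first.
  rewrite (_ : [set w | _] = set0) ?integral_set0//; apply/seteqP; split => // w vw.
  by move/negP : si; apply; exact: valid_increasing vw.
have mv := measurable_validG s; have me := measurable_extended s.
have we : word_of (size s) = e by rewrite sm /m word_indexK.
have mNull : measurable ([set w | valid (g w) s] `\` extended s) by exact: measurableD.
rewrite (@ge0_negligible_integral _ _ _ _ _ _ _ mNull mv)//; last 2 first.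
- by apply: measurable_funTS; exact: mf.
- exact: extended_null.
rewrite setDD setIidr; last exact: extended_sub.
rewrite ge0_integral_bigcup//; [|by move=> j; exact: measurable_validG
  |by apply: measurable_funTS; exact: mf|exact: trivIset_extended].
transitivity (\sum_(j <oo) \int[P]_(w in [set w | valid (g w) ((latest s + j).+1 :: s)])
     f (seqh (g w) ((latest s + j).+1 :: s)))%E.
  apply: eq_eseriesr => j _; apply: eq_integral => w /set_mem vw; apply: df => e' e'm.
  by rewrite (hdivE vw)//= sm.
rewrite (integral_valid_next mG G_indep)// we.
apply: eq_integral => w /set_mem vw.
by apply: (divide_depends df) => e' e'm; rewrite (hdivE vw)//= sm.
Qed.

End Law.
End Hitting.

(** * Joint law of the hyperplanes dividing the inner nodes of a tree *)

Fixpoint rev_tree (s : seq word) : bool := if s is e :: s' then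
  [&& e \notin s', (if e is _ :: p then p \in s' else true) & rev_tree s']
  else true.

(* es enumerates without repetition the inner nodes of a binary tree, each one
   after its predecessor. *)
Definition tree_order (es : seq word) := rev_tree (rev es).

Lemma tree_order_rcons es e : tree_order (rcons es e) =
  [&& e \notin es, (if e is _ :: p then p \in es else true) & tree_order es].
Proof.
rewrite /tree_order rev_rcons /= mem_rev; congr (_ && (_ && _)).
by case: e => // b p; rewrite mem_rev.
Qed.

Lemma tree_order_uniq es : tree_order es -> uniq es.
Proof.
elim/last_ind: es => // es e IH; rewrite tree_order_rcons rcons_uniq.
by move=> /and3P[-> _ /IH].
Qed.

Lemma tree_order_closed es : tree_order es -> prefix_closed es.
Proof.
elim/last_ind: es => // es e IH; rewrite tree_order_rcons => /and3P[_ pe /IH pc].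
move=> b p; rewrite !mem_rcons !inE => /predU1P[be|/pc ->]; rewrite ?orbT//.
by move: pe; rewrite -be => ->; rewrite orbT.
Qed.

Lemma tree_order_size es p : tree_order es -> p \in es -> (size p < size es)%N.
Proof.
elim/last_ind: es p => // es e IH p; rewrite tree_order_rcons => /and3P[_ pe tes].
rewrite mem_rcons inE size_rcons => /predU1P[->|/(IH _ tes)]; last lia.
by case: e pe => // b q /= /(IH _ tes).
Qed.

Lemma psuffix_parent p b e : psuffix p (b :: e) -> suffix p e.
Proof. by move=> /andP[pe]; exact: suffix_cons_neq. Qed.

Lemma psuffix_trans p q e : psuffix p q -> suffix q e -> psuffix p e.
Proof.
move=> pq qe; rewrite /psuffix; case/andP: (pq) => pq' _.
rewrite (suffix_trans pq' qe)/=; apply: contraTneq qe => <-.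
by apply/negP => /word_index_suffix; have := psuffix_index pq; lia.
Qed.

Section IteratedLaw.
Context (R : realType) (l : nat).
Local Notation V := 'rV[R]_l.+1.
Local Notation hyp := (hyperplane R l).
Implicit Types (h : word -> hyp) (e p : word) (es : seq word).
Variables (W : set V) (nu : probability hyp R).
Hypothesis W_polytope : polytope W.
Hypothesis W_int : W° !=set0.
Hypothesis hit_prob_gt0 : forall e h, nondeg W h e -> 0 < hit_prob W nu e h.
Hypothesis touch_null : forall h e b, nondeg W h e ->
  nu (hit (cell W h e) `&` [set H | ~ nondeg W (upd h e H) (b :: e)]) = 0%E.

Definition depends_on (S : pred word) (f : (word -> hyp) -> \bar R) := forall h h',
  (forall e, S e -> h e = h' e) -> f h = f h'.

Lemma divide_depends_on (S : pred word) e f : (forall p, psuffix p e -> S p) ->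
  depends_on (fun e' => S e' || (e' == e)) f -> depends_on S (divide W nu e f).
Proof.
move=> Se df h h' hh.
have ce : cell W h e = cell W h' e.
  by apply: eq_cell => p b /psuffix_cons/Se; exact: hh.
rewrite /divide /hit_prob ce; congr (_ * _)%E; apply: eq_integral => H _.
apply: df => e' Se'; rewrite /upd; case: eqP => // ne; apply: hh.
by case/orP: Se' => // /eqP.
Qed.

(** Neither hyperplane changes the cell divided by the other one, so that both sides are integrals
    over the same product set. *)
Lemma divideC e e' f h : ~~ psuffix e e' -> ~~ psuffix e' e -> e != e' ->
  cmeas f -> (forall h, 0 <= f h)%E ->
  divide W nu e (divide W nu e' f) h = divide W nu e' (divide W nu e f) h.
Proof.
move=> ee' e'e ne mf f0.
pose A := hit (cell W h e); pose B := hit (cell W h e').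
have mA : measurable A by exact: hit_cell_measurable.
have mB : measurable B by exact: hit_cell_measurable.
pose phi (z : hyp * hyp) := f (upd (upd h e z.1) e' z.2).
have mphi : measurable_fun setT phi.
  apply: (mf _ _ (fun z : hyp * hyp => upd (upd h e z.1) e' z.2)) => e1.
  apply: (measurable_upd (h := fun z : hyp * hyp => upd h e z.1)) => // e2.
  exact: (measurable_upd (h := fun _ : hyp * hyp => h)).
have phi0 z : (0 <= phi z)%E by exact: f0.
pose g := phi \_ (A `*` B).
have mg : measurable_fun setT g.
  apply: (measurable_restrictT _ (measurableX mA mB)).1.
  exact: measurable_funTS.
have g0 z : (0 <= g z)%E by exact: erestrict_ge0.
have c0 e1 : (0 <= (hit_prob W nu e1 h)^-1%:E)%E.
  by rewrite lee_fin invr_ge0 hit_prob_ge0.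
have E1 : divide W nu e (divide W nu e' f) h =
    ((hit_prob W nu e h)^-1%:E * ((hit_prob W nu e' h)^-1%:E *
      \int[nu]_x \int[nu]_y g (x, y)))%E.
  rewrite {1}/divide; congr (_ * _)%E.
  have Z := ge0_integralZl nu measurableT
    (measurable_fun_fubini_tonelli_F (m2 := nu) g mg g0)
    (fun x _ => integral_ge0 nu (fun y _ => g0 (x, y))) (c0 e').
  rewrite -Z.
  rewrite [LHS]integral_mkcond; apply: eq_integral => x _; rewrite patchE.
  case: ifPn => [/set_mem Ax|/negP Ax].
    rewrite /divide /hit_prob !cell_upd//; congr (_ * _)%E.
    rewrite [LHS]integral_mkcond; apply: eq_integral => y _.
    by rewrite /g !patchE in_setX (mem_set Ax).
  rewrite [X in (_ * X)%E]integral0_eq ?mule0// => y _.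
  by rewrite /g patchE in_setX; case: ifPn => // /andP[].
have E2 : divide W nu e' (divide W nu e f) h =
    ((hit_prob W nu e' h)^-1%:E * ((hit_prob W nu e h)^-1%:E *
      \int[nu]_y \int[nu]_x g (x, y)))%E.
  rewrite {1}/divide; congr (_ * _)%E.
  have Z := ge0_integralZl nu measurableT
    (measurable_fun_fubini_tonelli_G (m1 := nu) g mg g0)
    (fun y _ => integral_ge0 nu (fun x _ => g0 (x, y))) (c0 e).
  rewrite -Z.
  rewrite [LHS]integral_mkcond; apply: eq_integral => y _; rewrite patchE.
  case: ifPn => [/set_mem By|/negP By].
    rewrite /divide /hit_prob !cell_upd//; congr (_ * _)%E.
    rewrite [LHS]integral_mkcond; apply: eq_integral => x _.
    rewrite /g !patchE in_setX (mem_set By) andbT /phi/= (updC _ _ _ ne).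
    by [].
  rewrite [X in (_ * X)%E]integral0_eq ?mule0// => x _.
  by rewrite /g patchE in_setX; case: ifPn => // /andP[].
rewrite E1 E2 muleCA; congr (_ * (_ * _))%E; exact: fubini_tonelli.
Qed.

Section Law.
Context d (Omega : measurableType d) (P : probability Omega R).
Variable G : nat -> Omega -> hyp.
Hypothesis mG : forall n, measurable_fun setT (G n).
Hypothesis G_indep : forall n A B, (0 < n)%N -> <<s past G n >> A -> measurable B ->
  P (A `&` G n @^-1` B) = (P A * nu B)%E.
Local Notation hd w := (hdiv W (fun n => G n w)).

Let hit1 := first_hit W_polytope W_int hit_prob_gt0 touch_null mG G_indep.

(* Conditionally on the hyperplanes of the words that do not descend from e, the
   hyperplane of e has law nu conditioned on hitting the cell of e. *)
Lemma integral_divide e m f : cmeas f -> (forall h, 0 <= f h)%E ->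
  depends_on (fun e' => ~~ psuffix e e' && (word_index e' < m)%N) f ->
  (\int[P]_w f (hd w) = \int[P]_w divide W nu e f (hd w))%E.
Proof.
elim: m f => [|m IH] f mf f0 df.
  apply: hit1 => // h h' hh; apply: df => e' /andP[_]; lia.
have [me|me] := leqP m (word_index e).
  apply: hit1 => // h h' hh; apply: df => e' /andP[_ e'm]; apply: hh; lia.
set e' := word_of m.
(* A strict descendant of [e] is not seen by [f], so that the bound drops to [m]. *)
have [ee'|ee'] := boolP (psuffix e e').
  apply: IH => // h h' hh; apply: df => e1 /andP[e1e e1m]; apply: hh.
  rewrite e1e/=; move: e1m; rewrite ltnS leq_eqVlt => /predU1P[e1m|//].
  by move: e1e; rewrite (_ : e1 = e') ?ee'// /e' -e1m word_indexK.
have ie' : word_index e' = m by rewrite word_ofK.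
have e'e : ~~ psuffix e' e by apply/negP => /psuffix_index; lia.
have ne : e != e' by apply: contraTneq me => ->; rewrite ie' ltnn.
have de' : depends_on (fun e1 => ~~ psuffix e e1 && (word_index e1 < m)%N)
    (divide W nu e' f).
  apply: divide_depends_on => [p pe'|h h' hh].
    rewrite -ie' psuffix_index// andbT; apply: contra ee' => /psuffix_trans; apply.
    by case/andP: pe'.
  apply: df => e1 /andP[e1e e1m]; apply: hh; rewrite e1e/=.
  move: e1m; rewrite ltnS leq_eqVlt => /predU1P[e1m|->//].
  by rewrite /e' -e1m word_indexK eqxx orbT.
have md e1 f1 : cmeas f1 -> (forall h, 0 <= f1 h)%E -> cmeas (divide W nu e1 f1).
  by move=> ? ?; exact: cmeas_divide.
have d0 e1 f1 h : (forall h, 0 <= f1 h)%E -> (0 <= divide W nu e1 f1 h)%E.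
  by move=> ?; exact: divide_ge0.
(* The last word [e'] is integrated out, the induction hypothesis deals with [e], and [e'] is
   restored after the exchange. *)
transitivity (\int[P]_w divide W nu e' f (hd w))%E.
  by apply: hit1 => // h h' hh; apply: df => e1 /andP[_ e1m]; apply: hh; rewrite ie'.
transitivity (\int[P]_w divide W nu e (divide W nu e' f) (hd w))%E.
  by apply: IH de'; [exact: md|move=> h; exact: d0].
transitivity (\int[P]_w divide W nu e' (divide W nu e f) (hd w))%E.
  by apply: eq_integral => w _; exact: divideC.
apply/esym; apply: hit1; [exact: md|by move=> h; exact: d0|].
have : depends_on (fun e1 => (word_index e1 < m.+1)%N) (divide W nu e f).
  apply: divide_depends_on => [p /psuffix_index|h h' hh]; first by lia.
  by apply: df => e1 /andP[_ e1m]; apply: hh; rewrite e1m.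
by move=> de h h' hh; apply: de => e1 e1m; apply: hh; rewrite ie'.
Qed.

Lemma tree_order_psuffix es p e : tree_order es ->
  (if e is _ :: q then q \in es else true) -> psuffix p e -> p \in es.
Proof.
move=> tes; case: e => [|b q] qe; first by move=> /andP[]; rewrite suffixs0 => ->.
move=> /psuffix_parent pq; exact: prefix_closed_suffix (tree_order_closed tes) pq qe.
Qed.

(** The last word of [es] has no strict descendant in [es], so that it can be integrated out first
    whatever its rank. The start [h0] is arbitrary since the result depends on no hyperplane. *)
Lemma integral_tree es f h0 : tree_order es -> cmeas f ->
  (forall h, 0 <= f h)%E -> depends_on (mem es) f ->
  (\int[P]_w f (hd w) = foldr (divide W nu) f es h0)%E.
Proof.
elim/last_ind: es f => [|es e IH] f tes mf f0 df.
  rewrite /= (_ : (fun w => _) = cst (f h0)); last first.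
    by apply/funext => w; exact: df.
  transitivity (f h0 * P setT)%E; first exact: integral_cst.
  by rewrite -[RHS]mule1; congr (_ * _)%E; exact: probability_setT.
move: tes; rewrite tree_order_rcons => /and3P[ees pe tes].
rewrite foldr_rcons -IH//.
- apply: (@integral_divide e (\max_(e' <- rcons es e) (word_index e').+1)%N) => //.
  move=> h h' hh; apply: df => e' e'es; apply: hh; apply/andP; split.
    move: e'es; rewrite /= mem_rcons inE => /predU1P[->|e'es].
      by rewrite psuffixxx.
    apply: contra ees => ee'; apply: prefix_closed_suffix e'es.
      exact: tree_order_closed.
    by case/andP: ee'.
  have {}e'es : e' \in rcons es e := e'es.
  by rewrite (big_rem e')//= leq_max leqnn.
- exact: cmeas_divide.
- by move=> h; exact: divide_ge0.
- apply: divide_depends_on => [p pe'|h h' hh]; first exact: tree_order_psuffix pe'.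
  apply: df => e'; rewrite /= mem_rcons inE => e'es; apply: hh.
  by rewrite /= orbC.
Qed.

End Law.
End IteratedLaw.

(** * Trees of divisions *)

Section ThetaTrees.
Implicit Types (es : seq word) (e p : word).

Lemma tree_order_take es n : tree_order es -> tree_order (take n es).
Proof.
elim/last_ind: es => // es e IH tes.
have [n_es|n_es] := ltnP n (size (rcons es e)); last by rewrite take_oversize.
rewrite size_rcons ltnS in n_es; rewrite -cats1 takel_cat//; apply: IH.
by move: tes; rewrite tree_order_rcons => /and3P[].
Qed.

(* The tuple R in Theta_k whose words r^*_0, ..., r^*_(k-1) are listed in es. *)
Fixpoint children_list es : seq word :=
  if es is e :: es' then [:: false :: e, true :: e & children_list es'] else [::].

Definition node_list es : seq word := [::] :: children_list es.

Lemma mem_node_list es e :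
  (e \in node_list es) = (if e is _ :: p then p \in es else true).
Proof.
rewrite /node_list inE; case: e => [|b p] //=.
elim: es => //= e es IH; rewrite !inE IH !eqseq_cons.
by case: b {IH} => /=; case: (p == e).
Qed.

Lemma size_node_list es : size (node_list es) = (2 * size es).+1.
Proof. by congr _.+1; elim: es => //= e es ->; lia. Qed.

Lemma nth_node_list es s : (s < size es)%N ->
  nth [::] (node_list es) (2 * s).+1 = false :: nth [::] es s /\
  nth [::] (node_list es) (2 * s).+2 = true :: nth [::] es s.
Proof.
rewrite /node_list /=; elim: es s => // e es IH [|s] // /IH.
by rewrite mulnS.
Qed.

Lemma take_node_list es s : take (2 * s).+1 (node_list es) = node_list (take s es).
Proof.
rewrite /node_list /=; congr (_ :: _).
elim: es s => [|e es IH] [|s] //.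
by rewrite mulnS /= IH.
Qed.

Lemma node_list_uniq es : uniq (node_list es) = uniq es.
Proof.
rewrite /node_list /=.
have H e es' : (e \in children_list es') = (e \in node_list es') && (e != [::]).
  rewrite /node_list inE; case: eqVneq => [->|_] /=; last by rewrite andbT.
  by elim: es' => //= e' es' IH; rewrite !inE.
rewrite H eqxx andbF /=; elim: es => //= e es IH.
rewrite !inE !H !mem_node_list IH /= !andbT.
by case: (e \in es).
Qed.

Lemma leaves_node_list es : leaves (node_list es) = [set e | tree_leaf es e].
Proof.
apply/seteqP; split => e; rewrite /leaves /= !mem_node_list /tree_leaf.
  by case/and3P => -> ->.
by case/andP => -> ->.
Qed.

Definition rstars (r : seq word) k : seq word := [seq rstar r s | s <- iota 0 k].

Lemma size_rstars r k : size (rstars r k) = k.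
Proof. by rewrite size_map size_iota. Qed.

Lemma nth_rstars r k s : (s < k)%N -> nth [::] (rstars r k) s = rstar r s.
Proof. by move=> sk; rewrite (nth_map 0%N) ?size_iota// nth_iota. Qed.

Lemma take_rstars r k s : (s <= k)%N -> take s (rstars r k) = rstars r s.
Proof. by move=> sk; rewrite -map_take take_iota (minn_idPl sk). Qed.

Lemma rstars_node_list es : rstars (node_list es) (size es) = es.
Proof.
apply: (@eq_from_nth _ [::]); first by rewrite size_rstars.
move=> s; rewrite size_rstars => ss; rewrite nth_rstars// /rstar.
by have [-> _] := nth_node_list ss.
Qed.

Lemma rstars_rcons r s : rstars r s.+1 = rcons (rstars r s) (rstar r s).
Proof. by rewrite /rstars -addn1 iotaD map_cat cats1. Qed.

(** Together with [Theta_rstars] this identifies [Theta k] with the tree orders of length [k]. *)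
Lemma Theta_node_list k (r : (2 * k).+1.-tuple word) : Theta k r ->
  tval r = node_list (rstars r k) /\ tree_order (rstars r k).
Proof.
move=> [ur r0 rs].
have rsE s : (s < k)%N -> exists2 j, (j <= 2 * s)%N &
    rstar r s = nth [::] r j /\
    (nth [::] r (2 * s).+1 = false :: rstar r s /\
     nth [::] r (2 * s).+2 = true :: rstar r s).
  by move=> /rs[j js [r1 r2]]; exists j => //; rewrite /rstar r1.
have rE : tval r = node_list (rstars r k).
  apply: (@eq_from_nth _ [::]); first by rewrite size_node_list size_rstars size_tuple.
  move=> i; rewrite size_tuple => ik; case: i ik => [|i] ik; first by rewrite r0.
  have sk : (i./2 < size (rstars r k))%N by rewrite size_rstars; lia.
  have [] := nth_node_list sk; rewrite size_rstars in sk; rewrite nth_rstars// => e1 e2.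
  have [j _ [_ [r1 r2]]] := rsE _ sk.
  have [io|io] := boolP (odd i).
    have -> : i.+1 = (2 * i./2).+2 by lia.
    by rewrite e2.
  have -> : i.+1 = (2 * i./2).+1 by lia.
  by rewrite e1.
split => //; have : uniq (rstars r k) by rewrite -node_list_uniq -rE.
(* The word r^*_s is among the first 2s + 1 entries, which are the root and the successors of the
   earlier r^*. *)
have : forall s, (s < k)%N -> if rstar r s is _ :: p then p \in rstars r s else true.
  move=> s sk; have [j js [rj _]] := rsE s sk.
  rewrite -(mem_node_list (rstars r s)) rj -(take_rstars _ (ltnW sk)) -take_node_list -rE.
  rewrite -(@nth_take (2 * s).+1)//; apply: mem_nth.
  by rewrite size_take size_tuple; case: ifP => _; lia.
move=> par us; suff H s : (s <= k)%N -> tree_order (rstars r s) by exact: H.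
elim: s => // s IH sk; rewrite rstars_rcons tree_order_rcons par//= IH ?andbT; last lia.
have := take_uniq s.+1 us.
by rewrite take_rstars// rstars_rcons rcons_uniq => /andP[].
Qed.

Lemma Theta_rstars k (r : (2 * k).+1.-tuple word) :
  tree_order (rstars r k) -> tval r = node_list (rstars r k) -> Theta k r.
Proof.
move=> tes rE; set es := rstars r k in tes rE *.
have ses : size es = k by rewrite size_rstars.
split; first by rewrite rE node_list_uniq tree_order_uniq.
  by rewrite rE.
move=> s sk; rewrite rE; have [|e1 e2] := @nth_node_list es s; first by rewrite ses.
pose e := nth [::] es s.
have : e \in node_list (take s es).
  rewrite mem_node_list; have := tree_order_take s.+1 tes.
  by rewrite (take_nth [::]) ?ses// tree_order_rcons => /and3P[].
move=> ee; exists (index e (node_list (take s es))).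
  move: ee; rewrite -index_mem size_node_list size_take ses sk; lia.
have -> : nth [::] (node_list es) (index e (node_list (take s es))) = e.
  rewrite -(@nth_take (2 * s).+1) ?take_node_list ?nth_index//.
  by move: ee; rewrite -index_mem size_node_list size_take ses sk; lia.
by rewrite e1 e2.
Qed.

Lemma finite_words n : finite_set [set e : word | (size e < n)%N].
Proof.
apply: (@sub_finite_set _ _ [set word_of i | i in `I_(2 ^ n)]).
  move=> e en; exists (word_index e); last exact: word_indexK.
  have /andP[_ h] := word_index_size e; rewrite /=.
  apply: (leq_trans h); apply: (leq_trans (leq_pred _)).
  by rewrite leq_exp2l.
by apply: finite_image; exact: finite_II.
Qed.

Lemma finite_tree_order k : finite_set [set es | tree_order es /\ size es = k].
Proof.
elim: k => [|k IH].
  apply: (@sub_finite_set _ _ [set [::]]); last exact: finite_set1.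
  by move=> es [_ /size0nil].
apply: (@sub_finite_set _ _ [set rcons es e | es in
  [set es | tree_order es /\ size es = k] & e in [set e : word | (size e < k.+1)%N]]).
  move=> es []; case/lastP: es => // es e tes; rewrite size_rcons => -[sk].
  exists es; first by move: tes; rewrite tree_order_rcons => /and3P[].
  exists e => //=; have := @tree_order_size _ e tes.
  by rewrite mem_rcons mem_head size_rcons sk; exact.
by apply: finite_image2 => //; exact: finite_words.
Qed.

Lemma finite_Theta k : finite_set (Theta k).
Proof.
have fin : finite_set ((fun r : (2 * k).+1.-tuple word => tval r) @^-1`
    [set node_list es | es in [set es | tree_order es /\ size es = k]]).
  apply: finite_preimage; first by move=> x y _ _; exact: val_inj.
  exact/finite_image/finite_tree_order.
apply: sub_finite_set fin => r /Theta_node_list[rE tes].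
by exists (rstars r k); [rewrite /= size_rstars|rewrite -rE].
Qed.

(** A division replaces a leaf by its two successors; the argument is the reversed list, headed by
    the last division. *)
Fixpoint tree_leaves_rev es : seq word := if es is e :: es' then
  [:: false :: e, true :: e & rem e (tree_leaves_rev es')] else [:: [::]].

Definition tree_leaves es := tree_leaves_rev (rev es).

Lemma tree_leavesP es : tree_order es -> [/\ uniq (tree_leaves es),
  (forall e, (e \in tree_leaves es) = tree_leaf es e) &
  size (tree_leaves es) = (size es).+1].
Proof.
elim/last_ind: es => [_|es e IH]; first by split => // -[|b p].
move=> tes; have [ues les ses] : [/\ uniq (tree_leaves es),
    (forall e, (e \in tree_leaves es) = tree_leaf es e) &
    size (tree_leaves es) = (size es).+1].
  by apply: IH; move: tes; rewrite tree_order_rcons => /and3P[].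
have tes' := tes; move: tes'; rewrite tree_order_rcons => /and3P[ees pe tes'].
have el : e \in tree_leaves es by rewrite les /tree_leaf ees.
have nb b : b :: e \notin es.
  by apply: contra ees; exact: tree_order_closed.
have nl b : b :: e \notin tree_leaves es by rewrite les /tree_leaf /= negb_and ees orbT.
have -> : tree_leaves (rcons es e) =
    [:: false :: e, true :: e & rem e (tree_leaves es)].
  by rewrite /tree_leaves rev_rcons.
split.
- rewrite /= inE eqseq_cons /= rem_uniq// andbT; apply/andP; split;
    by apply: contra (nl _); exact: mem_rem.
- move=> e'; rewrite !inE mem_rem_uniq// inE /= les /tree_leaf.
  rewrite mem_rcons inE; case: e' => [|b p].
    rewrite -[[::] == false :: e]/false -[[::] == true :: e]/false /= !andbT.
    by rewrite negb_or.
  rewrite mem_rcons inE !eqseq_cons; have [->|pe'] := eqVneq p e.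
    have -> : (b :: e == e) = false.
      by apply/eqP => /(congr1 size) /=; lia.
    by rewrite (negbTE (nb b)) (negbTE ees) !andbT /=; case: b.
  by rewrite !andbF /= negb_or andbA.
- by rewrite /= size_rem// ses size_rcons.
Qed.

End ThetaTrees.

(** * Runs of the process *)

(** The process is a set of cells: counting cells is counting words only if different living words
    have different cells. *)
Lemma incomparable_cell_inj (R : realType) l (W : set 'rV[R]_l.+1)
    (h : word -> hyperplane R l) e e' : nondeg W h e ->
  ~~ suffix e e' -> ~~ suffix e' e -> cell W h e <> cell W h e'.
Proof.
move=> [x xe] ee' e'e ce.
have := xe; rewrite ce; move: xe; rewrite !cell_interiorE => -[_ xe] [_ xe'].
exact: margin_disjoint xe xe'.
Qed.

Section Runs.
Context (R : realType).
Implicit Types (rate z : word -> R) (e p : word) (es : seq word).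

Fixpoint tbirth rate z e : R :=
  if e is _ :: p then tbirth rate z p + (rate p)^-1 * z p else 0.

Definition tdeath rate z e : R := tbirth rate z e + (rate e)^-1 * z e.

Definition alive rate z t e := tbirth rate z e <= t < tdeath rate z e.

(* Ties have probability zero; they are broken to get a total order. *)
Definition before rate z e e' : bool :=
  (tdeath rate z e < tdeath rate z e') ||
  ((tdeath rate z e == tdeath rate z e') && (word_index e < word_index e')%N).

(* The cells divided up to time t are those of the words in es, in this order. *)
Definition run rate z t es : bool := [&& sorted (before rate z) es,
  all (fun e => tdeath rate z e <= t) es &
  all (fun e => t < tdeath rate z e) (tree_leaves es)].

Lemma tbirth_cons rate z b p : tbirth rate z (b :: p) = tdeath rate z p.
Proof. by []. Qed.

Lemma before_irr rate z : irreflexive (before rate z).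
Proof. by move=> e; rewrite /before ltxx ltnn andbF. Qed.

Lemma before_trans rate z : transitive (before rate z).
Proof.
move=> e2 e1 e3 /orP[h12|/andP[/eqP h12 i12]] /orP[h23|/andP[/eqP h23 i23]];
  apply/orP.
- by left; exact: lt_trans h23.
- by left; rewrite -h23.
- by left; rewrite h12.
- by right; rewrite h12 h23 eqxx (ltn_trans i12).
Qed.

Lemma before_total rate z e e' : e != e' -> before rate z e e' || before rate z e' e.
Proof.
move=> ne; rewrite /before; have [//|//|_] /= := ltgtP (tdeath rate z e) (tdeath rate z e').
by rewrite -neq_ltn (inj_eq word_index_inj).
Qed.

Lemma before_le rate z e e' : before rate z e e' -> tdeath rate z e <= tdeath rate z e'.
Proof. by case/orP => [/ltW//|/andP[/eqP ->]]. Qed.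

Lemma sort_before rate z es : uniq es -> exists2 es', perm_eq es' es &
  sorted (before rate z) es'.
Proof.
move=> ues; pose leT e e' := (e == e') || before rate z e e'.
have leT_total : total leT.
  move=> e e'; rewrite /leT eq_sym; have [//|ne] := eqVneq e e'; exact: before_total.
exists (sort leT es); first by rewrite perm_sort.
have := sort_sorted leT_total es; have : uniq (sort leT es) by rewrite sort_uniq.
case: (sort leT es) => //= x s; elim: s x => //= y s IH x /andP[].
rewrite inE negb_or => /andP[xy xs] ys /andP[/orP[/eqP xy'|-> /(IH _ ys)//]].
by rewrite xy' eqxx in xy.
Qed.

Context (rate z : word -> R).
Hypothesis rate_gt0 : forall e, 0 < rate e.
Hypothesis z_gt0 : forall e, 0 < z e.

Lemma tlife_gt0 e : 0 < (rate e)^-1 * z e.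
Proof. by rewrite mulr_gt0// invr_gt0. Qed.

Lemma tdeath_cons b p : tdeath rate z p < tdeath rate z (b :: p).
Proof. by rewrite /tdeath /= ltrDl tlife_gt0. Qed.

Lemma tdeath_suffix p e : suffix p e -> tdeath rate z p <= tdeath rate z e.
Proof.
move=> /suffixP[s ->]; elim: s => //= b s IH.
exact: le_trans (ltW (tdeath_cons _ _)).
Qed.

Lemma tdeath_psuffix p e : psuffix p e -> tdeath rate z p <= tbirth rate z e.
Proof.
case: e => [|b q]; first by move=> /andP[]; rewrite suffixs0 => ->.
by move=> /psuffix_parent; exact: tdeath_suffix.
Qed.

Lemma alive_incomparable t e e' : alive rate z t e -> alive rate z t e' ->
  e != e' -> ~~ suffix e e'.
Proof.
move=> /andP[_ te] /andP[te' _] ne; apply/negP => ee'.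
have /tdeath_psuffix : psuffix e e' by rewrite /psuffix ee'.
by lra.
Qed.

(** A word dies before its successors do, so that an order by death times puts predecessors
    first. *)
Lemma sorted_tree_order es : sorted (before rate z) es -> prefix_closed es ->
  tree_order es.
Proof.
elim/last_ind: es => // es e IH; rewrite -cats1 => ses pc.
have bes p : p \in es -> before rate z p e.
  move: ses; rewrite cats1 => + pes; rewrite -[rcons es e]revK rev_rcons.
  rewrite rev_sorted /= => /(order_path_min _) => /(_ _)/allP; apply.
    by move=> a b c ab bc; exact: before_trans ab.
  by rewrite mem_rev.
have ses' : sorted (before rate z) es.
  by have [] := cat_sorted2 ses.
rewrite cats1 tree_order_rcons; apply/and3P; split.
- by apply/negP => /bes; rewrite before_irr.
- case: e pc {ses bes} => // b p /(_ b p).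
  rewrite !mem_cat !inE eqxx orbT => /(_ isT)/orP[//|/eqP /(congr1 size)] /=; lia.
- apply: IH => // b p bp; have := pc b p; rewrite !mem_cat bp => /(_ isT).
  case/orP => //; rewrite inE => /eqP pe.
  by have /before_le := bes _ bp; have := tdeath_cons b p; rewrite pe; lra.
Qed.

Section Run.
Variables (t : R) (es : seq word).
Hypotheses (t0 : 0 <= t) (tes : tree_order es) (res : run rate z t es).

Lemma run_leaf e : tree_leaf es e -> t < tdeath rate z e.
Proof.
have /and3P[_ _ /allP h] := res; have [_ les _] := tree_leavesP tes.
by rewrite -les => /h.
Qed.

Lemma run_mem e : (e \in es) = (tdeath rate z e <= t).
Proof.
have /and3P[_ /allP h _] := res; apply/idP/idP; first exact: h.
elim: e => [|b p IH] et.
  by apply: contraLR et => nes; rewrite -ltNge run_leaf// /tree_leaf nes.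
have pes : p \in es by apply: IH; have := tdeath_cons b p; lra.
by apply: contraLR et => nes; rewrite -ltNge run_leaf// /tree_leaf nes.
Qed.

Lemma run_alive e : alive rate z t e = tree_leaf es e.
Proof.
rewrite /alive /tree_leaf run_mem -ltNge andbC; congr (_ && _).
by case: e => [|b p] /=; [rewrite t0|rewrite run_mem].
Qed.

End Run.

Lemma run_uniq t es es' : 0 <= t -> tree_order es -> tree_order es' ->
  run rate z t es -> run rate z t es' -> es = es'.
Proof.
move=> t0 tes tes' res res'.
apply: (irr_sorted_eq (@before_trans rate z) (@before_irr rate z)).
- by case/and3P: res.
- by case/and3P: res'.
- by move=> e; rewrite (run_mem tes res) (run_mem tes' res').
Qed.

Section Tessellations.
Context (l : nat) (W : set 'rV[R]_l.+1) (h : word -> hyperplane R l).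
Hypothesis W_polytope : polytope W.
Hypothesis h_nondeg : forall e, nondeg W h e.

Definition alive_cells t := [set cell W h e | e in [set e | alive rate z t e]].

Lemma card_tree_tess es : tree_order es -> (tree_tess W h es #= `I_(size es).+1)%card.
Proof.
move=> tes; have [us les ss] := tree_leavesP tes.
have -> : tree_tess W h es =
    [set cell W h (nth [::] (tree_leaves es) i) | i in `I_(size es).+1].
  apply/seteqP; split => [_ [e /= el <-]|_ [i /= ik <-]].
    rewrite -les in el; exists (index e (tree_leaves es)); last by rewrite nth_index.
    by rewrite /= -ss index_mem.
  by exists (nth [::] (tree_leaves es) i); rewrite //= -les mem_nth// ss.
apply: inj_card_eq => i j /set_mem /= ik /set_mem /= jk ce.
have il : nth [::] (tree_leaves es) i \in tree_leaves es by rewrite mem_nth// ss.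
have jl : nth [::] (tree_leaves es) j \in tree_leaves es by rewrite mem_nth// ss.
rewrite !les in il jl; apply/eqP; rewrite -(nth_uniq [::] _ _ us) ?ss//.
apply: contrapT => /negP ne; have pc := tree_order_closed tes.
by apply: incomparable_cell_inj ce => //; apply: (tree_leaf_incomparable pc) => //;
  rewrite eq_sym.
Qed.

(** A living word whose cell meets the interior of the cell of [e] is comparable with [e], and no
    strict ancestor of [e] is alive once [e] is born. *)
Lemma alive_below t e : 0 <= t -> tessellation W (alive_cells t) ->
  finite_set (alive_cells t) -> tbirth rate z e <= t ->
  exists2 e', alive rate z t e' & suffix e e'.
Proof.
move=> t0 [_ _ _ WE] _ et; apply: contrapT => ne.
have [x xe] := h_nondeg e.
have : W x by apply: (@cell_sub _ _ W h e); exact: interior_subset.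
rewrite -WE => -[_ [e' ae' <-] xe'].
have ee' : ~~ suffix e e' by apply/negP => ee'; apply: ne; exists e'.
have e'e : ~~ suffix e' e.
  apply/negP => e'e; have [ee|ee] := eqVneq e' e.
    by move: ee'; rewrite ee suffix_refl.
  have /tdeath_psuffix : psuffix e' e by rewrite /psuffix e'e.
  by move: ae' => /= /andP[_]; lra.
have [y [ye ye']] := cvx_interior_meets (cvx_cell (h := h) (e := e')
  (polytope_cvx W_polytope)) (h_nondeg e') xe' (nbhs_interior xe).
move: ye ye'; rewrite !cell_interiorE => -[_ ye] [_ ye'].
exact: margin_disjoint ye ye'.
Qed.

Lemma alive_cells_run t es : 0 <= t -> tree_order es -> run rate z t es ->
  alive_cells t = tree_tess W h es.
Proof.
move=> t0 tes res; congr (image _ _); apply/seteqP; split => e /=;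
  by rewrite (run_alive t0 tes res).
Qed.

(* Explosion is excluded: a word born before t has a descendant alive at t,
   as otherwise the interior of its cell would not be covered. *)
Lemma tessellation_run t : 0 <= t -> tessellation W (alive_cells t) ->
  exists2 es, tree_order es & run rate z t es.
Proof.
move=> t0 tY; have fY : finite_set (alive_cells t) by case: tY.
have fL : finite_set [set e | alive rate z t e].
  rewrite -(@eq_finite_set _ _ (alive_cells t))//; apply: inj_card_eq.
  move=> e e' /set_mem /= ae /set_mem /= ae' ce; apply: contrapT => /eqP ne.
  by apply: incomparable_cell_inj ce => //; apply: (alive_incomparable (t := t));
    rewrite // eq_sym.
have [s sE] := (finite_seqP _).1 fL.
(* Each of these words is an ancestor of one of the finitely many words alive at [t]; [drop i] runs
   through the ancestors. *)
have : finite_set [set e | tdeath rate z e <= t].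
  apply: (@sub_finite_set _ _
    [set` flatten [seq [seq drop i e | i <- iota 0 (size e).+1] | e <- s]]);
    last exact: finite_seq.
  move=> e /= et; have [|e' ae' ee'] := alive_below (e := e) t0 tY fY.
    by have := tlife_gt0 e; move: et; rewrite /tdeath; lra.
  apply/flattenP; exists [seq drop i e' | i <- iota 0 (size e').+1].
    by apply: map_f; have : [set` s] e' by rewrite -sE.
  apply/mapP; exists (size e' - size e)%N; first by rewrite mem_iota; lia.
  by apply/esym/eqP; rewrite -suffixE.
move=> /finite_seqP[I IE].
have [es pes ses] := sort_before rate z (undup_uniq I).
have mes e : (e \in es) = (tdeath rate z e <= t).
  rewrite (perm_mem pes) mem_undup; apply/idP/idP => [eI|et].
    by have : [set` I] e by []; rewrite -IE.
  by have : [set e | tdeath rate z e <= t] e by []; rewrite IE.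
have pc : prefix_closed es.
  by move=> b p; rewrite !mes; apply: le_trans; apply: ltW; exact: tdeath_cons.
have tes := sorted_tree_order ses pc.
exists es => //; apply/and3P; split => //.
  by apply/allP => e; rewrite mes.
have [_ les _] := tree_leavesP tes.
by apply/allP => e; rewrite les => /andP[]; rewrite mes -ltNge.
Qed.

Lemma card_alive_cells t k (A : set (set (set 'rV[R]_l.+1))) : 0 <= t ->
  A `<=` tessellation W ->
  ((alive_cells t #= `I_k.+1)%card /\ A (alive_cells t)) <->
  exists es, [/\ tree_order es, size es = k, run rate z t es & A (tree_tess W h es)].
Proof.
move=> t0 AW; split=> [[ck AY]|[es [tes <- res Aes]]]; last first.
  by rewrite (alive_cells_run t0 tes res); split => //; exact: card_tree_tess.
have [es tes res] := tessellation_run t0 (AW _ AY).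
rewrite (alive_cells_run t0 tes res) in ck AY; exists es; split => //.
have ce := card_tree_tess tes.
apply/eqP; rewrite -eqSS; apply/eqP/card_eq_II.
by apply: card_eq_trans ck; rewrite card_eq_sym.
Qed.

End Tessellations.
End Runs.

(** * Exponential lifetimes *)

Section ExponentialIntegrals.
Context (R : realType).
Local Notation leb := (@lebesgue_measure R).

(** Lebesgue measure is determined by its values on half-open intervals. *)
Lemma lebesgue_measure_affine (a c : R) (A : set R) : 0 < a -> measurable A ->
  leb A = (a%:E * leb ((fun w : R => (a * (w + c))%R) @^-1` A))%E.
Proof.
move=> a0 mA; pose phi : measurableTypeR R -> measurableTypeR R := fun w => a * (w + c).
have mphi : @measurable_fun _ _ (measurableTypeR R) (measurableTypeR R) setT phi.
  by apply: measurable_funM => //; exact: measurable_funD.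
pose r : {nonneg R} := NngNum (ltW a0).
pose m : {measure set (measurableTypeR R) -> \bar R} :=
  mscale r (pushforward leb phi).
rewrite (lebesgue_measure_unique (mu := m mphi)) => // _ [[x y]] _ <-.
rewrite /= /mscale /= /pushforward.
have -> : phi @^-1` `]x, y] = `]x / a - c, y / a - c]%classic.
  by apply/seteqP; split => w /=; rewrite !in_itv /= /phi => /andP[h1 h2];
    apply/andP; split; move: h1 h2; rewrite ?ltrBlDr ?lerBrDr ?ltr_pdivrMr ?ler_pdivlMr // 1?mulrC.
rewrite !lebesgue_measure_itv /= !lte_fin ltrD2r ltr_pM2r ?invr_gt0//.
case: ifPn => _; last by rewrite mule0.
rewrite -!EFinD -EFinM; congr EFin; field; exact: lt0r_neq0.
Qed.

Lemma ge0_integral_affine (a c : R) (f : R -> \bar R) : 0 < a ->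
  measurable_fun setT f -> (forall x, 0 <= f x)%E ->
  (\int[leb]_x f x = a%:E * \int[leb]_w f (a * (w + c))%R)%E.
Proof.
move=> a0 mf f0; pose phi : measurableTypeR R -> measurableTypeR R := fun w => a * (w + c).
have mphi : @measurable_fun _ _ (measurableTypeR R) (measurableTypeR R) setT phi.
  by apply: measurable_funM => //; exact: measurable_funD.
pose r : {nonneg R} := NngNum (ltW a0).
pose m : {measure set (measurableTypeR R) -> \bar R} :=
  mscale r (pushforward leb phi).
transitivity (\int[m mphi]_x f x)%E.
  by apply: eq_measure_integral => A mA _; exact: lebesgue_measure_affine.
rewrite ge0_integral_mscale//; congr (_ * _)%E.
by rewrite ge0_integral_pushforward.
Qed.

Section Density.
Context (m : probability R R) (g : R -> R).
Hypothesis mg : measurable_fun setT g.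
Hypothesis g0 : forall x, 0 <= g x.
Hypothesis mE : forall B, measurable B -> (m B = \int[leb]_(x in B) (g x)%:E)%E.

Import HBNNSimple.

(** The hypothesis settles indicators, linearity simple functions, and monotone convergence the
    rest. *)
Lemma ge0_integral_density (f : R -> \bar R) : measurable_fun setT f ->
  (forall x, 0 <= f x)%E -> (\int[m]_x f x = \int[leb]_x (f x * (g x)%:E))%E.
Proof.
move=> mf f0; pose f_ := nnsfun_approx measurableT mf.
have mgE : measurable_fun setT (EFin \o g) by apply/measurable_EFinP.
have fE x : f x = limn (fun n => (f_ n x)%:E).
  by apply/esym/cvg_lim => //; apply: cvg_nnsfun_approx.
transitivity (limn (fun n => \int[m]_x (f_ n x)%:E))%E.
  rewrite -monotone_convergence//.
  - by apply: eq_integral => x _; exact: fE.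
  - by move=> n; exact/measurable_EFinP.
  - by move=> *; rewrite lee_fin.
  - by move=> x _ i j ij; rewrite lee_fin; exact/lefP/nd_nnsfun_approx.
transitivity (limn (fun n => \int[leb]_x ((f_ n x)%:E * (g x)%:E)))%E; last first.
  rewrite -monotone_convergence//.
  - apply: eq_integral => x _; apply/cvg_lim => //; apply: cvgeZr => //.
    exact: cvg_nnsfun_approx.
  - by move=> n; apply: (@emeasurable_funM _ R R setT (fun x => (f_ n x)%:E)
      (fun x => (g x)%:E)) => //; exact/measurable_EFinP.
  - by move=> n x _; rewrite -EFinM lee_fin mulr_ge0.
  - move=> x _ i j ij; apply: lee_wpmul2r; rewrite lee_fin//.
    by have /lefP := nd_nnsfun_approx measurableT mf ij; exact.
congr (limn _); apply/funext => n.
transitivity (\int[m]_x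
    \sum_(y \in range (f_ n)) (y * \1_(f_ n @^-1` [set y]) x)%:E)%E.
  by apply: eq_integral => x _; rewrite fsumEFin// -fimfunE.
rewrite ge0_integral_fsum//; last 2 first.
- by move=> r; exact/measurable_EFinP/measurable_funM.
- by move=> r x _; rewrite EFinM; exact: nnfun_muleindic_ge0.
transitivity (\int[leb]_x \sum_(y \in range (f_ n))
    (y * \1_(f_ n @^-1` [set y]) x)%:E * (g x)%:E)%E; last first.
  apply: eq_integral => x _; rewrite -ge0_mule_fsuml => [|y].
    by rewrite fsumEFin// -fimfunE.
  by rewrite EFinM; exact: nnfun_muleindic_ge0.
rewrite ge0_integral_fsum//; last 2 first.
- move=> r; apply: (@emeasurable_funM _ R R setT
      (fun x => (r * \1_(f_ n @^-1` [set r]) x)%:E)) => //.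
  exact/measurable_EFinP/measurable_funM.
- by move=> r x _; rewrite EFinM mule_ge0 ?lee_fin//; exact: nnfun_muleindic_ge0.
apply: eq_fsbigr => r /set_mem[y _ fr].
have r0 : 0 <= r by rewrite -fr.
have mr : measurable (f_ n @^-1` [set r]) by exact: measurable_funPTI.
transitivity (r%:E * m (f_ n @^-1` [set r]))%E.
  under eq_integral do rewrite EFinM.
  rewrite ge0_integralZl//; last exact/measurable_EFinP.
  by rewrite integral_indic// setIT.
transitivity (r%:E * \int[leb]_(x in f_ n @^-1` [set r]) (g x)%:E)%E.
  by congr (_ * _)%E; exact: mE.
transitivity (\int[leb]_(x in f_ n @^-1` [set r]) (r%:E * (g x)%:E))%E.
  apply/esym/ge0_integralZl => //; first exact/measurable_funTS.
  by move=> x _; rewrite lee_fin.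
rewrite [LHS]integral_mkcond; apply: eq_integral => x _.
rewrite patchE indicE; case: ifP => _; first by rewrite mulr1.
by rewrite mulr0 mul0e.
Qed.
End Density.

Definition exp_law (m : probability R R) :=
  forall B, measurable B -> m B = exponential_prob 1 B.

Lemma integral_exp_law (m : probability R R) (f : R -> \bar R) : exp_law m ->
  measurable_fun setT f -> (forall x, 0 <= f x)%E ->
  (\int[m]_x f x = \int[leb]_x (f x * (exponential_pdf 1 x)%:E))%E.
Proof.
move=> mE mf f0; apply: ge0_integral_density => //.
- exact: measurable_exponential_pdf.
- by move=> x; exact: exponential_pdf_ge0.
Qed.

(* Substitution: x is the time spent alive, rescaled by the rate a, by a word
   born at time - c that dies at time w. *)
Lemma integral_exp_affine (m : probability R R) (a c : R) (f : R -> \bar R) :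
  exp_law m -> 0 < a -> measurable_fun setT f -> (forall x, 0 <= f x)%E ->
  (\int[m]_x f x = \int[leb]_w
    (f (a * (w + c))%R * (a * exponential_pdf 1 (a * (w + c)))%:E))%E.
Proof.
move=> me a0 mf f0; rewrite (integral_exp_law me)//.
have pdf0 x : 0 <= exponential_pdf (1 : R) x by exact: exponential_pdf_ge0.
have mp : measurable_fun setT (fun x => (exponential_pdf (1 : R) x)%:E).
  by apply/measurable_EFinP; exact: measurable_exponential_pdf.
have mphi : measurable_fun setT (fun w : R => a * (w + c)).
  by apply: measurable_funM => //; exact: measurable_funD.
rewrite (ge0_integral_affine c a0); last 2 first.
- exact: emeasurable_funM.
- by move=> x; rewrite mule_ge0 ?lee_fin.
rewrite -ge0_integralZl//.
- by apply: eq_integral => w _; rewrite EFinM muleCA.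
- by apply: emeasurable_funM; [exact: (measurableT_comp mf)|exact: (measurableT_comp mp)].
- by move=> x _; rewrite mule_ge0 ?lee_fin.
- by rewrite lee_fin ltW.
Qed.

Lemma exponential_prob_restrict (A B : set R) :
  A `&` `[0, +oo[%classic = B `&` `[0, +oo[%classic ->
  exponential_prob 1 A = exponential_prob 1 B.
Proof.
have E C : exponential_prob 1 C =
    (\int[leb]_(x in C `&` `[0%R, +oo[) (expR (- x))%:E)%E.
  rewrite /exponential_prob integral_mkcondr; apply: eq_integral => x _.
  rewrite /exponential_pdf !patchE; case: ifPn => // _.
  by rewrite mulN1r mul1r.
by move=> AB; rewrite !E AB.
Qed.

Lemma exp_law_le0 (m : probability R R) : exp_law m -> m [set x | x <= 0] = 0%E.
Proof.
move=> me; have m0 : measurable [set x : R | x <= 0] by rewrite -set_itvNyc.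
rewrite me// (@exponential_prob_restrict _ [set 0]).
  exact: (@integral_Sset1 _ _ _ 0).
apply/seteqP; split => x /=; rewrite in_itv/= andbT => -[x0 x0'].
  by split => //; apply/eqP; rewrite eq_le x0.
by rewrite x0.
Qed.

Lemma exp_law_gt (m : probability R R) (x : R) : exp_law m -> 0 <= x ->
  m [set y | x < y] = (expR (- x))%:E.
Proof.
move=> me x0; have -> : [set y | x < y] = ~` [set y | y <= x].
  apply/seteqP; split => y /=; first by move=> xy; apply/negP; rewrite -ltNge.
  by move=> /negP; rewrite -ltNge.
have mx : measurable [set y : R | y <= x] by rewrite -set_itvNyc.
transitivity (1 - m [set y | (y <= x)%R])%E; first exact: probability_setC.
have [x0'|x0'] := eqVneq x 0.
  rewrite x0' oppr0 expR0; have -> := exp_law_le0 me; by rewrite sube0.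
rewrite me// (@exponential_prob_restrict _ `[0, x]%classic).
  rewrite exponential_prob_itv0c ?lt0r ?x0' //.
  rewrite -[1%E]/(1%:E) -!EFinB; congr EFin; rewrite mulN1r; ring.
by apply/seteqP; split => y /=; rewrite !in_itv/= !andbT; [move=> [-> ->]|move=> [/andP[_ ->] ->]].
Qed.

End ExponentialIntegrals.

(** * From lifetimes to durations between divisions *)

Section TimeIntegrals.
Context (R : realType).
Local Notation leb := (@lebesgue_measure R).
Implicit Types (z : word -> R) (e p : word) (es L : seq word) (ws : seq R).

Lemma int_times_eq (t : R) n ws (F F' : seq R -> \bar R) :
  (forall ws', size ws' = (size ws + n)%N -> F ws' = F' ws') ->
  int_times t n ws F = int_times t n ws F'.
Proof.
elim: n ws => [|n IH] ws FF' /=; first by apply: FF'; rewrite addn0.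
apply: eq_integral => w _; apply: IH => ws' sws'; apply: FF'.
by rewrite sws' size_rcons addnS.
Qed.

Lemma int_times0 (t : R) n ws : int_times t n ws (fun=> 0%E) = 0%E.
Proof.
elim: n ws => //= n IH ws; apply: integral0_eq => w _; exact: IH.
Qed.

Lemma int_times_ge0 (t : R) n ws F : (forall ws, 0 <= F ws)%E ->
  (0 <= int_times t n ws F)%E.
Proof.
move=> F0; elim: n ws => //= n IH ws; apply: integral_ge0 => w _; exact: IH.
Qed.

Lemma tbirth_eq (rate z z' : word -> R) e :
  (forall p, psuffix p e -> z p = z' p) -> tbirth rate z e = tbirth rate z' e.
Proof.
elim: e => //= b p IH zz'; have pp : psuffix p (b :: p).
  by apply: (@psuffix_cons b); exact: suffix_refl.
rewrite zz'// IH// => q /andP[qp _]; apply: zz'.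
rewrite /psuffix (suffix_trans qp (suffix_cons _ _))/=; apply/eqP => qbp.
by move: (size_suffix qp); rewrite qbp /= ltnn.
Qed.

Lemma tdeath_eq (rate z z' : word -> R) e :
  (forall p, suffix p e -> z p = z' p) -> tdeath rate z e = tdeath rate z' e.
Proof.
move=> zz'; rewrite /tdeath zz' ?suffix_refl//; congr (_ + _).
by apply: tbirth_eq => p /andP[/zz'].
Qed.

Variables (m : probability R R) (m_exp : exp_law m).

Definition zint e (F : (word -> R) -> \bar R) z : \bar R :=
  (\int[m]_y F (upd z e y))%E.

Lemma zint_ge0 e F z : (forall z, 0 <= F z)%E -> (0 <= zint e F z)%E.
Proof. by move=> F0; exact: integral_ge0. Qed.

Lemma cmeas_zint e F : cmeas F -> (forall z, 0 <= F z)%E -> cmeas (zint e F).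
Proof.
move=> mF F0 d T z mz.
pose f (q : T * R) := F (upd (z q.1) e q.2).
have mf : measurable_fun setT f.
  apply: (mF _ _ (fun q : T * R => upd (z q.1) e q.2)) => e'.
  apply: (measurable_upd (h := fun q : T * R => z q.1)) => // p.
  exact: (measurableT_comp (mz p)).
by have := measurable_fun_fubini_tonelli_F (m2 := m) f mf (fun q => F0 _).
Qed.

Lemma foldr_zint_ge0 L F z : (forall z, 0 <= F z)%E -> (0 <= foldr zint F L z)%E.
Proof. by move=> F0; elim: L z => //= e L IH z; exact: zint_ge0. Qed.

Lemma cmeas_foldr_zint L F : cmeas F -> (forall z, 0 <= F z)%E ->
  cmeas (foldr zint F L).
Proof.
move=> mF F0; elim: L => //= e L IH; apply: cmeas_zint => // z.
exact: foldr_zint_ge0.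
Qed.

Lemma foldr_zint_eq L F F' z :
  (forall z', (forall e, e \notin L -> z' e = z e) -> F z' = F' z') ->
  foldr zint F L z = foldr zint F' L z.
Proof.
elim: L z => [|e L IH] z FF' /=; first exact: FF'.
apply: eq_integral => y _; apply: IH => z' zz'; apply: FF' => e'.
rewrite inE negb_or => /andP[ne nL]; by rewrite zz'// /upd (negbTE ne).
Qed.

Lemma foldr_zint0 L z : foldr zint (fun=> 0%E) L z = 0%E.
Proof. by elim: L z => //= e L IH z; apply: integral0_eq => y _; exact: IH. Qed.

(** Each leaf contributes the exponential tail beyond its rescaled remaining time; [c] collects the
    indicators of the leaves whose variables are already fixed. *)
Lemma foldr_zint_leaves (rate B : word -> R) (t c : R) L z : uniq L -> 0 <= c ->
  (forall e, e \in L -> 0 < rate e /\ B e <= t) ->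
  foldr zint (fun z => (c * (all (fun e => t < B e + (rate e)^-1 * z e) L)%:R)%:E) L z
  = (c * \prod_(e <- L) expR (- (rate e * (t - B e))))%:E.
Proof.
move=> + + h; elim: L c z h => [|e L IH] c z h /= uL c0; first by rewrite big_nil.
have [re Be] := h e (mem_head _ _); have /andP[eL {}uL] := uL.
rewrite big_cons; set pr := \prod_(_ <- L) _.
transitivity (\int[m]_y ((c * pr)%:E * (\1_[set y | rate e * (t - B e) < y] y)%:E))%E.
  apply: eq_integral => y _; rewrite (foldr_zint_eq (F' := fun z' =>
      (c * \1_[set y | rate e * (t - B e) < y] y *
       (all (fun e => t < B e + (rate e)^-1 * z' e) L)%:R)%:E)); last first.
    move=> z' zz'; rewrite zz'// /upd eqxx indicE -mulrA; congr (_ * _)%:E.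
    rewrite -natrM mulnb; congr ((_ && _)%:R); rewrite -ltrBlDl mulrC ltr_pdivlMr//.
    by rewrite mulrC; apply/idP/idP => [?|/set_mem//]; exact/mem_set.
  rewrite IH//; last 2 first.
  - by move=> e' e'L; apply: h; rewrite inE e'L orbT.
  - by rewrite mulr_ge0.
  by rewrite -EFinM mulrAC.
have pr0 : 0 <= pr by apply: prodr_ge0 => i _; exact: expR_ge0.
have ml : measurable [set y : R | rate e * (t - B e) < y] by rewrite -set_itvoy.
rewrite ge0_integralZl//; last 2 first.
- by apply/measurable_EFinP.
- by rewrite lee_fin mulr_ge0.
rewrite integral_indic// setIT.
transitivity ((c * pr)%:E * (expR (- (rate e * (t - B e))))%:E)%E.
  by congr (_ * _)%E; apply: exp_law_gt => //; rewrite mulr_ge0 ?subr_ge0// ltW.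
by rewrite -EFinM -mulrA; congr (_ * _)%:E; rewrite mulrC.
Qed.


Section Run.
Variables (rate : word -> R) (t a : R) (es : seq word).
Hypothesis t0 : 0 <= t.
Hypothesis a0 : 0 <= a.
Hypothesis tes : tree_order es.
Hypothesis rate_inner : forall e, e \in es -> 0 < rate e.
Hypothesis rate_leaf : forall e, tree_leaf es e -> 0 < rate e.
Local Notation k := (size es).
Local Notation L := (tree_leaves es).
Local Notation w_ e := (nth [::] es e).

(* The entries of ws are the durations between successive divisions: elapsed ws i
   is the time of division number i and bw ws e the time at which e is born. *)
Definition elapsed ws i : R := \sum_(n < i) ws`_n.

Definition bw ws e : R := if e is _ :: p then elapsed ws (index p es).+1 else 0.

(** The density, in the duration of index [i], of the death of the corresponding word at this
    division, given its birth. *)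
Definition weight ws i : R :=
  rate (w_ i) * expR (- (rate (w_ i) * (elapsed ws i.+1 - bw ws (w_ i)))).

Definition tail_weight ws : R :=
  \prod_(e <- L) expR (- (rate e * (t - bw ws e))).

Definition matches ws z := forall i, (i < size ws)%N ->
  tdeath rate z (w_ i) = elapsed ws i.+1.

Lemma elapsed_recr ws i : elapsed ws i.+1 = elapsed ws i + ws`_i.
Proof. by rewrite /elapsed big_ord_recr. Qed.

Lemma elapsed_size ws : elapsed ws (size ws) = \sum_(v <- ws) v.
Proof. by rewrite /elapsed (big_nth 0) big_mkord. Qed.

Lemma elapsed_rcons ws w i : (i <= size ws)%N -> elapsed (rcons ws w) i = elapsed ws i.
Proof.
move=> iw; apply: eq_bigr => n _; rewrite nth_rcons.
by rewrite (leq_trans (ltn_ord n) iw).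
Qed.

Lemma elapsed_le ws i j : (forall w, w \in ws -> 0 <= w) -> (i <= j)%N ->
  elapsed ws i <= elapsed ws j.
Proof.
move=> ws0; elim: j => [|j IH]; first by rewrite leqn0 => /eqP ->.
rewrite leq_eqVlt => /predU1P[->//|/IH ij]; rewrite elapsed_recr.
apply: le_trans ij _; rewrite lerDl; have [jw|jw] := ltnP j (size ws).
  by rewrite ws0// mem_nth.
by rewrite nth_default.
Qed.

Lemma elapsed_ge0 ws i : (forall w, w \in ws -> 0 <= w) -> 0 <= elapsed ws i.
Proof. by move=> /elapsed_le /(_ (leq0n i)); rewrite {1}/elapsed big_ord0. Qed.

Lemma tree_order_parent j b p : (j < k)%N -> w_ j = b :: p ->
  (index p es < j)%N /\ p \in es.
Proof.
move=> jk wj.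
have : tree_order (rcons (take j es) (w_ j)).
  by rewrite -take_nth//; exact: tree_order_take.
rewrite tree_order_rcons wj => /and3P[_ pj _]; split; last exact: mem_take pj.
exact: index_ltn.
Qed.

Lemma leaf_parent b p : b :: p \in L -> p \in es.
Proof. by have [_ -> _] := tree_leavesP tes; rewrite /tree_leaf => /andP[]. Qed.

Lemma bw_le ws e : (forall w, w \in ws -> 0 <= w) -> size ws = k -> e \in L ->
  bw ws e <= \sum_(v <- ws) v.
Proof.
move=> ws0 sw; case: e => [|b p] eL /=; rewrite -elapsed_size; first exact: elapsed_ge0.
by apply: elapsed_le => //; rewrite sw index_mem; exact: leaf_parent eL.
Qed.

Lemma bw_birth ws z e : matches ws z ->
  (if e is _ :: p then (index p es < size ws)%N && (p \in es) else true) ->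
  tbirth rate z e = bw ws e.
Proof.
case: e => // b p mz /andP[pw pes].
by rewrite tbirth_cons; have := mz _ pw; rewrite nth_index.
Qed.

(** Once [ws] prescribes the inner death times, their order and the bound [t] are automatic; only
    the survival of the leaves remains random. *)
Lemma zint_leaves ws z : size ws = k -> (forall w, w \in ws -> 0 < w) ->
  \sum_(v <- ws) v <= t -> matches ws z ->
  foldr zint (fun z => (a * (run rate z t es)%:R)%:E) L z = (a * tail_weight ws)%:E.
Proof.
move=> sw ws0 wt mz; have [uL LE _] := tree_leavesP tes.
have ws0' w : w \in ws -> 0 <= w by move=> /ws0/ltW.
rewrite /tail_weight -(foldr_zint_leaves (t := t) z uL a0); last first.
  move=> e eL; split; first by apply: rate_leaf; rewrite -LE.
  by apply: le_trans wt; exact: bw_le.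
apply: foldr_zint_eq => z' zz'.
have pc := tree_order_closed tes.
have zes e : e \in es -> tdeath rate z' e = tdeath rate z e.
  move=> ees; apply: tdeath_eq => p pe; apply: zz'; rewrite LE /tree_leaf.
  by rewrite (prefix_closed_suffix pc pe ees).
have zi i : (i < k)%N -> tdeath rate z' (w_ i) = elapsed ws i.+1.
  by move=> ik; rewrite zes ?mem_nth// mz// sw.
have ses : sorted (before rate z') es.
  apply/(sortedP [::]) => i ik; rewrite /before !zi//; last exact: ltnW.
  by rewrite [X in _ < X]elapsed_recr ltrDl ws0// mem_nth// sw.
have tl : all (fun e => tdeath rate z' e <= t) es.
  apply/(all_nthP [::]) => i ik; rewrite zi//; apply: le_trans wt.
  by rewrite -elapsed_size; apply: elapsed_le => //; rewrite sw.
rewrite /run ses tl /=; congr (_ * (nat_of_bool _)%:R)%:E.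
apply: eq_in_all => e eL; congr (_ < _ + _).
have e_es :
    (if e is _ :: p then (index p es < size ws)%N && (p \in es) else true) = true.
  by case: e eL => // b p /leaf_parent pes; rewrite sw index_mem pes.
rewrite -(bw_birth mz e_es); apply: tbirth_eq => p pe; apply: zz'.
by rewrite LE /tree_leaf (tree_order_psuffix tes _ pe)//;
  case: e eL {e_es pe} => // b q /leaf_parent.
Qed.

Local Notation F := (fun z => (a * (run rate z t es)%:R)%:E).

Hypothesis F_meas : cmeas F.

Lemma run_F_ge0 z : (0 <= F z)%E.
Proof. by rewrite lee_fin mulr_ge0. Qed.

Lemma weight_ge0 ws i : (i < k)%N -> 0 <= weight ws i.
Proof.
by move=> ik; rewrite mulr_ge0 ?expR_ge0// ltW// rate_inner// mem_nth.
Qed.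

Lemma bw_rcons ws w i : (i <= size ws)%N -> (i < k)%N ->
  bw (rcons ws w) (w_ i) = bw ws (w_ i).
Proof.
move=> iw ik; rewrite /bw; case wi : (w_ i) => [//|b p].
have [pi _] := tree_order_parent ik wi.
by rewrite elapsed_rcons// (leq_trans pi iw).
Qed.

Lemma weight_rcons ws w i : (i < size ws)%N -> (i < k)%N ->
  weight (rcons ws w) i = weight ws i.
Proof. by move=> iw ik; rewrite /weight elapsed_rcons// bw_rcons// ltnW. Qed.

Lemma inner_suffix i p : (i < k)%N -> suffix p (w_ i) -> (index p es <= i)%N /\ p \in es.
Proof.
move=> ik pi; have pc := tree_order_closed (tree_order_take i.+1 tes).
have : p \in take i.+1 es.
  apply: prefix_closed_suffix pi _ => //.
  by rewrite (take_nth [::])// mem_rcons mem_head.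
by move=> pt; split; [rewrite -ltnS; exact: index_ltn|exact: mem_take pt].
Qed.

Lemma tdeath_upd i j z y : (i < j)%N -> (j < k)%N ->
  tdeath rate (upd z (w_ j) y) (w_ i) = tdeath rate z (w_ i).
Proof.
move=> ij jk; apply: tdeath_eq => p pi; rewrite /upd; case: eqP => // pj.
have [] := inner_suffix (ltn_trans ij jk) pi.
by rewrite pj index_uniq ?tree_order_uniq//; lia.
Qed.

Lemma birth_inner ws z j : size ws = j -> (j < k)%N -> matches ws z ->
  tbirth rate z (w_ j) = bw ws (w_ j).
Proof.
move=> sw jk mz; apply: bw_birth => //; case wj : (w_ j) => [//|b p].
by have [? ->] := tree_order_parent jk wj; rewrite sw andbT.
Qed.

Lemma matches_rcons ws z w y : (size ws < k)%N -> matches ws z ->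
  y = rate (w_ (size ws)) * (w + elapsed ws (size ws) - bw ws (w_ (size ws))) ->
  matches (rcons ws w) (upd z (w_ (size ws)) y).
Proof.
move=> wk mz -> i; rewrite size_rcons ltnS leq_eqVlt => /predU1P[->|iw].
  rewrite elapsed_recr elapsed_rcons// nth_rcons ltnn eqxx /tdeath upd_eq.
  rewrite (_ : tbirth _ _ _ = bw ws (w_ (size ws))); last first.
    rewrite -(birth_inner (z := z))//; apply: tbirth_eq => p pe; rewrite /upd.
    by case: eqP => // pp; rewrite pp in pe; rewrite (negbTE (psuffixxx _)) in pe.
  have re : rate (w_ (size ws)) != 0 by rewrite gt_eqF// rate_inner// mem_nth.
  by rewrite mulKf//; ring.
by rewrite tdeath_upd// mz// elapsed_rcons.
Qed.

(** The words still to be integrated do not influence the death times up to index [j], so that a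
    violation among these is final. *)
Lemma run_prefix_eq0 j z : (j < k)%N ->
  t < tdeath rate z (w_ j) \/ (exists2 i, j = i.+1 &
    tdeath rate z (w_ j) < tdeath rate z (w_ i)) ->
  foldr zint F (drop j.+1 es ++ L) z = 0%E.
Proof.
move=> jk bad; rewrite -(foldr_zint0 (drop j.+1 es ++ L) z).
apply: foldr_zint_eq => z' zz'; rewrite (_ : run _ _ _ _ = false) ?mulr0//.
have zi i : (i <= j)%N -> tdeath rate z' (w_ i) = tdeath rate z (w_ i).
  move=> ij; have ik := leq_ltn_trans ij jk.
  apply: tdeath_eq => p /(inner_suffix ik)[pi pes]; apply: zz'.
  have [_ LE _] := tree_leavesP tes.
  rewrite mem_cat LE /tree_leaf pes orbF; apply/negP => /(nthP [::])[n].
  rewrite size_drop nth_drop => nk pE; move: pi; rewrite -pE index_uniq//; try lia.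
  exact: tree_order_uniq.
apply/negP => /and3P[ses tl _]; case: bad => [tj|[i ji tji]].
  by have /(all_nthP [::])/(_ _ jk) := tl; rewrite zi// leNgt tj.
have /(sortedP [::])/(_ i) := ses; rewrite -ji jk => /(_ isT)/before_le.
by rewrite !zi ?ji//; move: tji; rewrite ji; lra.
Qed.

Definition run_density ws : \bar R :=
  (a * (\prod_(i < k) weight ws i) * tail_weight ws)%:E.

(** Induction on the number of inner lifetimes left. The factor with the weights of the divisions
    already fixed makes the complete density appear on the right at every stage. *)
Lemma foldr_zint_times n ws z : (size ws + n)%N = k ->
  (forall w, w \in ws -> 0 < w) -> \sum_(v <- ws) v <= t -> matches ws z ->
  (foldr zint F (drop (size ws) es ++ L) z * (\prod_(i < size ws) weight ws i)%:E
   = int_times t n ws run_density)%E.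
Proof.
elim: n ws z => [|n IH] ws z swn ws0 wt mz.
  rewrite addn0 in swn; rewrite (_ : drop _ _ = [::]) ?swn ?drop_size//=.
  rewrite (zint_leaves swn ws0 wt mz) -EFinM; by rewrite /run_density mulrAC.
have wk : (size ws < k)%N by lia.
have ws0' w : w \in ws -> 0 <= w by move=> /ws0/ltW.
set j := size ws; set e := w_ j; rewrite (drop_nth [::] wk) -/j -/e /=.
set L' := drop j.+1 es ++ L; set c := \prod_(i < j) weight ws i.
have c0 : 0 <= c by apply: prodr_ge0 => i _; apply: weight_ge0; have := ltn_ord i; lia.
have re : 0 < rate e by apply: rate_inner; exact: mem_nth.
pose b := bw ws e; pose y w := rate e * (w + (elapsed ws j - b)).
pose G x := foldr zint F L' (upd z e x).
have mG : measurable_fun setT G.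
  apply: (cmeas_foldr_zint L' F_meas run_F_ge0) => p.
  by apply: (measurable_upd (h := fun _ : R => z)).
have G0 x : (0 <= G x)%E by exact/foldr_zint_ge0/run_F_ge0.
have birthe : tbirth rate z e = b by exact: birth_inner.
have deathe w : tdeath rate (upd z e (y w)) e = elapsed ws j + w.
  rewrite /tdeath upd_eq -(tbirth_eq rate (z := z)).
    by rewrite birthe /y mulKf ?gt_eqF//; ring.
  move=> p pe; rewrite /upd; case: eqP => // pp.
  by rewrite pp (negbTE (psuffixxx _)) in pe.
have Sb : b <= elapsed ws j.
  rewrite /b /e; case wj : (w_ j) => [|b' p]; first exact: elapsed_ge0.
  by apply: elapsed_le => //; have [] := tree_order_parent wk wj.
pose T := t - \sum_(v <- ws) v.
have ST : elapsed ws j = t - T by rewrite /T -elapsed_size; ring.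
pose H w := (G (y w) * (rate e * exponential_pdf 1 (y w))%:E * c%:E)%E.
have HI w : 0 < w <= T -> H w = int_times t n (rcons ws w) run_density.
  move=> /andP[w0 wT].
  rewrite -(IH _ (upd z e (y w))).
  - rewrite size_rcons -/j /H -muleA -EFinM; congr (_ * _%:E)%E.
    rewrite big_ord_recr /= mulrC; congr (_ * _).
      by apply: eq_bigr => i _; rewrite weight_rcons//; have := ltn_ord i; lia.
    rewrite /weight -/e elapsed_recr elapsed_rcons// nth_rcons ltnn eqxx bw_rcons// -/b.
    rewrite exponential_pdfE; last first.
      by apply: mulr_ge0; [exact: ltW|lra].
    by rewrite mulN1r mul1r; congr (_ * expR (- (_ * _))); ring.
  - by rewrite size_rcons; lia.
  - by move=> v; rewrite mem_rcons inE => /predU1P[->//|/ws0].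
  - by rewrite -cats1 big_cat big_seq1 /=; move: wT; rewrite /T; lra.
  - by apply: matches_rcons => //; rewrite /y -addrA.
(* The point [w = 0] is left out: there two deaths may tie and the numbers of the words decide. It
   is a null set. *)
have H0 w : w != 0 -> ~~ (0 < w <= T) -> H w = 0%E.
  move=> w0 wn; rewrite /H /G.
  have [wT|wT] := ltP T w.
    rewrite (run_prefix_eq0 wk) ?mul0e//; left; rewrite -/e deathe; lra.
  have {}w0 : w < 0 by rewrite lt_neqAle w0/= leNgt; apply: contra wn => ->.
  (* Nothing precedes the first division; there the exponential density excludes negative times,
     later on the order of deaths does. *)
  have [j0|j0] := posnP j.
    rewrite (_ : exponential_pdf _ _ = 0) ?mulr0 ?mule0 ?mul0e//.
    apply: lt0_exponential_pdf; rewrite /y pmulr_rlt0//.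
    rewrite (_ : b = 0) ?j0 /elapsed ?big_ord0; first by lra.
    rewrite /b /e j0; case w0' : (w_ 0%N) => [//|b' p].
    by have [] := tree_order_parent (leq_ltn_trans (leq0n j) wk) w0'.
  rewrite (run_prefix_eq0 wk) ?mul0e//; right; exists j.-1; first by rewrite prednK.
  rewrite -/e deathe tdeath_upd ?prednK//; rewrite mz ?prednK//; lra.
have mH' : measurable_fun setT
    (fun w => G (y w) * (rate e * exponential_pdf 1 (y w))%:E)%E.
  have my : measurable_fun setT y by apply: measurable_funM => //; exact: measurable_funD.
  apply: emeasurable_funM; first exact: (measurableT_comp mG).
  apply/measurable_EFinP; apply: measurable_funM => //.
  exact: (measurableT_comp (measurable_exponential_pdf _)).
have mH : measurable_fun setT H by exact: emeasurable_funM.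
transitivity (\int[leb]_w H w)%E.
  rewrite /zint (integral_exp_affine (elapsed ws j - b) m_exp re mG G0).
  rewrite -ge0_integralZr//.
  by move=> w _; rewrite mule_ge0 ?lee_fin ?mulr_ge0 ?exponential_pdf_ge0// ltW.
have -> : (\int[leb]_w H w = \int[leb]_(w in `]0%R, T]) H w)%E.
  rewrite [RHS]integral_mkcond; apply: ae_eq_integral => //.
    by apply: (measurable_restrictT _ _).1 => //; exact: measurable_funTS.
  exists [set 0]; split => //; first exact: lebesgue_measure_set1.
  move=> w /= Hw; apply: contrapT => w0; apply: Hw => _; rewrite patchE.
  case: ifPn => [//|wn]; apply: H0; first exact/eqP.
  by apply: contra wn => ?; apply/mem_set; rewrite /= in_itv.
rewrite /= -/T.
transitivity (\int[leb]_(w in `]0%R, T]) int_times t n (rcons ws w) run_density)%E.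
  by apply: eq_integral => w /set_mem /=; rewrite in_itv/= => /HI.
apply: integral_itv_obnd_cbnd; apply: eq_measurable_fun (measurable_funS _ _ mH) => //.
by move=> w /set_mem /=; rewrite in_itv/= => /HI.
Qed.

(** This is [zeta] after [i] divisions, summed over words instead of cells. *)
Definition total_rate i : R := \sum_(e <- tree_leaves (take i es)) rate e.

(** Both sides compute the integral over the time from 0 to [u] of the total rate of the living
    words, on the left word by word, on the right between successive divisions. *)
Lemma exponent_identity ws j u : (j <= k)%N ->
  \sum_(i < j) rate (w_ i) * (elapsed ws i.+1 - bw ws (w_ i)) +
  \sum_(e <- tree_leaves (take j es)) rate e * (u - bw ws e) =
  \sum_(i < j) total_rate i * ws`_i + total_rate j * (u - elapsed ws j).
Proof.
elim: j u => [|j IH] u jk.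
  by rewrite !big_ord0 /total_rate take0 /tree_leaves /= !big_seq1 /elapsed big_ord0.
have tj := tree_order_take j.+1 tes; have tj' := tree_order_take j tes.
have [uL LE _] := tree_leavesP tj'.
have rE : take j.+1 es = rcons (take j es) (w_ j) by exact: take_nth.
have wL : w_ j \in tree_leaves (take j es).
  move: tj; rewrite rE tree_order_rcons => /and3P[wn wp _].
  by rewrite LE /tree_leaf wn.
have LS : tree_leaves (take j.+1 es) =
    [:: false :: w_ j, true :: w_ j & rem (w_ j) (tree_leaves (take j es))].
  by rewrite rE /tree_leaves rev_rcons.
have rem_sum (f : word -> R) : \sum_(e <- tree_leaves (take j es)) f e =
    f (w_ j) + \sum_(e <- rem (w_ j) (tree_leaves (take j es))) f e.
  exact: big_rem.
have ij : index (w_ j) es = j by rewrite index_uniq// tree_order_uniq.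
(* At this time the divided word completes its life and its two successors have age 0. *)
have {}IH := IH (elapsed ws j.+1) (ltnW jk).
have TS : total_rate j.+1 = rate (false :: w_ j) + (rate (true :: w_ j) +
    \sum_(e <- rem (w_ j) (tree_leaves (take j es))) rate e).
  by rewrite /total_rate LS !big_cons.
have T0 : total_rate j = rate (w_ j) +
    \sum_(e <- rem (w_ j) (tree_leaves (take j es))) rate e.
  by rewrite /total_rate rem_sum.
rewrite big_ord_recr [X in _ = X + _]big_ord_recr /= TS LS !big_cons /= ij.
move: IH; rewrite T0 rem_sum; set r := rem _ _; set wj := w_ j.
have E v : \sum_(e <- r) rate e * (v - bw ws e) =
    v * (\sum_(e <- r) rate e) - \sum_(e <- r) rate e * bw ws e.
  by rewrite mulr_sumr -sumrB; apply: eq_bigr => e _; ring.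
rewrite !E !elapsed_recr; set A := \sum_(i < j) _; set B := \sum_(i < j) _.
by move=> IH; lra.
Qed.

Lemma run_densityE ws : size ws = k -> run_density ws =
  (\prod_(0 <= s < k) rate (w_ s) *
   expR (- \sum_(0 <= s < k) total_rate s * ws`_s) *
   expR (- (total_rate k * (t - \sum_(v <- ws) v))) * a)%:E.
Proof.
move=> sw; congr EFin; rewrite -mulrA mulrC; congr (_ * _).
rewrite /weight big_split /= /tail_weight !big_mkord -!mulrA; congr (_ * _).
rewrite -!expR_sum -!expRD; congr expR.
have := exponent_identity ws t (leqnn k); rewrite take_size.
have -> : elapsed ws k = \sum_(v <- ws) v by rewrite -elapsed_size sw.
by rewrite !sumrN => /(congr1 -%R); rewrite !opprD.
Qed.

Lemma foldr_zint_run z : foldr zint F (es ++ L) z = int_times t k [::]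
  (fun ws => (\prod_(0 <= s < k) rate (w_ s) *
   expR (- \sum_(0 <= s < k) total_rate s * ws`_s) *
   expR (- (total_rate k * (t - \sum_(v <- ws) v))) * a)%:E).
Proof.
have := @foldr_zint_times k [::] z.
rewrite /= drop0 big_ord0 mule1 big_nil => -> //.
by apply: int_times_eq => ws; exact: run_densityE.
Qed.

End Run.
End TimeIntegrals.

(** * Conditioning on the hyperplanes *)

Section MeasurableRuns.
Context (R : realType) d (T : measurableType d).
Variables (rate z : T -> word -> R).
Hypothesis mrate : forall e, measurable_fun setT (rate ^~ e).
Hypothesis mz : forall e, measurable_fun setT (z ^~ e).

Hypothesis rate_ge0 : forall t e, 0 <= rate t e.

Lemma measurable_tlife e : measurable_fun setT (fun t => (rate t e)^-1 * z t e).
Proof.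
apply: measurable_funM => //.
have : measurable_fun setT (fun t => rate t e `^ (-1)).
  exact: (measurableT_comp (measurable_powR (-1))).
by congr measurable_fun; apply/funext => t; rewrite powR_inv1.
Qed.

Lemma measurable_tbirth e : measurable_fun setT (fun t => tbirth (rate t) (z t) e).
Proof.
elim: e => [|b p IH] /=; first exact: measurable_cst.
by apply: measurable_funD => //; exact: measurable_tlife.
Qed.

Lemma measurable_tdeath e : measurable_fun setT (fun t => tdeath (rate t) (z t) e).
Proof.
by apply: measurable_funD; [exact: measurable_tbirth|exact: measurable_tlife].
Qed.

Lemma measurable_all (p : T -> word -> bool) s :
  (forall e, measurable_fun setT (p ^~ e)) ->
  measurable_fun setT (fun t => all (p t) s).
Proof.
move=> mp; elim: s => [|e s IH] /=; first exact: measurable_cst.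
exact: measurable_and.
Qed.

Lemma measurable_before e e' :
  measurable_fun setT (fun t => before (rate t) (z t) e e').
Proof.
have mt e1 := measurable_tdeath e1.
apply: measurable_or; first exact: measurable_fun_ltr.
by apply: measurable_and => //; exact: measurable_fun_eqr.
Qed.

Lemma measurable_run (t : R) es :
  measurable_fun setT (fun w => run (rate w) (z w) t es).
Proof.
have mt e := measurable_tdeath e.
apply: measurable_and; last apply: measurable_and.
- case: es => [|e es] /=; first exact: measurable_cst.
  elim: es e => [|e' es IH] e /=; first exact: measurable_cst.
  by apply: measurable_and => //; exact: measurable_before.
- by apply: measurable_all => e; exact: measurable_fun_ler.
- by apply: measurable_all => e; exact: measurable_fun_ltr.
Qed.

End MeasurableRuns.

Section GeneratedSigmaAlgebra.
Context d d' (T : measurableType d) (U : measurableType d') (X : {mfun T >-> U}).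

Lemma preimage_sigma_setI : setI_closed (g_sigma_algebra_preimage X).
Proof.
move=> _ _ [A mA <-] [B mB <-]; exists (A `&` B); first exact: measurableI.
by rewrite !setTI preimage_setI.
Qed.

Lemma preimage_sigma_setT : g_sigma_algebra_preimage X setT.
Proof. by exists setT; rewrite // setTI preimage_setT. Qed.

Lemma preimage_sigma_measurable : g_sigma_algebra_preimage X `<=` measurable.
Proof. by move=> _ [A mA <-]; rewrite setTI; exact: measurable_funPTI. Qed.

End GeneratedSigmaAlgebra.

Section HyperplanesAndTimes.
Context (R : realType) (l : nat).
Local Notation hyp := (hyperplane R l).
Implicit Types (h : word -> hyp) (z : word -> R) (e : word) (L : seq word).

Definition cmeas2 (F : (word -> hyp) -> (word -> R) -> \bar R) :=
  forall d (T : measurableType d) (h : T -> word -> hyp) (z : T -> word -> R),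
  (forall e, measurable_fun setT (h ^~ e)) ->
  (forall e, measurable_fun setT (z ^~ e)) ->
  measurable_fun setT (fun t => F (h t) (z t)).

Variable m : probability R R.

Lemma cmeas2_zint F e : cmeas2 F -> (forall h z, 0 <= F h z)%E ->
  cmeas2 (fun h => zint m e (F h)).
Proof.
move=> mF F0 d' T h z mh mz.
pose f (q : T * R) := F (h q.1) (upd (z q.1) e q.2).
have mf : measurable_fun setT f.
  apply: (mF _ _ (fun q : T * R => h q.1) (fun q : T * R => upd (z q.1) e q.2)) => e'.
    exact: (measurableT_comp (mh e')).
  apply: (measurable_upd (h := fun q : T * R => z q.1)) => // p.
  exact: (measurableT_comp (mz p)).
by have := measurable_fun_fubini_tonelli_F (m2 := m) f mf (fun q => F0 _ _).
Qed.

Lemma cmeas2_foldr_zint F L : cmeas2 F -> (forall h z, 0 <= F h z)%E ->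
  cmeas2 (fun h => foldr (zint m) (F h) L).
Proof.
move=> mF F0; elim: L => //= e L IH.
by apply: (@cmeas2_zint (fun h => foldr (zint m) (F h) L)) => // h z; exact: foldr_zint_ge0.
Qed.

End HyperplanesAndTimes.

Section Lifetimes.
Context (R : realType) (l : nat).
Local Notation hyp := (hyperplane R l).
Implicit Types (h : word -> hyp) (z : word -> R) (e : word) (L : seq word).
Variables (Lam : {measure set hyp -> \bar R}) (W : set 'rV[R]_l.+1).
Context d (Omega : measurableType d) (P : probability Omega R).
Variables (Z : word -> {RV P >-> R}) (G : nat -> {RV P >-> hyp}).
Hypothesis ZG : stit_variables Lam W Z G.
Hypothesis W_polytope : polytope W.

(** The events of all variables other than [Z e] with which it is independent. *)
Definition sources e : set (set Omega) :=
  \bigcup_(n in [set n | (1 <= n)%N]) g_sigma_algebra_preimage (G n) `|`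
  \bigcup_(e' in [set e' | e' != e]) g_sigma_algebra_preimage (Z e').

Lemma Z_indep_sources e A B : <<s sources e >> A -> measurable B ->
  P (A `&` Z e @^-1` B) = (P A * distribution P (Z [::]) B)%E.
Proof.
move=> sA mB.
pose SZ e := \bigcup_(e' in [set e' | e' != e]) g_sigma_algebra_preimage (Z e').
pose SZT := \bigcup_e g_sigma_algebra_preimage (Z e).
pose SG := \bigcup_(n in [set n | (1 <= n)%N]) g_sigma_algebra_preimage (G n).
have -> : distribution P (Z [::]) B = P (Z e @^-1` B).
  by rewrite (Z_exponential ZG)// -(Z_exponential ZG e).
have mSG : <<s SG >> `<=` measurable.
  apply: smallest_sub; first exact: sigma_algebra_measurable.
  by move=> _ [n _ [C mC <-]]; rewrite setTI; exact: measurable_funPTI.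
have mSZ e' : <<s SZ e' >> `<=` measurable.
  apply: smallest_sub; first exact: sigma_algebra_measurable.
  by move=> _ [n _ [C mC <-]]; rewrite setTI; exact: measurable_funPTI.
have mZB : measurable (Z e @^-1` B) by exact: measurable_funPTI.
have sZ : <<s SZ e >> `<=` <<s SZT >>.
  by apply: sub_sigma_algebra2 => C [e' _ SC]; exists e'.
have sZB : <<s SZT >> (Z e @^-1` B).
  by apply: sub_sigma_algebra; exists e => //; exists B => //; rewrite setTI.
have Zind A1 : <<s SZ e >> A1 -> (P (A1 `&` Z e @^-1` B) = P A1 * P (Z e @^-1` B))%E.
  move=> sA1; apply: (@bigcup_independent _ _ _ _ _ _ _ (Z_independent ZG) _ _ _
    [set e' | e' != e] e) => //.
  - by move=> i; exact: preimage_sigma_setI.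
  - by move=> i; exact: preimage_sigma_setT.
  - by move=> i _; exact: preimage_sigma_measurable.
  - by move=> /= /eqP.
  - by exists B => //; rewrite setTI.
(* Independence is given among the [Z], and between all [Z] and all [G]. Intersections of one event
   of each kind form a pi-system on which both can be used. *)
pose Pi := [set C | exists A1 A2, [/\ <<s SZ e >> A1, <<s SG >> A2 & C = A1 `&` A2]].
have sT (S : set (set Omega)) : <<s S >> setT.
  exact: (@measurableT _ (g_sigma_algebraType S)).
have sI (S : set (set Omega)) : setI_closed <<s S >>.
  move=> C D sC sD.
  exact: (@measurableI _ (g_sigma_algebraType S) C D).
apply: (independent_pi (G := Pi)) => //.
- move=> _ _ [A1 [A2 [s1 s2 ->]]] [B1 [B2 [t1 t2 ->]]].
  by exists (A1 `&` B1), (A2 `&` B2); split; [exact: sI|exact: sI|rewrite setIACA].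
- by exists setT, setT; split => //; rewrite setTI.
- by move=> _ [A1 [A2 [s1 s2 ->]]]; apply: measurableI; [exact: mSZ s1|exact: mSG].
- move=> _ [A1 [A2 [s1 s2 ->]]]; have ZGi := ZG_independent ZG.
  rewrite setIAC (ZGi (A1 `&` Z e @^-1` B) A2)//; last by apply: sI => //; exact: sZ.
  rewrite (ZGi A1 A2)//; last exact: sZ.
  by rewrite Zind// muleAC.
- apply: sub_sigma_algebra2 sA => C [SC|SC].
    exists setT, C; split; [exact: sT|exact: sub_sigma_algebra|by rewrite setTI].
  exists C, setT; split; [exact: sub_sigma_algebra|exact: sT|by rewrite setIT].
Qed.

Local Notation mZ := (distribution P (Z [::])).
Local Notation hd w := (hdiv W (fun n => G n w)).
Local Notation zd w := (fun e => Z e w).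

Lemma exp_law_Z : exp_law mZ.
Proof. by move=> B mB; exact: (Z_exponential ZG). Qed.

Lemma integral_zint F e : cmeas2 F -> (forall h z, 0 <= F h z)%E ->
  (\int[P]_w F (hd w) (zd w) = \int[P]_w zint mZ e (F (hd w)) (zd w))%E.
Proof.
move=> mF F0; pose T1 := g_sigma_algebraType (sources e).
have mT1 (C : set Omega) : measurable (C : set T1) -> measurable C.
  apply: smallest_sub; first exact: sigma_algebra_measurable.
  by move=> _ [[n _ [D mD <-]]|[n _ [D mD <-]]]; rewrite setTI; exact: measurable_funPTI.
have mG1 n : (0 < n)%N -> measurable_fun setT (G n : T1 -> hyp).
  by move=> n0 _ B mB; apply: sub_sigma_algebra; left; exists n => //; exists B.
have mZ1 e' : e' != e -> measurable_fun setT (Z e' : T1 -> R).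
  by move=> ne _ B mB; apply: sub_sigma_algebra; right; exists e' => //; exists B.
(* A free variable replaces [Z e], the one lifetime variable left out of the generators of [T1]. *)
pose zq (q : T1 * R) : word -> R := upd (fun e' => Z e' q.1) e q.2.
pose f (q : T1 * R) := F (hd q.1) (zq q).
transitivity (\int[P]_w f (w, Z e w))%E.
  apply: eq_integral => w _; congr (F _ _); apply/funext => e'.
  by rewrite /zq /upd /=; case: eqP => // ->.
apply: (@freezing _ _ _ P _ _ T1 R id (Z e)) => //.
- by move=> _ A mA; rewrite setTI; exact: mT1.
- by move=> A B mA mB; exact: Z_indep_sources.
- apply: (mF _ _ (fun q : T1 * R => hd q.1) zq) => e'.
    have := @measurable_hdiv _ _ W W_polytope _ T1 (fun w n => G n w) e' mG1.
    by move=> mh; exact: (measurableT_comp mh).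
  rewrite /zq /upd; have [_|ne] := eqVneq e' e; first exact: measurable_snd.
  exact: (measurableT_comp (mZ1 e' ne)).
- by move=> q; exact: F0.
Qed.

Lemma integral_zints F L : cmeas2 F -> (forall h z, 0 <= F h z)%E ->
  (\int[P]_w F (hd w) (zd w) = \int[P]_w foldr (zint mZ) (F (hd w)) L (zd w))%E.
Proof.
elim/last_ind: L F => // L e IH F mF F0.
rewrite (integral_zint e mF F0) (IH (fun h => zint mZ e (F h))).
- by apply: eq_integral => w _; rewrite foldr_rcons.
- exact: cmeas2_zint.
- by move=> h z; exact: zint_ge0.
Qed.

End Lifetimes.

(** * The integral formula *)

Section NormalizedMeasure.
Context (R : realType) (l : nat).
Local Notation V := 'rV[R]_l.+1.
Local Notation hyp := (hyperplane R l).
Implicit Types (h : word -> hyp) (e : word) (es : seq word).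

Section RestrictedIntegral.
Context d (T : measurableType d) (m : {measure set T -> \bar R}).

Lemma ge0_integral_mrestr (D : set T) (mD : measurable D) (f : T -> \bar R) :
  measurable_fun setT f -> (forall x, 0 <= f x)%E ->
  (\int[mrestr m mD]_x f x = \int[m]_(x in D) f x)%E.
Proof.
move=> mf f0.
rewrite [LHS](ge0_negligible_integral (N := ~` D))//; last 2 first.
- exact: measurableC.
- by rewrite /= /mrestr setICl measure0.
rewrite setTD setCK; apply: eq_measure_integral => A mA AD /=.
by rewrite /mrestr setIidl.
Qed.

End RestrictedIntegral.

Variables (Lam : {measure set hyp -> \bar R}) (W : set V) (nu : probability hyp R).
Hypothesis Lam_neq0 : Lam setT != 0%E.
Hypothesis Lam_inv : translation_invariant Lam.
Hypothesis Lam_lf : locally_finite Lam.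
Hypothesis W_polytope : polytope W.
Hypothesis W_int : W° !=set0.
Hypothesis nu_Lam : forall B, measurable B -> nu B = Lamhat Lam W B.

Let W_compact : compact W := polytope_compact W_polytope.

Lemma Lam_hit C : compact C -> Lam (hit C) = (lam Lam C)%:E.
Proof.
move=> Cc; rewrite /lam fineK// ge0_fin_numE; last exact: measure_ge0.
exact: Lam_hit_finite.
Qed.

Lemma lam_gt0 C : compact C -> C° !=set0 -> 0 < lam Lam C.
Proof. by move=> Cc C0; rewrite -lte_fin -Lam_hit//; exact: Lam_hit_gt0. Qed.

Lemma lam_ge0 C : 0 <= lam Lam C.
Proof. exact: fine_ge0. Qed.

Lemma sub_hit (C D : set V) : C `<=` D -> (hit C : set hyp) `<=` hit D.
Proof. by move=> CD H [x [Hx Cx]]; exists x; split => //; exact: CD. Qed.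

Lemma nu_hit C B : C `<=` W -> measurable (B `&` hit C) ->
  nu (B `&` hit C) = ((lam Lam W)^-1%:E * Lam (B `&` hit C))%E.
Proof.
move=> CW mB; rewrite nu_Lam// /Lamhat; congr (_ * Lam _)%E.
by rewrite -setIA; congr (_ `&` _); apply: setIidl; exact: sub_hit.
Qed.

Let lW : 0 < lam Lam W. Proof. exact: lam_gt0. Qed.

Lemma hit_prob_lam e h :
  hit_prob W nu e h = (lam Lam W)^-1 * lam Lam (cell W h e).
Proof.
apply: EFin_inj; rewrite -hit_probE// -[hit _]setTI nu_hit.
- by rewrite setTI Lam_hit ?EFinM//; exact: cell_compact.
- exact: cell_sub.
- by rewrite setTI; exact: hit_cell_measurable.
Qed.

Lemma lam_cell_gt0 h e : nondeg W h e -> 0 < lam Lam (cell W h e).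
Proof. by move=> he; apply: lam_gt0 => //; exact: cell_compact. Qed.

Lemma hit_prob_gt0 e h : nondeg W h e -> 0 < hit_prob W nu e h.
Proof. by move=> he; rewrite hit_prob_lam mulr_gt0 ?invr_gt0// lam_cell_gt0. Qed.

Lemma nondeg_upd h e H b :
  nondeg W (upd h e H) (b :: e) = nondeg (cell W h e) (fun=> H) [:: b].
Proof.
rewrite /nondeg; congr (_ !=set0); congr (_°)%classic => /=.
by rewrite upd_eq cell_upd// psuffixxx.
Qed.

Lemma touch_null h e b : nondeg W h e ->
  nu (hit (cell W h e) `&` [set H | ~ nondeg W (upd h e H) (b :: e)]) = 0%E.
Proof.
move=> he; have Cp : polytope (cell W h e) by exact: polytope_cell.
have := Lam_touch Lam_inv b Lam_lf Cp he.
rewrite (_ : [set H | ~ nondeg W (upd h e H) (b :: e)] =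
  [set H | ~ nondeg (cell W h e) (fun=> H) [:: b]]); last first.
  by apply/funext => H; rewrite /= nondeg_upd.
set S := [set _ | _] => S0; rewrite setIC nu_hit; [|exact: cell_sub|].
  by rewrite setIC S0 mule0.
apply: measurableI; last exact: hit_cell_measurable.
rewrite (_ : S = ~` [set H | nondeg (cell W h e) (fun=> H) [:: b]])//.
apply: measurableC.
by apply: (@measurable_nondeg _ _ _ _ (fun H : hyp => (fun=> H))).
Qed.

(** The measure of the formula is [nu] conditioned on hitting the cell, as the factor with
    [lam Lam W] cancels. Degenerate cells are covered by the convention for the inverse of 0. *)
Lemma integral_Lamhat h e f : cmeas f -> (forall h, 0 <= f h)%E ->
  (\int[Lamhat Lam (cell W h e)]_H f (upd h e H) = divide W nu e f h)%E.
Proof.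
move=> mf f0; have mC := hit_cell_measurable W_polytope h e.
have mfH : measurable_fun setT (fun H => f (upd h e H)).
  by apply: mf => e'; apply: (measurable_upd (h := fun _ : hyp => h)).
have r0 : 0 <= (lam Lam (cell W h e))^-1 by rewrite invr_ge0 lam_ge0.
have p0 : 0 <= (hit_prob W nu e h)^-1 by rewrite invr_ge0 hit_prob_ge0.
pose m : {measure set hyp -> \bar R} := mscale (NngNum r0) (mrestr Lam mC).
pose m' : {measure set hyp -> \bar R} := mscale (NngNum p0) (mrestr nu mC).
transitivity (\int[m]_H f (upd h e H))%E; first by [].
transitivity (\int[m']_H f (upd h e H))%E.
  apply: eq_measure_integral => B mB _; rewrite /m /m' /= /mscale /= /mrestr.
  transitivity ((hit_prob W nu e h)^-1%:E *
      ((lam Lam W)^-1%:E * Lam (B `&` hit (cell W h e))))%E.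
    by rewrite muleA -EFinM hit_prob_lam invfM invrK mulrAC divff ?gt_eqF// mul1r.
  congr (_ * _)%E; apply/esym/nu_hit; first exact: cell_sub.
  exact: measurableI.
rewrite ge0_integral_mscale//; congr (_ * _)%E.
exact: ge0_integral_mrestr.
Qed.


Definition cell_rate h e := lam Lam (cell W h e).

(** Since [zeta] sums over a set of cells, different words must have different cells for no term to
    be lost. *)
Lemma sum_image_cells (L : seq word) h : uniq L ->
  (forall e, e \in L -> nondeg W h e) ->
  (forall e e', e \in L -> e' \in L -> e != e' -> ~~ suffix e e') ->
  zeta Lam [set cell W h e | e in [set` L]] = \sum_(e <- L) cell_rate h e.
Proof.
move=> uL nL incL; rewrite /zeta fsbig_image; last first.
  move=> e e' /set_mem /= eL /set_mem /= e'L ce; apply: contrapT => /eqP ne.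
  have nd := nL e eL; apply: incomparable_cell_inj ce => //; first exact: incL.
  by apply: incL; rewrite // eq_sym.
by rewrite -fsbig_seq.
Qed.

Lemma nondeg_suffix h p e : suffix p e -> nondeg W h e -> nondeg W h p.
Proof.
move=> pe [x]; rewrite cell_interiorE => -[Wx mx]; exists x.
rewrite cell_interiorE; split => //; exact: lt_le_trans (margin_suffix h x pe).
Qed.

Lemma tess_sigma_sub A : tess_sigma W A -> A `<=` tessellation W.
Proof.
move: A; apply: smallest_sub.
  split; first by [].
    by move=> B _ T [].
  by move=> F FT T [n _ /FT].
by move=> _ [K _ <-] T [].
Qed.

Lemma leaf_below es e : tree_order es -> (e \in es) || tree_leaf es e ->
  exists2 e', tree_leaf es e' & suffix e e'.
Proof.
move=> tes; have [n] := ubnP (size es - size e); elim: n e => // n IH e en.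
have [ees _|_ el] := boolP (e \in es); last by exists e => //; exact: suffix_refl.
have es_e := tree_order_size tes ees.
have [||e' e'l e'e] := IH (false :: e).
- by rewrite /= subnS prednK ?subn_gt0.
- by rewrite /tree_leaf /= ees andbT orbN.
by exists e' => //; apply: suffix_trans e'e; exact: suffix_cons.
Qed.

Section Formula.
Variables (t : R) (A : set (set (set V))) (es : seq word).
Hypothesis t0 : 0 <= t.
Hypothesis A_tess : tess_sigma W A.
Hypothesis tes : tree_order es.
Local Notation k := (size es).

Definition run_indicator h z : \bar R :=
  (\1_A (tree_tess W h es) * (run (cell_rate h) z t es)%:R)%:E.

Lemma run_indicator_ge0 h z : (0 <= run_indicator h z)%E.
Proof. by rewrite lee_fin mulr_ge0// indicE. Qed.

Lemma cmeas2_run_indicator : cmeas2 run_indicator.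
Proof.
move=> d T h z mh mz; apply/measurable_EFinP; apply: measurable_funM.
  have -> : (fun w => \1_A (tree_tess W (h w) es)) =
      \1_[set w | A (tree_tess W (h w) es)] :> (T -> R).
    by apply/funext => w; rewrite !indicE.
  apply: measurable_indic; apply: measurable_tree_tess => //.
    exact: tree_order_closed.
  by move=> p; exact: tree_order_size.
have mr e : measurable_fun setT (fun w => cell_rate (h w) e).
  have : measurable_fun setT (fun w => lam Lam W * hit_prob W nu e (h w)).
    apply: measurable_funM => //; apply/measurable_EFinP.
    exact: (cmeas_hit_prob nu W_polytope e).
  congr measurable_fun; apply/funext => w.
  by rewrite hit_prob_lam mulVKf// gt_eqF.
have mrun := measurable_run mr mz (fun w e => lam_ge0 _) t es.
have -> : (fun w => (run (cell_rate (h w)) (z w) t es)%:R) =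
    \1_((fun w => run (cell_rate (h w)) (z w) t es) @^-1` [set true]) :> (T -> R).
  apply/funext => w; rewrite indicE; congr (nat_of_bool _)%:R.
  by apply/idP/idP => [r|/set_mem //]; exact/mem_set.
by apply: measurable_indic; rewrite -[X in measurable X]setTI; exact: mrun.
Qed.

Definition run_prob h : \bar R := int_times t k [::] (fun ws =>
  (\prod_(0 <= s < k) cell_rate h (nth [::] es s) *
   expR (- \sum_(0 <= s < k) total_rate (cell_rate h) es s * ws`_s) *
   expR (- (total_rate (cell_rate h) es k * (t - \sum_(v <- ws) v))) *
   \1_A (tree_tess W h es))%:E).

(** Membership in [A] makes the leaf cells windows, and the cell of every node contains a leaf cell.
    All rates in the formula are then positive. *)
Lemma leaf_nondeg h e : A (tree_tess W h es) -> (e \in es) || tree_leaf es e ->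
  nondeg W h e.
Proof.
move=> /(tess_sigma_sub A_tess).
move=> /(tree_tessP W_polytope h (tree_order_closed tes)
  (fun p => @tree_order_size es p tes)) nd.
by move=> /(leaf_below tes)[e' /nd ne' ee']; exact: nondeg_suffix ne'.
Qed.

Lemma foldr_zint_run_prob (m : probability R R) h z : exp_law m ->
  foldr (zint m) (run_indicator h) (es ++ tree_leaves es) z = run_prob h.
Proof.
move=> me; have [AT|AT] := pselect (A (tree_tess W h es)).
  apply: (foldr_zint_run me (a := \1_A (tree_tess W h es))) => //.
  - by move=> e ees; apply: lam_cell_gt0; apply: leaf_nondeg => //; rewrite ees.
  - by move=> e el; apply: lam_cell_gt0; apply: leaf_nondeg => //; rewrite el orbT.
  - move=> d T z' mz'; apply: (cmeas2_run_indicator (h := fun _ : T => h)) => //.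
(* Outside [A] some rates may be 0 and the computation does not apply, but both sides vanish. *)
have A0 : \1_A (tree_tess W h es) = 0 :> R.
  by rewrite indicE (_ : _ \in A = false)//; apply/negP => /set_mem.
rewrite (@foldr_zint_eq _ m _ _ (fun=> 0%E)) ?foldr_zint0.
  rewrite /run_prob A0 (@int_times_eq _ _ _ _ _ (fun=> 0%E)) ?int_times0// => ws _.
  by rewrite mulr0.
by move=> z' _; rewrite /run_indicator A0 mul0r.
Qed.

Lemma run_prob_ge0 h : (0 <= run_prob h)%E.
Proof.
apply: int_times_ge0 => ws; rewrite lee_fin.
by rewrite !mulr_ge0 ?expR_ge0// ?indicE// prodr_ge0// => i _; exact: lam_ge0.
Qed.

Lemma cmeas_run_prob (m : probability R R) : exp_law m -> cmeas run_prob.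
Proof.
move=> me d T h mh.
have := @cmeas2_foldr_zint _ _ m run_indicator (es ++ tree_leaves es).
move=> /(_ cmeas2_run_indicator run_indicator_ge0 d T h (fun _ _ => 0) mh).
move=> /(_ (fun _ => measurable_cst _)); congr measurable_fun.
by apply/funext => w; exact: foldr_zint_run_prob.
Qed.

Lemma run_prob_depends_on : depends_on (mem es) run_prob.
Proof.
move=> h h' hh.
have ce e : (e \in es) || tree_leaf es e -> cell W h e = cell W h' e.
  move=> ees; apply: eq_cell => p b pe; apply: hh.
  have pc := tree_order_closed tes.
  case/orP: ees => [ees|/andP[_ el]].
    apply: prefix_closed_suffix ees => //; apply: suffix_trans pe; exact: suffix_cons.
  by apply: (tree_order_psuffix tes el); exact: psuffix_cons pe.
have re e : (e \in es) || tree_leaf es e -> cell_rate h e = cell_rate h' e.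
  by move=> /ce; rewrite /cell_rate => ->.
have tE : tree_tess W h es = tree_tess W h' es.
  by apply: eq_imagel => e el; apply: ce; rewrite el orbT.
have zE s : total_rate (cell_rate h) es s = total_rate (cell_rate h') es s.
  have [_ LE _] := tree_leavesP (tree_order_take s tes).
  apply: eq_big_seq => e; rewrite LE => el; apply: re.
  case/andP: el => es_e; rewrite /tree_leaf.
  by have [//|_ /=] := boolP (e \in es); case: e es_e => // b p _; exact: mem_take.
rewrite /run_prob tE; apply: int_times_eq => ws _; congr (_ * _ * _ * _)%:E.
- by rewrite !big_mkord; apply: eq_bigr => i _; rewrite re// mem_nth.
- by congr (expR (- _)); rewrite !big_mkord; apply: eq_bigr => i _; rewrite zE.
- by rewrite zE.
Qed.

End Formula.

Lemma cmeas_foldr_divide es f : cmeas f -> (forall h, 0 <= f h)%E ->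
  cmeas (foldr (divide W nu) f es).
Proof.
move=> mf f0; have d0 es' h : (0 <= foldr (divide W nu) f es' h)%E.
  by case: es' => //= e es'; apply: divide_ge0; elim: es' => //= e' es' IH h';
    exact: divide_ge0.
by elim: es => //= e es IH; exact: cmeas_divide.
Qed.

(** Relates the lookup by position in the formula to families of hyperplanes updated at one word
    after the other. *)
Lemma divider_rcons r (hs : seq hyp) H : uniq (rstars r (size hs).+1) ->
  divider r (rcons hs H) = upd (divider r hs) (rstar r (size hs)) H.
Proof.
rewrite rstars_rcons rcons_uniq => /andP[nr _]; apply/funext => e.
rewrite /divider size_rcons -/(rstars r (size hs).+1) -/(rstars r (size hs)).
rewrite rstars_rcons -[rcons (rstars _ _) _]cats1 index_cat /upd nth_rcons.
have [er|er] := boolP (e \in rstars r (size hs)).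
  have : (index e (rstars r (size hs)) < size hs)%N.
    by rewrite -[X in (_ < X)%N](size_rstars r) index_mem.
  by move=> ->; case: eqP => // ee; rewrite ee (negbTE nr) in er.
rewrite size_rstars /= [rstar _ _ == e]eq_sym; case: (e == _).
  by rewrite addn0 ltnn eqxx.
rewrite ltnNge leq_addr /= addn1 [RHS]nth_default ?gtn_eqF//.
by rewrite memNindex// size_rstars.
Qed.

Lemma int_hyperplanes_foldr r n hs Phi F : uniq (rstars r (size hs + n)) ->
  cmeas Phi -> (forall h, 0 <= Phi h)%E ->
  (forall hs', size hs' = (size hs + n)%N -> F hs' = Phi (divider r hs')) ->
  int_hyperplanes Lam W r n hs F =
  foldr (divide W nu) Phi (drop (size hs) (rstars r (size hs + n))) (divider r hs).
Proof.
move=> + mPhi Phi0; elim: n hs => [|n IH] hs ur FP.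
  by rewrite /= drop_oversize ?size_rstars ?addn0//=; apply: FP; rewrite addn0.
rewrite (drop_nth [::]) ?size_rstars; last by rewrite addnS ltnS leq_addr.
rewrite nth_rstars /=; last by rewrite addnS ltnS leq_addr.
set L' := drop _ _; rewrite -integral_Lamhat; last 2 first.
- exact: cmeas_foldr_divide.
- move=> h; elim: L' h => //= e L' IH' h; exact: divide_ge0.
rewrite /rcell; congr (integral _ _ _); apply/funext => H; rewrite IH; last 2 first.
- by rewrite size_rcons addSnnS.
- by move=> hs' hs's; apply: FP; rewrite hs's size_rcons addSnnS.
rewrite size_rcons addSnnS divider_rcons//.
have -> : rstars r (size hs).+1 = take (size hs).+1 (rstars r (size hs + n.+1)).
  by rewrite take_rstars// addnS ltnS leq_addr.
exact: take_uniq.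
Qed.

Lemma int_hyperplanes_stit k t A (r : (2 * k).+1.-tuple word)
    (m : probability R R) : exp_law m -> 0 <= t ->
  tess_sigma W A -> Theta k r ->
  int_hyperplanes Lam W r k [::] (fun hs => int_times t k [::] (fun ws =>
    (stit_density Lam W r k t A hs ws)%:E)) =
  foldr (divide W nu) (run_prob t A (rstars r k)) (rstars r k) point.
Proof.
move=> me t0 A_tess rT; have [rE tes] := Theta_node_list rT.
set es := rstars r k in rE tes *; have ses : size es = k by rewrite size_rstars.
rewrite (int_hyperplanes_foldr (Phi := run_prob t A es)).
- by rewrite /= drop0.
- exact: tree_order_uniq.
- exact: (cmeas_run_prob _ _ _ me).
- by move=> h; exact: run_prob_ge0.
move=> hs; rewrite add0n => hsk; set h := divider r hs.
have tessE s : rtess W r hs s = tree_tess W h (take s es).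
  rewrite /rtess (_ : leaves _ = [set e | tree_leaf (take s es) e])//.
  by rewrite rE take_node_list leaves_node_list.
rewrite /run_prob ses; apply: int_times_eq => ws wsk; congr EFin.
rewrite /stit_density tessE take_oversize ?ses//.
(* If the tessellation is not in [A], both sides are 0. Otherwise the cells are nondegenerate at
   every stage, so that [zeta] can be summed over words. *)
have [AT|AT] := pselect (A (tree_tess W h es)); last first.
  by rewrite indicE (_ : _ \in A = false) ?mulr0//; apply/negP => /set_mem.
have zE s : (s <= k)%N -> zeta Lam (rtess W r hs s) = total_rate (cell_rate h) es s.
  move=> sk; have ts := tree_order_take s tes; have [uL LE _] := tree_leavesP ts.
  rewrite tessE /tree_tess (_ : [set e | tree_leaf (take s es) e] =
    [set` tree_leaves (take s es)]); last by apply/funext => e /=; rewrite LE.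
  apply: sum_image_cells => // [e|e e']; rewrite !LE.
    move=> el; apply: (leaf_nondeg A_tess tes AT).
    case/andP: el => es_e; rewrite /tree_leaf.
    by have [//|_ /=] := boolP (e \in es); case: e es_e => // b p _; exact: mem_take.
  by apply: tree_leaf_incomparable; exact: tree_order_closed.
congr (_ * _ * _ * _).
- by apply: eq_big_nat => s /andP[_ sk]; rewrite /cell_rate /es nth_rstars.
- congr (expR (- _)); apply: eq_big_nat => s /andP[_ sk]; rewrite zE//; exact: ltnW.
- by rewrite -[in LHS](take_size es) -tessE ses zE.
Qed.

End NormalizedMeasure.

(** * The STIT process *)

Section Kappa.
Context (R : realType) (l : nat).
Local Notation hyp := (hyperplane R l).
Implicit Types (e p : word) (s : seq nat).
Variables (W : set 'rV[R]_l.+1) (g : nat -> hyp).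
Hypothesis W_int : W° !=set0.
Hypothesis g_found : forall m, exists2 s, size s = m & valid W g s.
Hypothesis g1_hit : hit W (g 1%N).

(** Read off the valid sequence that ends with [e]. Where all these sequences exist and the first
    hyperplane hits [W], it is the only solution of [kappa_spec]. *)
Definition kap e : nat :=
  latest (xget [::] [set s | size s = (word_index e).+1 /\ valid W g s]).

Lemma kap_valid e : exists s, [/\ valid W g (kap e :: s), size s = word_index e &
  forall e', (word_index e' < word_index e)%N -> kap e' = nth 0%N (rev s) (word_index e')].
Proof.
have kapE e' n s' : valid W g (n :: s') -> size s' = word_index e' -> kap e' = n.
  move=> vs ss; rewrite /kap; set x := xget _ _; have -> // : x = n :: s'.
  apply: xget_unique; first by split => //=; rewrite ss.
  by move=> s'' [ss'' vs'']; apply: (valid_uniq vs'' vs); rewrite ss'' /= ss.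
have [[//|n s] [ss] vs] := g_found (word_index e).+1.
exists s; rewrite (kapE _ _ _ vs ss); split => // e'; rewrite -ss.
case: vs => vs _ _ _; elim: s vs {ss n} => // n s IH vs /=.
rewrite ltnS leq_eqVlt => /predU1P[es|es].
  by rewrite (kapE _ _ _ vs (esym es)) rev_cons nth_rcons size_rev es ltnn eqxx.
rewrite rev_cons nth_rcons size_rev es; apply: IH => //; by case: vs.
Qed.

Lemma kap_hdiv e : g (kap e) = hdiv W g e.
Proof.
have [s [vs ss _]] := kap_valid e; rewrite (hdivE vs) /= ?ss//.
by rewrite seqh_cons ss word_indexK upd_eq.
Qed.

Lemma cell_hdiv s e : valid W g s -> (word_index (behead e) < size s)%N || (e == [::]) ->
  cell W (hdiv W g) e = cell W (seqh g s) e.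
Proof.
move=> vs es; apply: eq_cell => p b /suffixP[q eE]; apply: hdivE => //.
case/orP: es => [|/eqP e0]; last by move: eE; rewrite e0; case: q.
apply: leq_ltn_trans; apply: word_index_suffix; rewrite eE.
case: q {eE} => [|c q] /=; first exact: suffix_refl.
by apply: (suffix_trans (suffix_cons p b)); exact: suffix_suffix.
Qed.

Lemma hdiv_nondeg e : nondeg W (hdiv W g) e.
Proof.
have [s ss vs] := g_found (word_index (behead e)).+1.
have es : (word_index (behead e) < size s)%N || (e == [::]) by rewrite ss leqnn.
by rewrite /nondeg (cell_hdiv vs es); exact: valid_nondeg.
Qed.

Lemma kap_spec : kappa_spec W g kap.
Proof.
have gk : g \o kap = hdiv W g by apply/funext => e; exact: kap_hdiv.
split=> [|e e0].
  have [s [vs ss _]] := kap_valid [::].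
  have s0 : s = [::] by apply: size0nil; rewrite ss.
  move: vs; rewrite s0 => -[_ k0 mk _].
  (* A value above 1 would turn the first hyperplane into a miss, although it hits [W]. *)
  apply/eqP; rewrite eqn_leq k0 andbT leqNgt; apply/negP => k1.
  by apply: (mk 1%N) => //=; rewrite /latest /=; lia.
have [s [vs ss kE]] := kap_valid e.
have [vs' ks mk [hk _]] := vs.
have eE : word_of (size s) = e by rewrite ss word_indexK.
have es : (word_index (behead e) < size s)%N || (e == [::]).
  by rewrite (negbTE e0) orbF ss; case: (e) e0 => // b p _; exact: word_index_lt.
have kl e' : word_lt e' e -> (kap e' <= latest s)%N.
  rewrite word_ltE => ee'; rewrite kE//.
  have : nth 0%N (rev s) (word_index e') \in s by rewrite -mem_rev mem_nth// size_rev ss.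
  by move=> /(increasing_head (valid_increasing vs'))/andP[].
rewrite /kappa_candidates gk (cell_hdiv vs' es); split.
  split; first by rewrite eE in hk.
  by move=> e' /kl; move/leq_ltn_trans; apply.
move=> n [hn ne]; rewrite leqNgt; apply/negP => nk.
(* The word just before [e] has the value [latest s], which every candidate exceeds. *)
have sn : (latest s < n)%N.
  have s0 : (0 < size s)%N.
    by rewrite ss; case: (e) e0 => // b p _; exact: leq_ltn_trans (word_index_lt b p).
  pose e' := word_of (size s).-1.
  have ie' : word_index e' = (size s).-1 by rewrite word_ofK.
  have ee' : (word_index e' < word_index e)%N by rewrite ie' -ss prednK.
  have := ne e'; rewrite word_ltE => /(_ ee'); rewrite kE// ie'.
  by rewrite nth_rev ?prednK// subnn nth0.
by apply: (mk n _ _ _) => //; [lia|rewrite eE].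
Qed.

Lemma kappa_spec_uniq kap' : kappa_spec W g kap' -> kap' = kap.
Proof.
move=> [k0 k1]; apply/funext => e; have [h0 h1] := kap_spec.
have [n] := ubnP (word_index e); elim: n e => // n IH e en.
have [->|e0] := eqVneq e [::]; first by rewrite k0 h0.
have eq_k e' : (word_index e' < word_index e)%N -> kap' e' = kap e'.
  by move=> ee'; apply: IH; rewrite -ltnS; exact: leq_trans en.
have cE : kappa_candidates W g kap' e = kappa_candidates W g kap e.
  have -> : kappa_candidates W g kap' e = [set m |
      hit (cell W (g \o kap) e) (g m) /\ forall e', word_lt e' e -> (kap' e' < m)%N].
    rewrite /kappa_candidates (_ : cell W (g \o kap') e = cell W (g \o kap) e)//.
    apply: eq_cell => p b /psuffix_cons/psuffix_index pe /=; by rewrite eq_k.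
  apply/seteqP; split => m [hm mk]; split => // e' ee'.
    by rewrite -eq_k -?word_ltE//; exact: mk.
  by rewrite eq_k -?word_ltE//; exact: mk.
have [c1 m1] := k1 e e0; have [c2 m2] := h1 e e0.
by apply/eqP; rewrite eqn_leq m1 ?cE// m2// -cE.
Qed.

Lemma kappa_kap : kappa W g = kap.
Proof.
by rewrite /kappa; apply: xget_unique => [|k ?]; [exact: kap_spec|exact: kappa_spec_uniq].
Qed.

Lemma stit_cell_hdiv e : stit_cell W g e = cell W (hdiv W g) e.
Proof.
rewrite /stit_cell kappa_kap; congr (cell W _ e).
by apply/funext => e'; exact: kap_hdiv.
Qed.

Lemma stit_alive_cells (Lam : {measure set hyp -> \bar R}) (z : word -> R) t :
  stit Lam W z g t =
  alive_cells (cell_rate Lam W (hdiv W g)) z W (hdiv W g) t.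
Proof.
have lE e : lifetime Lam W z g e = (cell_rate Lam W (hdiv W g) e)^-1 * z e.
  by rewrite /lifetime stit_cell_hdiv.
have bE e : birth Lam W z g e = tbirth (cell_rate Lam W (hdiv W g)) z e.
  by elim: e => //= b p ->; rewrite lE.
rewrite /stit /alive_cells (_ : stit_cell W g = cell W (hdiv W g)); last first.
  by apply/funext => e; exact: stit_cell_hdiv.
by congr (image _ _); apply/funext => e /=; rewrite bE lE.
Qed.

End Kappa.

(** * Probabilities of runs and the sum over trees *)

Section Assembly.
Context (R : realType) (l : nat).
Local Notation V := 'rV[R]_l.+1.
Local Notation hyp := (hyperplane R l).
Variables (Lam : {measure set hyp -> \bar R}) (W : set V).
Hypothesis Lam_neq0 : Lam setT != 0%E.
Hypothesis Lam_inv : translation_invariant Lam.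
Hypothesis Lam_lf : locally_finite Lam.
Hypothesis W_polytope : polytope W.
Hypothesis W_int : W° !=set0.
Context d (Omega : measurableType d) (P : probability Omega R).
Variables (Z : word -> {RV P >-> R}) (G : nat -> {RV P >-> hyp}).
Hypothesis ZG : stit_variables Lam W Z G.
Local Notation nu := (distribution P (G 1%N)).
Local Notation g w := (fun n => G n w).
Local Notation hd w := (hdiv W (fun n => G n w)).
Local Notation zd w := (fun e => Z e w).

Lemma nu_Lamhat B : measurable B -> nu B = Lamhat Lam W B.
Proof. by move=> mB; exact: (G_law ZG). Qed.

Lemma G_past_indep n A B : (0 < n)%N -> <<s past (fun n => G n) n >> A -> measurable B ->
  P (A `&` G n @^-1` B) = (P A * nu B)%E.
Proof.
move=> n0 sA mB.
have -> : nu B = P (G n @^-1` B).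
  by rewrite nu_Lamhat// -(G_law ZG n0 mB).
apply: (@bigcup_independent _ _ _ _ _ _ _ (G_independent ZG) _ _ _
  [set i | (0 < i < n)%N] n) => //.
- by move=> i; exact: preimage_sigma_setI.
- by move=> i; exact: preimage_sigma_setT.
- by move=> i _; exact: preimage_sigma_measurable.
- by move=> i /= /andP[].
- by rewrite /= ltnn andbF.
- by exists B => //; rewrite setTI.
Qed.

(** The almost sure event on which the process agrees with its measurable version built from [hdiv]
    and has positive lifetimes. *)
Definition regular : set Omega := [set w | [/\ forall m, found W (fun n => G n) m w,
  hit W (G 1%N w) & forall e, 0 < Z e w]].

Lemma regular_ae : P.-negligible (~` regular).
Proof.
have mG n : measurable_fun setT (G n) by [].
have W_compact := polytope_compact W_polytope.
apply: (@negligibleS _ _ _ _ (\bigcup_m ~` found W (fun n => G n) m `|`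
    (~` (G 1%N @^-1` hit W) `|` \bigcup_i [set w | Z (word_of i) w <= 0]))).
  move=> w /= nr; apply: contrapT => nw; apply: nr; split.
  - by move=> m; apply: contrapT => nm; apply: nw; left; exists m.
  - by apply: contrapT => nh; apply: nw; right; left.
  - move=> e; rewrite ltNge; apply/negP => ze; apply: nw; right; right.
    by exists (word_index e) => //=; rewrite word_indexK.
apply: negligibleU; last apply: negligibleU.
- apply: negligible_bigcup => m; exists (~` found W (fun n => G n) m); split => //.
    by apply: measurableC; exact: measurable_found.
  apply: (found_ae W_polytope W_int _ _ mG G_past_indep).
    by move=> e h; exact: (hit_prob_gt0 Lam_neq0 Lam_inv Lam_lf W_polytope W_int nu_Lamhat).
  by move=> h e b; exact: (touch_null Lam_inv Lam_lf W_polytope nu_Lamhat).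
- have mW : measurable (~` hit W : set hyp) by apply: measurableC; exact: measurable_hit.
  exists (G 1%N @^-1` (~` hit W)); split => //; first exact: measurable_funPTI.
  transitivity (nu (~` hit W)); first by [].
  by rewrite nu_Lamhat// /Lamhat setICl measure0 mule0.
- apply: negligible_bigcup => i; set e := word_of i.
  have m0 : measurable [set x : R | x <= 0] by rewrite -set_itvNyc.
  exists (Z e @^-1` [set x | x <= 0]); split => //; first exact: measurable_funPTI.
  transitivity (distribution P (Z e) [set x | (x <= 0)%R]); first by [].
  by apply: exp_law_le0 => B mB; exact: (Z_exponential ZG).
Qed.

Variables (t : R) (A : set (set (set V))).
Hypothesis t0 : 0 <= t.
Hypothesis A_tess : tess_sigma W A.

Definition run_event es : set Omega := [set w |
  run (cell_rate Lam W (hd w)) (zd w) t es /\ A (tree_tess W (hd w) es)].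

Lemma indic_run_event es w : (\1_(run_event es) w)%:E =
  run_indicator Lam W t A es (hd w) (zd w).
Proof.
congr EFin; rewrite !indicE -natrM mulnb; congr (nat_of_bool _)%:R.
by apply/idP/andP => [/set_mem[-> ?]|[/set_mem ? ?]]; [split => //|]; exact/mem_set.
Qed.

Lemma measurable_run_indicator es : tree_order es ->
  measurable_fun setT (fun w => run_indicator Lam W t A es (hd w) (zd w)).
Proof.
move=> tes.
apply: (@cmeas2_run_indicator _ _ Lam W nu Lam_neq0 Lam_inv Lam_lf W_polytope W_int
    nu_Lamhat t A es A_tess tes d Omega (fun w => hd w)) => // e.
by apply: measurable_hdiv.
Qed.

Lemma measurable_run_event es : tree_order es -> measurable (run_event es).
Proof.
move=> /measurable_run_indicator m; apply/(@measurable_indicP _ _ R)/measurable_EFinP.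
by move: m; congr measurable_fun; apply/funext => w; rewrite /= indic_run_event.
Qed.

Lemma prob_run_event es : tree_order es ->
  P (run_event es) = foldr (divide W nu) (run_prob Lam W t A es) es point.
Proof.
move=> tes; have ze : exp_law (distribution P (Z [::])) := exp_law_Z ZG.
have mG n : measurable_fun setT (G n) by [].
transitivity (\int[P]_w (\1_(run_event es) w)%:E)%E.
  by rewrite integral_indic ?setIT//; exact: measurable_run_event.
transitivity (\int[P]_w run_indicator Lam W t A es (hd w) (zd w))%E.
  by apply: eq_integral => w _; exact: indic_run_event.
rewrite (integral_zints ZG W_polytope (es ++ tree_leaves es)); last 2 first.
- exact: (cmeas2_run_indicator Lam_neq0 Lam_inv Lam_lf W_polytope W_int nu_Lamhat).
- by move=> h z; exact: run_indicator_ge0.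
transitivity (\int[P]_w run_prob Lam W t A es (hd w))%E.
  by apply: eq_integral => w _;
  exact: (foldr_zint_run_prob Lam_neq0 Lam_inv Lam_lf W_polytope W_int nu_Lamhat).
apply: (integral_tree W_polytope W_int _ _ mG G_past_indep) => //.
- by move=> e h; exact: (hit_prob_gt0 Lam_neq0 Lam_inv Lam_lf W_polytope W_int nu_Lamhat).
- by move=> h e b; exact: (touch_null Lam_inv Lam_lf W_polytope nu_Lamhat).
- exact: (cmeas_run_prob Lam_neq0 Lam_inv Lam_lf W_polytope W_int nu_Lamhat _ _ _ ze).
- by move=> h; exact: run_prob_ge0.
- exact: run_prob_depends_on.
Qed.

Lemma regular_run w : regular w ->
  [/\ (forall e, nondeg W (hd w) e), (forall e, 0 < cell_rate Lam W (hd w) e)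
    & forall e, 0 < Z e w].
Proof.
move=> [fw hw zw]; have nd e := hdiv_nondeg W_int fw e.
by split => // e; apply: lam_cell_gt0.
Qed.

Lemma regular_stit k w : regular w ->
  (stit Lam W (zd w) (g w) t #= `I_k.+1)%card /\ A (stit Lam W (zd w) (g w) t) <->
  exists es, [/\ tree_order es, size es = k & run_event es w].
Proof.
move=> rw; have [nd rate0 z0] := regular_run rw; have [fw hw _] := rw.
rewrite stit_alive_cells//.
have := card_alive_cells rate0 z0 W_polytope nd k t0 (tess_sigma_sub A_tess).
move=> ->; split=> [[es [tes sk res Aes]]|[es [tes sk [res Aes]]]].
  by exists es.
by exists es.
Qed.

End Assembly.

Theorem proposition7p1 (R : realType) (l : nat)
    (Lam : {measure set (hyperplane R l) -> \bar R})
    (Lam_neq0 : Lam setT != 0%E)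
    (Lam_inv : translation_invariant Lam)
    (Lam_lf : locally_finite Lam)
    (Lam_dir : no_common_parallel_line Lam)
    (W : set 'rV[R]_l.+1) (W_window : window W)
    (d : measure_display) (Omega : measurableType d) (P : probability Omega R)
    (Z : word -> {RV P >-> R}) (G : nat -> {RV P >-> hyperplane R l})
    (ZG : stit_variables Lam W Z G)
    (k : nat) (k_ge1 : (1 <= k)%N) (t : R) (t_ge0 : 0 <= t)
    (A : set (set (set 'rV[R]_l.+1))) (A_meas : tess_sigma W A) :
  let Y omega := stit Lam W (fun e => Z e omega) (fun n => G n omega) t in
  prob_mod_null P [set omega | (Y omega #= `I_k.+1)%card /\ A (Y omega)]
    (\sum_(r \in Theta k)
       int_hyperplanes Lam W r k [::] (fun hs =>
         int_times t k [::] (fun ws =>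
           (stit_density Lam W r k t A hs ws)%:E)))%E.
Proof.
move=> Y; have [W_polytope W_int] := W_window.
have [N [mN N0 rN]] := regular_ae Lam_neq0 Lam_inv Lam_lf W_polytope W_int ZG.
have reg w : ~ N w -> regular W Z G w by move=> nw; apply: contrapT => /rN.
(* Different runs are known to exclude each other only where all rates and lifetimes are positive;
   removing the null set [N] makes the union disjoint everywhere. *)
pose E (r : (2 * k).+1.-tuple word) :=
  run_event Lam W Z G t A (rstars r k) `\` N.
have mE r : Theta k r -> measurable (E r).
  move=> /Theta_node_list[_ tes]; apply: measurableD => //.
  exact: measurable_run_event.
exists (\bigcup_(r in Theta k) E r).
  split.
    by apply: fin_bigcup_measurable => //; exact: finite_Theta.
  exists N; split => // w /= nw; apply: contrapT => Nw; apply: nw.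
  rewrite (regular_stit Lam_neq0 Lam_inv Lam_lf W_polytope W_int t_ge0 A_meas k (reg _ Nw)).
  split=> [[es [tes sk ew]]|[r rT [ew _]]]; last first.
    by have [_ tes] := Theta_node_list rT; exists (rstars r k); rewrite size_rstars.
  have sz : size (node_list es) == (2 * k).+1 by rewrite size_node_list sk.
  have rE : rstars (Tuple sz) k = es by rewrite /= -sk rstars_node_list.
  by exists (Tuple sz); [apply: Theta_rstars; rewrite rE|split; rewrite ?rE].
rewrite measure_fin_bigcup//; last 2 first.
- exact: finite_Theta.
- move=> r r' rT r'T [w [[ew Nw] [ew' _]]].
  have [rE tes] := Theta_node_list rT; have [r'E tes'] := Theta_node_list r'T.
  have [nd rate0 z0] := regular_run Lam_neq0 Lam_inv Lam_lf W_polytope W_int (reg _ Nw).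
  apply: val_inj; rewrite /= rE r'E; congr node_list.
  by case: ew ew' => rr _ [rr' _]; exact: (run_uniq rate0 z0 t_ge0 tes tes' rr rr').
apply: eq_fsbigr => r /set_mem rT; have [rE tes] := Theta_node_list rT.
transitivity (P (run_event Lam W Z G t A (rstars r k))).
  have mR := measurable_run_event Lam_neq0 Lam_inv Lam_lf W_polytope W_int ZG t A_meas tes.
  rewrite [RHS](measureDI P mR mN) [X in _ = (_ + X)%E](_ : _ = 0%E) ?adde0//.
  apply/eqP; rewrite eq_le measure_ge0 andbT -N0; apply: le_measure; rewrite ?inE//.
  exact: measurableI.
rewrite prob_run_event//; apply/esym.
exact: (int_hyperplanes_stit Lam_neq0 Lam_inv Lam_lf W_polytope W_int (nu_Lamhat ZG)
  (exp_law_Z ZG)).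
Qed.
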